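(* A (finite) maximal triangle-free graph satisfies property $\mathscr{Q}_4$ if and only if it is a blow-up of either an Andrásfai graph $\Gamma_k$ ($k\ge1$) or a Vega graph $\Upsilon_i^{\mu\nu}$ ($i\ge2$, $\mu,\nu\in\{0,1\}$).
   Context: A graph is maximal triangle-free if it contains no triangle but adding any new edge creates a triangle. A blow-up of $H$ is any graph obtained by replacing each vertex of $H$ by a non-empty independent set and each edge of $H$ by the complete bipartite graph between the corresponding sets, with no further edges. Property $\mathscr{Q}_k$: for every $m\in\{1,\dots,k\}$ and every sequence $x_1,\dots,x_{3m}$ of (not necessarily distinct) vertices of $G$ there is an index set $I\subseteq[3m]$ such that $U=\{x_i:i\in I\}$ is independent and either $|I|\ge m+2$, or $|I|=m+1$ and $U$ has a common neighbour. Andrásfai graph $\Gamma_k$: vertex set $\mathbb Z/(3k-1)\mathbb Z$, $ij$ an edge iff $i-j\in\{k,\dots,2k-1\}$ mod $3k-1$. Vega graphs: for $i\ge2$, $\Upsilon_i^{00}$ has vertex set $\mathbb Z/(3i-1)\mathbb Z\cup\{a,b,c,u,v,w,x,y\}$; edges: those of $\Gamma_i$; the hexagon $av,vc,cu,ub,bw,wa$; all edges from $a,u$ to $\{0,\dots,i-1\}$; from $b,v$ to $\{i,\dots,2i-1\}$; from $c,w$ to $\{2i,\dots,3i-2\}$; and $xa,xb,xc,yu,yv,yw,xy$. Further $\Upsilon_i^{10}=\Upsilon_i^{00}-y$, $\Upsilon_i^{01}=\Upsilon_i^{00}-(2i-1)$, $\Upsilon_i^{11}=\Upsilon_i^{0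0}-\{y,2i-1\}$.
   Formalization: The graph is assumed to have at least two vertices: the one-vertex graph (and the empty graph) is vacuously maximal triangle-free and satisfies Q_4 but is not a blow-up of any Andrásfai or Vega graph. *)

(* Defs.v *)
From mathcomp Require Import all_boot.
Set Implicit Arguments. Unset Strict Implicit. Unset Printing Implicit Defensive.

(* A finite simple graph: T : finType with a symmetric irreflexive rel adj. *)

Definition triangle_free (T : finType) (adj : rel T) : Prop :=
  forall x y z : T, ~ (adj x y /\ adj y z /\ adj x z).

Definition add_edge (T : finType) (adj : rel T) (x y : T) : rel T :=
  fun u v => adj u v || ((u == x) && (v == y)) || ((u == y) && (v == x)).

Definition maximal_triangle_free (T : finType) (adj : rel T) : Prop :=
  triangle_free adj /\
  forall x y : T, x != y -> ~~ adj x y -> ~ triangle_free (add_edge adj x y).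

Definition independent (T : finType) (adj : rel T) (U : {set T}) : Prop :=
  forall u v, u \in U -> v \in U -> ~~ adj u v.

Definition common_neighbour (T : finType) (adj : rel T) (U : {set T}) : Prop :=
  exists z : T, forall u, u \in U -> adj z u.

Definition property_Q (k : nat) (T : finType) (adj : rel T) : Prop :=
  forall m : nat, 1 <= m <= k ->
  forall s : 'I_(3 * m) -> T,
  exists I : {set 'I_(3 * m)},
    let U := [set s i | i in I] in
    independent adj U /\
    (m + 2 <= #|I| \/ (#|I| = m + 1 /\ common_neighbour adj U)).

(* G (on T) is a blow-up of the induced subgraph of (V, e) on the vertex set S:
   a surjection f onto S with x ~ y iff f x ~ f y. The fibres are the
   (non-empty, independent since e is loopless) classes. *)
Definition blowup_on (T : finType) (adj : rel T) (V : finType) (e : rel V)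
    (S : pred V) : Prop :=
  exists f : T -> V,
    (forall x, S (f x)) /\
    (forall v, S v -> exists x, f x = v) /\
    (forall x y, adj x y = e (f x) (f y)).

Definition blowup (T : finType) (adj : rel T) (V : finType) (e : rel V) : Prop :=
  blowup_on adj e predT.

Definition andrasfai_adj (k : nat) (i j : 'I_(3 * k - 1)) : bool :=
  let d := (i + (3 * k - 1) - j) %% (3 * k - 1) in
             (k <= d) && (d <= 2 * k - 1).

(* Vega graphs.  Vertex type 'I_(3i-1) + 'I_8, the extra vertices being
   a=0, b=1, c=2, u=3, v=4, w=5, x=6, y=7. *)
Definition vega_letter_pairs : seq (nat * nat) :=
  [:: (0, 4); (4, 2); (2, 3); (3, 1); (1, 5); (5, 0)   (* hexagon av,vc,cu,ub,bw,wa *)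
   ; (6, 0); (6, 1); (6, 2)
   ; (7, 3); (7, 4); (7, 5)
   ; (6, 7)].

Definition vega_letter_adj (p q : nat) : bool :=
  ((p, q) \in vega_letter_pairs) || ((q, p) \in vega_letter_pairs).

Definition vega_letter_num (i p j : nat) : bool :=
  if (p == 0) || (p == 3) then j < i
  else if (p == 1) || (p == 4) then (i <= j) && (j <= 2 * i - 1)
  else if (p == 2) || (p == 5) then (2 * i <= j) && (j <= 3 * i - 2)
  else false.

Definition vega_adj (i : nat) : rel ('I_(3 * i - 1) + 'I_8) :=
  fun p q =>
    match p, q with
    | inl j, inl j' => andrasfai_adj (k:=i) j j'
    | inl j, inr l => vega_letter_num i l j
    | inr l, inl j => vega_letter_num i l j
    | inr l, inr l' => vega_letter_adj l l'
    end.

Definition vega_vertices (i : nat) (mu nu : bool) : pred ('I_(3 * i - 1) + 'I_8) :=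
  fun p =>
    match p with
    | inl j => ~~ (nu && (nat_of_ord j == 2 * i - 1))
    | inr l => ~~ (mu && (nat_of_ord l == 7))
    end.

Arguments andrasfai_adj k i j : clear implicits.
Arguments vega_adj i p q : clear implicits.
Arguments vega_vertices i mu nu p : clear implicits.

(* Main.v *)
(* Sufficiency: both families carry vertex weights for which every neighbourhood has more than a third of
   the total weight; averaging over the weighted vertices of the blow-up gives property Q for every m.

   Necessity: identify twins. If there is no induced hexagon, then the non-neighbours of a vertex contain
   neither two independent edges nor a pentagon, and this gives a proper 3-colouring. Two vertices of
   different colours are adjacent iff they have no common neighbour in the third class, and by Q_2 the
   neighbourhoods of the vertices of one class in another one are nested; ranking the vertices by their
   degrees into the next class identifies the graph with an Andrasfai graph.

   If there is an induced hexagon, then Q_2 gives it a centre and the Groetzsch graph, i.e. the Vega graph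
   with (i, mu, nu) = (2, 1, 1), maps into the graph. Take the first of the Vega graphs (3, 1, 1),
   (2, 0, 0), (2, 1, 0), (2, 1, 1) that maps into it. Then every vertex has at least two neighbours on the
   hexagon a v c u b w, and no vertex that sees just the neighbours v, w of a is adjacent to one that sees
   just the neighbours b, c of u, and similarly for b, v and c, w: otherwise an earlier graph of the list
   would map into the graph. Since the graph is maximal triangle-free, the traces on the hexagon now
   determine all adjacencies, except between the traces {a, u}, {b, v} and {c, w}, which form a tripartite
   chain as in the 3-coloured case.

   The statements on finitely many vertices are proved by refutation trees found by a computer search and
   replayed by a verified checker. *)
Require Import Defs.
From mathcomp Require Import all_boot zify.
From Stdlib Require Import Classical_Prop.
Set Implicit Arguments. Unset Strict Implicit. Unset Printing Implicit Defensive.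

(** * Refutation certificates *)

(** The parameter i is unbounded while certificates are finite, so the two are kept apart: a finite
    core only serves to choose a good hexagon, and i and nu are read off afterwards from three
    vertex classes of arbitrary size. Both families rest on the same structure on these classes.
    Cyclically, each class is linearly ordered by its neighbourhoods in another one, and adjacency
    is a comparison of ranks. Placing the ranks on consecutive intervals turns each comparison into
    a bound on the difference of positions, and this is the Andrásfai adjacency. Which class comes
    first is not visible from the cyclic symmetry; it is decided by a vertex without neighbours in
    one of the other classes.

    Outside the computer search Q is used in one way only: an alternating triple of every hexagon
    has a common neighbour. The values m = 3 and m = 4 occur only in the refutation trees.

    The finite statements concern maps that may identify vertices and record only some adjacencies.
    A state thus covers all its quotients, and no tree has to split on the equality of two
    vertices. *)

Definition bits_or (a b : bitseq) : bitseq :=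
  (fix go a b := match a, b with
     | [::], _ => b | _, [::] => a
     | x :: a', y :: b' => (x || y) :: go a' b' end) a b.

Lemma nth_bits_or a b i : nth false (bits_or a b) i = nth false a i || nth false b i.
Proof.
elim: a b i => [|x a IH] [|y b] [|i] //=; rewrite ?nth_nil ?orbF //.
Qed.

Definition bit2 (R : seq bitseq) i j :=
  if i < j then nth false (nth [::] R j) i else (j < i) && nth false (nth [::] R i) j.

Definition set2 (R : seq bitseq) i j :=
  let a := minn i j in let b := maxn i j in
  set_nth [::] R b (set_nth false (nth [::] R b) a true).

Lemma bit2C R i j : bit2 R i j = bit2 R j i.
Proof. by rewrite /bit2; case: ltngtP. Qed.

Lemma bit2_set2 R i j a b : bit2 (set2 R i j) a b ->
  [\/ bit2 R a b, a = i /\ b = j | a = j /\ b = i].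
Proof.
wlog ab : a b / a < b => [hw|].
  case: (ltngtP a b) => [|ba|->]; first exact: hw.
    by rewrite bit2C => /(hw _ _ ba)[h|[-> ->]|[-> ->]];
      [constructor 1; rewrite bit2C | constructor 3 | constructor 2].
  by rewrite /bit2 ltnn.
rewrite /bit2 ab /set2 nth_set_nth /=; case: eqP => [->|_]; last by constructor 1.
rewrite nth_set_nth /=; case: eqP => [->|_]; last by constructor 1.
by move=> _; case: (leqP i j) => ij; [constructor 2 | constructor 3];
  split => //; lia.
Qed.

Lemma size_set2 R i j : size (set2 R i j) = maxn (maxn i j).+1 (size R).
Proof. by rewrite size_set_nth. Qed.

(* A state describes finitely many vertices, some adjacencies and some non-adjacencies between them;
   row [j] of [edges] and [nonedges] lists the bits for the vertices [i < j]. *)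
Record state := State { edges : seq bitseq; nonedges : seq bitseq }.

Definition sz (s : state) := size (edges s).

(** Non-adjacencies forced by the absence of loops and triangles are recomputed here instead of
    being stored. *)
Definition nonadj (s : state) i j :=
  [|| i == j, bit2 (nonedges s) i j |
      has (fun k => bit2 (edges s) i k && bit2 (edges s) j k) (iota 0 (sz s))].

Definition add_edge_st s i j := State (set2 (edges s) i j) (nonedges s).
Definition add_nonedge_st s i j := State (edges s) (set2 (nonedges s) i j).
Definition fresh s (D : seq nat) :=
  State (rcons (edges s) [seq i \in D | i <- iota 0 (sz s)]) (nonedges s).

Definition mkst n (E N : seq (nat * nat)) :=
  State (foldl (fun R p => set2 R p.1 p.2) (nseq n [::]) E)
        (foldl (fun R p => set2 R p.1 p.2) [::] N).

(* A certificate refutes a state: [Split i j] decides whether [i] and [j] are adjacent, [Join i j] adds a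
   common neighbour of the non-adjacent [i] and [j], [Prop_Q m sup] applies Q to the multiset [sup] of
   [3 * m] vertices and adds a common neighbour of the resulting set, for each of its possible values, and
   [Instance k f] finds the [k]-th state of the library. *)
Inductive cert : Type :=
| Split of nat & nat & cert & cert
| Join of nat & nat & cert
| Prop_Q of nat & seq (nat * nat) & seq cert
| Instance of nat & seq nat.

Definition units (s : seq nat) := [seq (i, 1) | i <- s].
Definition weight (sup : seq (nat * nat)) := sumn (map snd sup).

(* The independent subsets of [sup] of weight larger than [m], with their weights; [w] and [D] are the
   weight and the elements chosen so far, and [forb] marks their neighbours. *)
Fixpoint heavy (R : seq bitseq) m sup w (D : seq nat) (forb : bitseq) : seq (nat * seq nat) :=
  if sup is (v, k) :: sup' then
    (if m < w + weight sup' then heavy R m sup' w D forb else [::]) ++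
    (if nth false forb v then [::]
     else heavy R m sup' (w + k) (v :: D) (bits_or forb (nth [::] R v)))
  else [:: (w, D)].

(** An adjacency of [p] has to be recorded in [s], whereas a non-adjacency only has to be derivable
    there. The list [f] may repeat vertices. *)
Definition matches (p s : state) (f : seq nat) :=
  let n := sz p in
  all (fun j => all (fun i =>
    (bit2 (edges p) i j ==> bit2 (edges s) (nth 0 f i) (nth 0 f j)) &&
    (bit2 (nonedges p) i j ==> nonadj s (nth 0 f i) (nth 0 f j))) (iota 0 j)) (iota 0 n).

(** In the case [Prop_Q] the bound [o.1 <= m.+1] excludes the alternative of Q with [m + 2] indices,
    so a common neighbour must exist. The list [sup] is decreasing because row [v] of [edges] shows
    only the neighbours below [v]. The inner fixpoint makes the recursion through [seq cert]
    structural. *)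
Fixpoint check (lib : seq state) (s : state) (c : cert) {struct c} : bool :=
  match c with
  | Split i j a b => [&& i < sz s, j < sz s,
      check lib (add_edge_st s i j) a & check lib (add_nonedge_st s i j) b]
  | Join i j c => nonadj s i j && check lib (fresh s [:: i; j]) c
  | Prop_Q m sup cs =>
      [&& 0 < m <= 4, weight sup == 3 * m, sorted gtn (map fst sup) &
       let os := heavy (edges s) m sup 0 [::] [::] in
       all (fun o => o.1 <= m.+1) os &&
       (fix go cs os {struct cs} := match cs with
         | [::] => nilp os
         | c :: cs' => if os is o :: os' then check lib (fresh s o.2) c && go cs' os'
                       else false end) cs os]
  | Instance k f => (k < size lib) && matches (nth (State [::] [::]) lib k) s f
  end.

(** Each checked state joins the library at its end, so the indices in [Instance] run through the
    initial library and then through the states of [l] in order. *)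
Fixpoint check_all (lib : seq state) (l : seq (state * cert)) : bool :=
  if l is (s, c) :: l' then check lib s c && check_all (rcons lib s) l' else true.

(** * Soundness of the checker *)

Section Sound.
Variables (T : finType) (adj : rel T).
Hypothesis adj_sym : symmetric adj.
Hypothesis adj_irr : irreflexive adj.
Hypothesis tf : triangle_free adj.
Hypothesis common : forall x y, ~~ adj x y -> exists z, adj z x && adj z y.
Hypothesis Q4 : property_Q 4 adj.

(** The map [h] may identify vertices. The bound on [nonedges] keeps the index [sz s] free of
    constraints, ready for the vertex added by [fresh]. *)
Definition valid (h : nat -> T) s :=
  [/\ size (nonedges s) <= sz s,
      forall i j, bit2 (edges s) i j -> adj (h i) (h j) &
      forall i j, bit2 (nonedges s) i j -> ~~ adj (h i) (h j)].

Definition refuted s := forall h, ~ valid h s.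

Lemma no_triangle x y z : adj z x -> adj z y -> ~~ adj x y.
Proof. by move=> zx zy; apply/negP => xy; apply: (tf (x := x) (y := y) (z := z)); rewrite xy adj_sym zy adj_sym zx. Qed.

Lemma nonadjP h s i j : valid h s -> nonadj s i j -> ~~ adj (h i) (h j).
Proof.
move=> [_ E N] /or3P[/eqP-> | /N // | /hasP[k _ /andP[/E ik /E jk]]].
  by rewrite adj_irr.
by apply: (@no_triangle _ _ (h k)); rewrite adj_sym.
Qed.

Lemma valid_add_edge h s i j : i < sz s -> j < sz s ->
  valid h s -> adj (h i) (h j) -> valid h (add_edge_st s i j).
Proof.
move=> il jl [S E N] ij; split=> //=; first by rewrite /sz size_set2; apply: leq_trans S (leq_maxr _ _).
by move=> a b /bit2_set2[/E //|[-> ->] //|[-> ->]]; rewrite adj_sym.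
Qed.

Lemma valid_add_nonedge h s i j : i < sz s -> j < sz s ->
  valid h s -> ~~ adj (h i) (h j) -> valid h (add_nonedge_st s i j).
Proof.
move=> il jl [S E N] ij; split=> //=.
  by rewrite size_set2 geq_max S andbT gtn_max il jl.
by move=> a b /bit2_set2[/N //|[-> ->] //|[-> ->]]; rewrite adj_sym.
Qed.

Lemma valid_fresh h s D z : valid h s -> (forall i, i \in D -> adj z (h i)) ->
  valid (fun i => if i == sz s then z else h i) (fresh s D).
Proof.
move=> [S E N] zD; split=> /=.
- by rewrite /sz /= size_rcons ltnW.
- move=> i j; wlog ij : i j / i < j => [hw|].
    case: (ltngtP i j) => [|ji|->]; first exact: hw.
      by rewrite bit2C adj_sym; apply: hw.
    by rewrite /bit2 ltnn.
  rewrite /bit2 ij nth_rcons -/(sz s).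
  case: (ltngtP j (sz s)) => [js|js|js]; last rewrite js in ij.
  + have -> : (i == sz s) = false by lia.
    by move=> b; apply: E; rewrite /bit2 ij.
  + by rewrite nth_nil.
  + have -> : (i == sz s) = false by lia.
    case: (ltnP i (sz s)) => [il|il]; last by rewrite nth_default // size_map size_iota.
    rewrite (nth_map 0) ?size_iota // nth_iota // add0n => iD.
    by rewrite adj_sym; apply: zD.
- move=> i j b.
  (* No recorded non-adjacency involves the new index, so changing [h] there does no harm. *)
  have bd a c : bit2 (nonedges s) a c -> a < sz s.
    have oob e : sz s <= e -> nth [::] (nonedges s) e = [::].
      by move=> se; rewrite nth_default // (leq_trans S se).
    rewrite /bit2; case: ltnP => ac; case: (ltnP a (sz s)) => // sa.
      by rewrite oob ?nth_nil // (leq_trans sa (ltnW ac)).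
    by rewrite oob ?nth_nil ?andbF.
  have il := bd _ _ b; have jl : j < sz s by apply: (bd j i); rewrite bit2C.
  by rewrite (ltn_eqF il) (ltn_eqF jl); exact: N.
Qed.

Lemma matches_valid h p s f : valid h s -> size (nonedges p) <= sz p -> matches p s f ->
  valid (fun i => h (nth 0 f i)) p.
Proof.
move=> v S /allP mt; have [_ E _] := v.
have key i j : i < j -> (bit2 (edges p) i j -> adj (h (nth 0 f i)) (h (nth 0 f j))) /\
    (bit2 (nonedges p) i j -> ~~ adj (h (nth 0 f i)) (h (nth 0 f j))).
  move=> ij; case: (ltnP j (sz p)) => jl; last first.
    by rewrite /bit2 ij !(nth_default [::]) ?nth_nil //; apply: leq_trans S jl.
  have /mt/allP/(_ i) : j \in iota 0 (sz p) by rewrite mem_iota.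
  rewrite mem_iota ij => /(_ isT) /andP[/implyP e /implyP n].
  by split=> [/e /E //|/n]; apply: nonadjP.
split=> // i j; case: (ltngtP i j) => ij.
- by case: (key _ _ ij).
- by rewrite bit2C adj_sym; case: (key _ _ ij).
- by rewrite ij /bit2 ltnn.
- by case: (key _ _ ij).
- by rewrite bit2C adj_sym; case: (key _ _ ij).
- by rewrite ij /bit2 ltnn.
Qed.

Definition wt (P : pred nat) (sup : seq (nat * nat)) := sumn [seq p.2 | p <- sup & P p.1].

(** The branch of the search that follows [P] is never cut off: as [P] is independent, [forb] marks
    none of its elements, and the weight still to come keeps the bound above [m]. *)
Lemma heavy_complete h s m (P : pred nat) : valid h s ->
  (forall i j, P i -> P j -> ~~ adj (h i) (h j)) ->
  forall sup w D forb, sorted gtn (map fst sup) ->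
    (forall v, nth false forb v -> v \in map fst sup -> exists2 u, P u & adj (h u) (h v)) ->
    m < w + wt P sup ->
    exists2 D', (w + wt P sup, D') \in heavy (edges s) m sup w D forb &
      forall v, v \in D' -> v \in D \/ (v \in map fst sup /\ P v).
Proof.
move=> [S E N] indep; elim=> [|[v k] sup IH] w D forb /= srt hf.
  by rewrite /wt /= addn0 => lt; exists D => [|v vD]; [rewrite inE | left].
have srt' : sorted gtn (map fst sup) by case: (map fst sup) srt => //= ? ? /andP[].
rewrite /wt /=; case: ifP => Pv /= lt.
  have nf : nth false forb v = false.
    apply/negP => /hf; rewrite inE eqxx => /(_ isT)[u Pu].
    by apply/negP; exact: indep.
  have hf' x : nth false (bits_or forb (nth [::] (edges s) v)) x ->
      x \in map fst sup -> exists2 u, P u & adj (h u) (h x).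
    rewrite nth_bits_or => /orP[fx xs|bx xs].
      by apply: hf => //; rewrite inE xs orbT.
    exists v => //; rewrite adj_sym; apply: E; rewrite /bit2.
    (* The list decreases, so the bit for [x] and [v] stands in row [v]. *)
    have -> : x < v; last by [].
    have := srt; rewrite path_sortedE; last first.
      by move=> a b c /= h1 h2; apply: ltn_trans h2 h1.
    by move=> /andP[/allP/(_ x xs)].
  have lt' : m < w + k + wt P sup by rewrite -addnA.
  have [D' in1 in2] := IH (w + k) (v :: D) _ srt' hf' lt'.
  exists D'; first by rewrite mem_cat nf addnA in1 orbT.
  move=> x /in2[|[xs Px]]; last by right; rewrite inE xs orbT.
  by rewrite inE => /orP[/eqP->|]; [right; rewrite inE eqxx | left].
have le : wt P sup <= weight sup.
  rewrite /wt /weight; elim: (sup) => //= -[a b] l; case: ifP => //= _; lia.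
have lt' : m < w + wt P sup by [].
have hf' x : nth false forb x -> x \in map fst sup -> exists2 u, P u & adj (h u) (h x).
  by move=> fx xs; apply: hf => //; rewrite inE xs orbT.
have [D' in1 in2] := IH w D forb srt' hf' lt'.
exists D'; first by rewrite mem_cat ifT ?in1 //; lia.
by move=> x /in2[|[xs Px]]; [left | right; rewrite inE xs orbT].
Qed.

(** The values at the indices given by Q are independent, and their weight in [sup] is at least the
    number of indices, hence above [m]. So [heavy] lists this set, and the bound [m.+1] on its
    weight leaves only the alternative with a common neighbour. *)
Lemma property_Q_option h s m sup : valid h s -> 0 < m <= 4 -> weight sup = 3 * m ->
  sorted gtn (map fst sup) ->
  (forall o, o \in heavy (edges s) m sup 0 [::] [::] -> o.1 <= m.+1) ->
  exists o z, o \in heavy (edges s) m sup 0 [::] [::] /\ (forall i, i \in o.2 -> adj z (h i)).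
Proof.
move=> v mle wE srt small.
pose L := flatten [seq nseq p.2 p.1 | p <- sup].
have szL : size L = 3 * m.
  rewrite -wE /L /weight size_flatten /shape -map_comp; congr sumn.
  by apply: eq_map => -[a b] /=; rewrite size_nseq.
have [I [ind big]] := Q4 mle (fun i => h (nth 0 L i)).
pose P i := [exists j in I, nth 0 L j == i].
have Pind i j : P i -> P j -> ~~ adj (h i) (h j).
  move=> /exists_inP[a aI /eqP<-] /exists_inP[b bI /eqP<-].
  by apply: ind; apply/imsetP; [exists a | exists b].
(* Only an inequality: an index outside [I] may have the same value as one in [I], and the weight
   counts it too. *)
have cnt : #|I| <= wt P sup.
  have -> : wt P sup = count P L.
    rewrite /wt /L; elim: (sup) => //= -[a b] l IH.
    by rewrite count_cat count_nseq /= -IH; case: (P a); rewrite /= ?mul1n ?mul0n.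
  have -> : L = [seq nth 0 L (i : 'I_(3 * m)) | i <- enum 'I_(3 * m)].
    have szE := size_enum_ord (3 * m).
    apply: (@eq_from_nth _ 0) => [|i]; first by rewrite size_map szE.
    rewrite szL => il.
    by rewrite (nth_map (Ordinal il)) ?szE // nth_enum_ord.
  rewrite count_map cardE -size_filter; apply: uniq_leq_size.
    by rewrite enum_uniq.
  move=> i; rewrite mem_enum mem_filter mem_enum andbT /= => iI.
  by apply/exists_inP; exists i.
have mI : m < #|I| by case: big => [|[-> _]]; lia.
have nf u : nth false [::] u -> u \in map fst sup -> exists2 t, P t & adj (h t) (h u).
  by rewrite nth_nil.
have lt : m < 0 + wt P sup by rewrite add0n; apply: leq_trans mI cnt.
have [D inD subD] := heavy_complete v Pind [::] srt nf lt.
rewrite add0n in inD.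
have wm := small _ inD; rewrite /= in wm.
case: big => [|[cI [z zI]]]; first by lia.
exists (wt P sup, D), z; split=> // i /subD[//|[_ /exists_inP[j jI /eqP <-]]].
by apply: zI; apply/imsetP; exists j.
Qed.

Lemma check_sound lib c s h :
  (forall k, k < size lib -> refuted (nth (State [::] [::]) lib k)) ->
  all (fun p => size (nonedges p) <= sz p) lib ->
  check lib s c -> valid h s -> False.
Proof.
(* The type [cert] is nested in [seq], so the recursion is set up by hand and the list of options
   gets an induction of its own. *)
move=> Hlib Slib; move: c s h; fix IH 1 => c s h; case: c => [i j a b|i j c|m sup cs|k f] /=.
- move=> /and4P[il jl ca cb] v; case: (boolP (adj (h i) (h j))) => ij.
    exact: (IH _ _ _ ca (valid_add_edge il jl v ij)).
  exact: (IH _ _ _ cb (valid_add_nonedge il jl v ij)).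
- move=> /andP[nij cc] v.
  have [z /andP[zi zj]] := common (nonadjP v nij).
  apply: (IH _ _ _ cc (valid_fresh (z := z) v _)) => k.
  by rewrite !inE => /orP[] /eqP ->.
- move=> /and4P[mle /eqP wE srt /andP[/allP small go]] v.
  have [o [z [oin oz]]] := property_Q_option v mle wE srt small.
  move: (heavy _ _ _ _ _ _) oin go {small} => os.
  elim: cs os => [|c cs IHcs] [|o' os] //=.
  rewrite inE => /orP[/eqP<- /andP[cc _]|oin /andP[_ go]]; last exact: IHcs oin go.
  exact: (IH _ _ _ cc (valid_fresh v oz)).
- move=> /andP[kl mt] v; apply: (Hlib k kl _ (matches_valid v _ mt)).
  by apply: (all_nthP _ Slib).
Qed.

Lemma check_all_sound lib l :
  (forall k, k < size lib -> refuted (nth (State [::] [::]) lib k)) ->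
  all (fun p => size (nonedges p) <= sz p) lib ->
  all (fun p => size (nonedges p.1) <= sz p.1) l ->
  check_all lib l -> forall k, k < size l -> refuted (nth (State [::] [::], Join 0 0 (Instance 0 [::])) l k).1.
Proof.
elim: l lib => //= -[s c] l IH lib Hlib Slib /= /andP[Ss Sl] /andP[cs call].
have rs : refuted s by move=> h; exact: check_sound cs.
move=> [|k] //= kl; apply: (IH (rcons lib s)) => //.
  move=> j; rewrite size_rcons nth_rcons ltnS => jl.
  case: ltnP => [jl'|sj]; first exact: Hlib.
  have -> : j = size lib by apply/eqP; rewrite eqn_leq jl.
  by rewrite eqxx.
by rewrite all_rcons Ss.
Qed.
End Sound.

(** * Weighted graphs have property Q *)

(** Count weighted pairs of [v] and [i] with [r v] adjacent to [s i]. Every index contributes more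
    than a third of the total weight, so among [3 * m] indices some [r v] sees more than [m]. What
    it sees is independent and has [r v] as common neighbour. *)
Lemma property_Q_of_weights (T : finType) (adj : rel T) (V : finType)
    (w : V -> nat) (r : V -> T) k : triangle_free adj -> symmetric adj ->
  (forall x, \sum_v w v < 3 * \sum_v w v * adj (r v) x) -> property_Q k adj.
Proof.
move=> tf sym deg m /andP[m1 _] s.
pose N v := [set i | adj (r v) (s i)].
have [v vN] : exists v, m < #|N v|.
  apply/existsP; rewrite -[X in is_true X]negbK negb_exists; apply/negP => /forallP le.
  have : \sum_(i < 3 * m) \sum_v w v < \sum_(i < 3 * m) 3 * \sum_v w v * adj (r v) (s i).
    have i0 : 'I_(3 * m) by apply: (@Ordinal _ 0); lia.
    rewrite (bigD1 i0) //= [X in _ < X](bigD1 i0) //= -addSn; apply: leq_add; first exact: deg.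
    by apply: leq_sum => i _; apply: ltnW.
  rewrite sum_nat_const card_ord -big_distrr /= exchange_big /= ltnNge => /negP; apply.
  rewrite -mulnA leq_mul2l /= big_distrr /=; apply: leq_sum => v _.
  rewrite -big_distrr /= [m * _]mulnC leq_mul2l; apply/orP; right.
  have := le v; rewrite -leqNgt; congr (_ <= _).
  by rewrite -sum1dep_card big_mkcond /=; apply: eq_bigr => i _; case: (adj _ _).
have ind (I : {set 'I_(3 * m)}) : I \subset N v -> independent adj [set s i | i in I].
  move=> /subsetP sI _ _ /imsetP[i /sI + ->] /imsetP[j /sI + ->]; rewrite !inE => vi vj.
  by apply/negP => ij; apply: (tf (r v) (s i) (s j)).
have [I IN cI] : exists2 I : {set 'I_(3 * m)}, I \subset N v & #|I| = m.+1.
  have : 0 < #|[set I : {set 'I_(3 * m)} | I \subset N v & #|I| == m.+1]|.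
    by rewrite cards_draws bin_gt0.
  by case/card_gt0P => I; rewrite inE => /andP[IN /eqP]; exists I.
exists I; split; first exact: ind.
right; rewrite cI addn1; split=> //; exists (r v) => _ /imsetP[i /(subsetP IN) + ->].
by rewrite inE.
Qed.

(** The interval from k to 2k - 1 is symmetric under d -> 3k - 1 - d, so the cyclic difference may
    be replaced by the absolute one, which is [i - j + (j - i)] with truncated subtraction. *)
Lemma andrasfai_adjE k (i j : 'I_(3 * k - 1)) : 0 < k ->
  andrasfai_adj k i j = (k <= i - j + (j - i) <= 2 * k - 1).
Proof.
move=> k0; rewrite /andrasfai_adj; have := ltn_ord i; have := ltn_ord j.
move: (nat_of_ord i) (nat_of_ord j) => {i j} i j jl il.
case: (leqP j i) => ij.
  have -> : i + (3 * k - 1) - j = (i - j) + (3 * k - 1) by lia.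
  by rewrite modnDr modn_small; lia.
by rewrite modn_small; lia.
Qed.

Lemma sum_interval n a b : \sum_(i < n) (a <= i < b) = minn b n - a.
Proof.
elim: n => [|n IH]; first by rewrite big_ord0 minn0.
by rewrite big_ord_recr /= IH; case: (leqP a n); case: (ltnP n b) => /=; lia.
Qed.

Lemma andrasfai_degree k (j : 'I_(3 * k - 1)) : 0 < k ->
  \sum_(i < 3 * k - 1) andrasfai_adj k i j = k.
Proof.
move=> k0.
(* Neighbours above [j] and neighbours below [j]. The bound is written [(j + 1) - k] since
   [j - k + 1] would be 1 instead of 0 for [j < k]. *)
transitivity (\sum_(i < 3 * k - 1) ((j + k <= i < j + 2 * k) : nat) +
              \sum_(i < 3 * k - 1) (((j + 1) - 2 * k <= i < (j + 1) - k) : nat)).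
  rewrite -big_split; apply: eq_bigr => i _; rewrite andrasfai_adjE //.
  have := ltn_ord i; have := ltn_ord j; move: (nat_of_ord i) (nat_of_ord j) => a b.
  by case: (leqP (b + k) a); case: (ltnP a (b + 2 * k)); case: (leqP (b + 1 - 2 * k) a);
    case: (ltnP a (b + 1 - k)); case: (leqP k _); case: (leqP _ (2 * k - 1)) => /=; lia.
rewrite !sum_interval; have := ltn_ord j; move: (nat_of_ord j) => b; lia.
Qed.

Lemma property_Q_blowup_on (T : finType) (adj : rel T) (V : finType) (e : rel V)
    (S : pred V) (w : V -> nat) k :
  triangle_free adj -> symmetric adj -> blowup_on adj e S ->
  (forall v, ~~ S v -> w v = 0) ->
  (forall p, S p -> \sum_v w v < 3 * \sum_v w v * e v p) -> property_Q k adj.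
Proof.
move=> tf sym [f [fS [surj fe]]] w0 deg m mk s.
have x0 : T by apply: s; apply: (@Ordinal _ 0); lia.
(* The default [x0] is taken only for [v] outside [S], where the weight is 0. *)
pose r v := odflt x0 [pick x | f x == v].
apply: (property_Q_of_weights (w := w) (r := r) (k := k)) => // x.
have -> : \sum_v w v * adj (r v) x = \sum_v w v * e v (f x); last exact: deg.
apply: eq_bigr => v _; case: (boolP (S v)) => [Sv|/w0 ->] //; rewrite fe.
rewrite /r; case: pickP => [y /eqP-> //|none].
by have [y fy] := surj v Sv; have := none y; rewrite fy eqxx.
Qed.

Lemma andrasfai_property_Q (T : finType) (adj : rel T) k n :
  triangle_free adj -> symmetric adj -> 0 < k -> blowup adj (andrasfai_adj k) ->
  property_Q n adj.
Proof.
move=> tf sym k0 bl; apply: (property_Q_blowup_on (w := fun=> 1) (k := n) tf sym bl) => // p _.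
under [X in _ < 3 * X]eq_bigr do rewrite mul1n.
(* Three times the degree [k] exceeds the number [3 * k - 1] of vertices by one. *)
by rewrite andrasfai_degree // sum_nat_const card_ord; lia.
Qed.

(* With these weights 3 times the weighted degree of each vertex is the total weight plus one. *)
Definition num_weight i (nu : bool) j :=
  if nu then (if j == 2 * i - 1 then 0 else if (j == 0) || (j == i - 1) then 2 else 3)
  else (if (j == 0) || (j == 2 * i - 1) then 1 else 3).

Definition letter_weight i (mu nu : bool) l :=
  nth 0 (match mu, nu with
  | false, false => [:: 3*i-2; 3*i-2; 3*i-3; 3*i-2; 3*i-2; 3*i-3; 1; 1]
  | true, false => [:: 3*i-2; 3*i-2; 3*i-3; 3*i-3; 3*i-3; 3*i-4; 2; 0]
  | false, true => [:: 3*i-2; 3*i-3; 3*i-3; 3*i-2; 3*i-3; 3*i-3; 1; 1]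
  | true, true => [:: 3*i-2; 3*i-3; 3*i-3; 3*i-3; 3*i-4; 3*i-4; 2; 0]
  end) l.

Lemma sum_indicator n c (P : pred nat) : c < n -> \sum_(j < n) (j == c :> nat) * P j = P c.
Proof.
move=> cn; rewrite (bigD1 (Ordinal cn)) //= eqxx mul1n big1 ?addn0 // => j.
by rewrite -val_eqE /= => /negbTE ->.
Qed.

(** The weights fall short of 3 at two or three numbers only. Adding the deficits on the left avoids
    truncated subtraction and reduces every weighted sum to counting. *)
Lemma sum_num_weight i nu (P : pred nat) : 1 < i ->
  \sum_(j < 3 * i - 1) num_weight i nu j * P j +
  (if nu then 3 * P (2 * i - 1) + P 0 + P (i - 1) else 2 * P 0 + 2 * P (2 * i - 1))
  = 3 * \sum_(j < 3 * i - 1) P j.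
Proof.
move=> i1.
have h c : c < 3 * i - 1 -> P c = \sum_(j < 3 * i - 1) (j == c :> nat) * P j :> nat.
  by move=> ?; rewrite sum_indicator.
case: nu; rewrite (h 0) ?(h (2 * i - 1)) ?(h (i - 1)) ?big_distrr /= -?big_split /=; try lia.
  apply: eq_bigr => j _; rewrite /num_weight; case: (P j); rewrite ?muln0 // ?muln1.
  by case: eqP => a; case: eqP => b; case: eqP => c /=; lia.
apply: eq_bigr => j _; rewrite /num_weight; case: (P j); rewrite ?muln0 // ?muln1.
by case: eqP => a; case: eqP => b /=; lia.
Qed.

Lemma sum_num_block i nu (a b : nat) : 1 < i ->
  \sum_(j < 3 * i - 1) num_weight i nu j * (a <= j < b) =
  3 * (minn b (3 * i - 1) - a) -
  (if nu then 3 * (a <= 2 * i - 1 < b) + (a <= 0 < b) + (a <= i - 1 < b)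
   else 2 * (a <= 0 < b) + 2 * (a <= 2 * i - 1 < b)).
Proof.
by move=> i1; have := sum_num_weight nu (fun j => a <= j < b) i1; rewrite sum_interval; lia.
Qed.

Lemma vega_property_Q (T : finType) (adj : rel T) i mu nu n :
  triangle_free adj -> symmetric adj -> 1 < i ->
  blowup_on adj (vega_adj i) (vega_vertices i mu nu) -> property_Q n adj.
Proof.
move=> tf sym i1 bl.
pose w (p : 'I_(3 * i - 1) + 'I_8) :=
  match p with inl j => num_weight i nu j | inr l => letter_weight i mu nu l end.
have sA : \sum_(j < 3 * i - 1) num_weight i nu j * (0 <= j < i) = 3 * i - 2.
  by rewrite sum_num_block //; clear -i1; case: nu; lia.
have sB : \sum_(j < 3 * i - 1) num_weight i nu j * (i <= j < 2 * i) = if nu then 3 * i - 3 else 3 * i - 2.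
  by rewrite sum_num_block //; clear -i1; case: nu; lia.
have sC : \sum_(j < 3 * i - 1) num_weight i nu j * (2 * i <= j < 3 * i - 1) = 3 * i - 3.
  by rewrite sum_num_block //; clear -i1; case: nu; lia.
have blk (l : 'I_8) : \sum_(j < 3 * i - 1) num_weight i nu j * vega_letter_num i l j =
   if (l == 0 :> nat) || (l == 3 :> nat) then \sum_(j < 3 * i - 1) num_weight i nu j * (0 <= j < i)
   else if (l == 1 :> nat) || (l == 4 :> nat) then \sum_(j < 3 * i - 1) num_weight i nu j * (i <= j < 2 * i)
   else if (l == 2 :> nat) || (l == 5 :> nat) then
     \sum_(j < 3 * i - 1) num_weight i nu j * (2 * i <= j < 3 * i - 1) else 0.
  rewrite /vega_letter_num; case: ifP => _; first by [].
  case: ifP => _; first by apply: eq_bigr => j _; congr (_ * _); lia.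
  case: ifP => _; first by apply: eq_bigr => j _; congr (_ * _); have := ltn_ord j; lia.
  by apply: big1 => j _; rewrite muln0.
have tot : \sum_(j < 3 * i - 1) num_weight i nu j = \sum_(j < 3 * i - 1) num_weight i nu j * (0 <= j < 3 * i - 1).
  by apply: eq_bigr => j _; rewrite ltn_ord muln1.
have sT : \sum_(j < 3 * i - 1) num_weight i nu j * (0 <= j < 3 * i - 1) = if nu then 9 * i - 8 else 9 * i - 7.
  by rewrite sum_num_block //; clear -i1; case: nu; lia.
apply: (property_Q_blowup_on (w := w) (k := n) tf sym bl) => [[j|l]|].
- by rewrite /= negbK => /andP[-> /eqP ->]; rewrite /num_weight eqxx.
- by rewrite /= negbK => /andP[muT /eqP ->]; move: muT; rewrite /letter_weight; clear; case: mu nu => -[].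
- move=> p Sp; rewrite /w !big_sumType /= tot sT.
  clear bl w; case: p Sp => [q /= Sq|l].
    (* The numbers contribute to the weighted degree of [q] three times its Andrásfai degree [i],
       less the deficits at those of [0], [i - 1] and [2 * i - 1] that are adjacent to [q]; the two
       letters of its block are added to this. *)
    have := sum_num_weight nu (fun j => i <= j - q + (q - j) <= 2 * i - 1) i1.
    have <- : \sum_(j < 3 * i - 1) andrasfai_adj i j q = \sum_(j < 3 * i - 1) (i <= j - q + (q - j) <= 2 * i - 1).
      by apply: eq_bigr => j _; rewrite andrasfai_adjE //; lia.
    rewrite andrasfai_degree; last lia.
    have -> : \sum_(j < 3 * i - 1) num_weight i nu j * andrasfai_adj i j q =
       \sum_(j < 3 * i - 1) num_weight i nu j * (i <= j - q + (q - j) <= 2 * i - 1).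
      by apply: eq_bigr => j _; rewrite andrasfai_adjE //; lia.
    move: (\sum_(j < 3 * i - 1) num_weight i nu j * (i <= j - q + (q - j) <= 2 * i - 1)) => D.
    rewrite !big_ord_recl !big_ord0 /= /vega_letter_num /=.
    have := ltn_ord q; move: (nat_of_ord q) Sq => {sA sB sC blk tot sT} q' Sq ql.
    have -> : (i <= 0 - q' + (q' - 0) <= 2 * i - 1) = (i <= q' <= 2 * i - 1) by rewrite sub0n subn0.
    have -> : (i <= 2 * i - 1 - q' + (q' - (2 * i - 1)) <= 2 * i - 1) = (q' < i).
      by apply/idP/idP; lia.
    have -> : (i <= i - 1 - q' + (q' - (i - 1)) <= 2 * i - 1) = (2 * i - 1 <= q').
      by apply/idP/idP; lia.
    rewrite /=.
    case: (ltnP q' i) => qi; [|case: (ltnP q' (2 * i)) => q2i].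
    - have [e1 e2] : (2 * i - 1 <= q') = false /\ (2 * i <= q') = false by split; lia.
      by rewrite ?e1 ?e2 /= /letter_weight; case: mu; case: nu Sq => /=; lia.
    - have e1 : (q' <= 2 * i - 1) = true by lia.
      by rewrite ?e1 /= /letter_weight; case: mu; case: nu Sq => /=; lia.
    - have [e1 e2 e3] : [/\ (2 * i - 1 <= q') = true, (q' <= 2 * i - 1) = false &
        (q' <= 3 * i - 2) = true] by split; lia.
      by rewrite ?e1 ?e2 ?e3 /= /letter_weight; case: mu; case: nu Sq => /=; lia.
  move: (blk l); rewrite sA sB sC => ->.
  rewrite !big_ord_recl !big_ord0 /=.
  case: l => -[|[|[|[|[|[|[|[|l]]]]]]]] //= ll Sl; rewrite /vega_letter_adj /=;
  case: mu Sl; case: nu {sA sB sC blk tot sT}; rewrite /letter_weight //= => _; lia.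
Qed.

(** * Tripartite chains *)

Section Rank.
Variables (T U : finType) (A : {set T}) (C : {set U}) (N : T -> {set U}).
Hypothesis subC : forall x, x \in A -> N x \subset C.
Hypothesis chainN : forall x y, x \in A -> y \in A -> (N x \subset N y) || (N y \subset N x).
Hypothesis injN : {in A &, injective N}.
Hypothesis sepN : forall z z', z \in C -> z' \in C ->
  (forall x, x \in A -> (z \in N x) = (z' \in N x)) -> z = z'.

Definition below x := [set y in A | N y \subset N x].
Definition has_empty := [exists x in A, N x == set0].

(** Each set of the chain exceeds its predecessor by exactly one element, since two new elements
    would be separated by a set strictly in between. So rank and size grow together, with a shift by
    one if the chain starts at the empty set. *)
Lemma card_below x : x \in A -> #|below x| = #|N x| + has_empty.
Proof.
have [n] := ubnP #|N x|; elim: n x => // n IH x /ltnSE le xA.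
have ssub y : y \in A -> ~~ (N x \subset N y) -> N y \proper N x.
  by move=> yA ns; rewrite properE ns andbT; have := chainN yA xA; rewrite (negbTE ns) orbF.
pose P y := (y \in A) && (N y \proper N x).
case: (pickP P) => [y0 Py0 | noP].
  case: (@arg_maxnP _ y0 P (fun y => #|N y|) Py0) => y /andP[yA yx] ymax.
  have one : #|N x :\: N y| = 1.
    have : N x :\: N y != set0 by rewrite setD_eq0 (proper_subn yx).
    case/set0Pn => z zD; apply/eqP/cards1P; exists z; apply/setP => z'; rewrite inE.
    apply/idP/eqP => [z'D|->//]; move: zD z'D; rewrite !inE => /andP[zy zx] /andP[z'y z'x].
    have xC := subsetP (subC xA); apply: sepN => [||w wA]; rewrite ?xC //.
    (* Such a set [N w] lies strictly between [N y] and [N x], against the choice of [y]. *)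
    have aux t t' : t \notin N y -> t' \in N x -> t \in N w -> t' \notin N w -> False.
      move=> ty t'x tw t'w; have wx : N w \proper N x.
        by apply: ssub => //; apply/negP => /subsetP/(_ _ t'x); apply/negP.
      have := ymax w; rewrite /P wA wx => /(_ isT); apply/negP; rewrite -ltnNge.
      apply: proper_card; rewrite properE; apply/andP; split; last first.
        by apply/negP => /subsetP/(_ _ tw); apply/negP.
      case/orP: (chainN yA wA) => // /subsetP/(_ _ tw) ty'; by rewrite ty' in ty.
    by apply/idP/idP => h; apply/negPn/negP => h'; [apply: (aux z' z) | apply: (aux z z')];
      rewrite ?h //; apply: (aux z z').
  have cN : #|N x| = #|N y|.+1.
    by rewrite -(cardsID (N y)) one (setIidPr (proper_sub yx)) addn1.
  have -> : below x = x |: below y.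
    apply/setP => w; rewrite !inE; apply/andP/orP => [[wA wx]|[/eqP->|/andP[wA wy]]] //.
      case: (eqVneq w x) => [|wnx]; [by left | right; rewrite wA /=].
      have pw : N w \proper N x.
        rewrite properEneq wx andbT; apply/eqP => /(injN wA xA) e; by rewrite e eqxx in wnx.
      have {}ymax := ymax w; have cw : #|N w| <= #|N y| by apply: ymax; rewrite /P wA pw.
      case/orP: (chainN wA yA) => // yw; have := subset_leqif_cards yw => -[_ /esym e].
      have : N y == N w by rewrite e eqn_leq subset_leq_card.
      by move/eqP ->.
    by split=> //; apply: subset_trans wy (proper_sub yx).
  rewrite cardsU1 !inE xA /= (negbTE (proper_subn yx)) /= IH // ?cN ?addSn //.
  by rewrite -ltnS -cN.
have -> : below x = [set x].
  apply/setP => w; rewrite !inE; apply/andP/eqP => [[wA wx]|->//].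
  have := noP w; rewrite /P wA /= properE wx /= => /negbFE xw.
  by apply: injN => //; apply/eqP; rewrite eqEsubset wx.
(* Now [N x] is the least set of the chain: it is empty or, by separation, a singleton. *)
rewrite cards1; case: (boolP has_empty) => [/exists_inP[w wA /eqP w0]|ne].
  have -> : N x = set0; last by rewrite cards0.
  by apply/eqP; have := noP w; rewrite /P wA /= properE w0 sub0set /= => /negbFE; rewrite subset0.
have : N x != set0 by apply: contra ne => x0; apply/exists_inP; exists x.
case/set0Pn => z zx; rewrite addn0; apply/esym/eqP/cards1P; exists z.
apply/setP => z'; rewrite inE; apply/idP/eqP => [z'x|->//].
have xC := subsetP (subC xA).
apply: sepN; rewrite ?xC // => w wA.
have xw : N x \subset N w.
  case/orP: (chainN xA wA) => // wx; have := noP w; rewrite /P wA /= properE wx.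
  by move/negbFE.
by rewrite !(subsetP xw).
Qed.

(** The last vertex of the chain has rank [#|A|], and by separation its set misses at most one point
    of [C], namely one that lies in no set of the chain. *)
Lemma card_chain : 0 < #|A| ->
  #|A| + [exists z in C, [forall x in A, z \notin N x]] = #|C| + has_empty.
Proof.
case/card_gt0P => x0 x0A.
case: (@arg_maxnP _ x0 (mem A) (fun y => #|N y|) x0A) => x xA xmax.
have top y : y \in A -> N y \subset N x.
  move=> yA; case/orP: (chainN yA xA) => // xy; have := subset_leqif_cards xy => -[_ /esym e].
  have le : #|N y| <= #|N x| by apply: xmax.
  by have : N x == N y; [rewrite e eqn_leq le subset_leq_card | move/eqP ->].
have -> : #|A| = #|below x|.
  by apply: eq_card => y; rewrite inE; case: (boolP (y \in A)) => //= /top ->.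
rewrite card_below // addnAC; congr (_ + _).
have NC := subC xA.
have -> : #|C| = #|N x| + #|C :\: N x| by rewrite -(cardsID (N x) C) (setIidPr NC).
congr (_ + _); case: (boolP [exists z in C, _]) => [/exists_inP[z zC /forall_inP nz]|ne].
  apply/esym/eqP/cards1P; exists z; apply/setP => z'; rewrite !inE.
  apply/andP/eqP => [[z'x z'C]|->]; last by rewrite nz.
  apply: sepN => // w wA; rewrite (negbTE (nz w wA)); apply/negbTE.
  by apply: contra z'x; apply: (subsetP (top w wA)).
apply/esym/eqP; rewrite cards_eq0; apply/eqP/setP => z; rewrite !inE; apply/negP => /andP[zx zC].
case/negP: ne; apply/exists_inP; exists z => //; apply/forall_inP => w wA.
by apply: contra zx; apply: (subsetP (top w wA)).
Qed.
End Rank.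

(** * Three classes whose mutual neighbourhoods form chains *)

Section Tripartite.
Variables (T : finType) (adj : rel T).
Hypothesis sym : symmetric adj.

Definition nbr (X : {set T}) x := [set y in X | adj x y].
Definition isolated (X Y : {set T}) := [exists x in X, nbr Y x == set0].

(* Two vertices of different parts are adjacent unless the third part contains a common neighbour. *)
Definition determined (X Y Z : {set T}) :=
  forall x y, x \in X -> y \in Y -> adj x y = ~~ [exists z in Z, adj x z && adj z y].
Definition nested (X Y : {set T}) :=
  forall x x', x \in X -> x' \in X -> (nbr Y x \subset nbr Y x') || (nbr Y x' \subset nbr Y x).
Definition separated (X Y : {set T}) := {in X &, injective (nbr Y)}.

Record tripartite (A B C : {set T}) : Prop := Tripartite {
  tri_det : [/\ determined A B C, determined B C A & determined C A B];
  tri_nest : [/\ nested A B, nested B C & nested C A];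
  tri_nest' : [/\ nested B A, nested C B & nested A C];
  tri_sep : [/\ separated A B, separated B C & separated C A];
  tri_sep' : [/\ separated B A, separated C B & separated A C];
  tri_pos : [/\ 0 < #|A|, 0 < #|B| & 0 < #|C|] }.

Lemma tripartite_rot A B C : tripartite A B C -> tripartite B C A.
Proof. by case=> -[? ? ?] [? ? ?] [? ? ?] [? ? ?] [? ? ?] [? ? ?]. Qed.

Lemma nbrP X x y : (y \in nbr X x) = (y \in X) && adj x y.
Proof. by rewrite inE. Qed.

Lemma card_below_nbr A C x : nested A C -> separated A C -> separated C A -> x \in A ->
  #|below A (nbr C) x| = #|nbr C x| + isolated A C.
Proof.
move=> nAC sAC sCA xA; apply: (@card_below _ _ A C) => //.
- by move=> y _; apply/subsetP => z; rewrite nbrP => /andP[].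
- by move=> z z' zC z'C e; apply: sCA => //; apply/setP => y; rewrite !nbrP;
    case: (boolP (y \in A)) => //= /e; rewrite !nbrP zC z'C /= ![adj y _]sym.
Qed.

Lemma card_part A C : nested A C -> separated A C -> separated C A -> 0 < #|A| ->
  #|A| + isolated C A = #|C| + isolated A C.
Proof.
move=> nAC sAC sCA A0; rewrite -(@card_chain _ _ A C (nbr C)) //; first last.
- by move=> z z' zC z'C e; apply: sCA => //; apply/setP => y; rewrite !nbrP;
    case: (boolP (y \in A)) => //= /e; rewrite !nbrP zC z'C /= ![adj y _]sym.
- by move=> y _; apply/subsetP => z; rewrite nbrP => /andP[].
congr (_ + nat_of_bool _); apply: eq_existsb => z; case: (boolP (z \in C)) => //= zC.
apply/eqP/forall_inP => [z0 x xA|h].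
  by rewrite nbrP zC /= sym; have := in_set0 x; rewrite -z0 nbrP xA /= => ->.
by apply/setP => x; rewrite nbrP inE; apply/negP => /andP[xA]; have := h x xA; rewrite nbrP zC sym => /negP.
Qed.

(* For [c] in the third part, [adj a c] holds iff [c] is among the first [#|nbr C a|] vertices of
   [C], in the order of decreasing neighbourhood in [A], i.e. of increasing neighbourhood in [B]. *)
Lemma adj_threshold A B C a c : tripartite A B C -> a \in A -> c \in C ->
  adj a c = (#|nbr B c| + isolated C B <= #|nbr C a|).
Proof.
move=> [[dAB dBC dCA] [nAB nBC nCA] [nBA nCB nAC] [sAB sBC sCA] [sBA sCB sAC] _] aA cC.
rewrite -card_below_nbr //.
(* A neighbour in [B] is an obstacle to neighbours in [A]: adjacency between [C] and [A] fails
   exactly where a common neighbour in [B] exists. So the two orders on [C] are opposite. *)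
have ord z z' : z \in C -> z' \in C -> nbr B z' \subset nbr B z -> nbr A z \subset nbr A z'.
  move=> zC z'C /subsetP h; apply/subsetP => x; rewrite !nbrP => /andP[xA].
  rewrite xA /= dCA // dCA //; apply: contra => /exists_inP[y yB /andP[z'y yx]].
  have := h y; rewrite !nbrP yB z'y => /(_ isT) /= zy.
  by apply/exists_inP; exists y; rewrite ?zy.
have ord' z z' : z \in C -> z' \in C -> nbr A z \subset nbr A z' -> nbr B z' \subset nbr B z.
  move=> zC z'C /subsetP h; apply/subsetP => y; rewrite !nbrP => /andP[yB].
  rewrite yB /= ![adj _ y]sym dBC // dBC //; apply: contra => /exists_inP[x xA /andP[yx xz]].
  have := h x; rewrite !nbrP xA sym xz => /(_ isT) /= z'x.
  by apply/exists_inP; exists x; rewrite // yx /= sym.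
apply/idP/idP => [ac|].
  apply: subset_leq_card; apply/subsetP => z; rewrite inE => /andP[zC /(ord _ _ cC zC)/subsetP/(_ a)].
  by rewrite !nbrP zC aA /= sym ac => /(_ isT); rewrite sym.
apply: contraLR => nac; rewrite -ltnNge; apply: proper_card; apply/properP; split.
  apply/subsetP => z; rewrite nbrP inE => /andP[zC az]; rewrite zC /=; apply: ord' => //.
  case/orP: (nCA c z cC zC) => // /subsetP/(_ a); rewrite !nbrP aA /= sym az sym => /(_ isT).
  by rewrite (negbTE nac).
by exists c; rewrite ?inE ?cC ?subxx //= (negbTE nac).
Qed.

Lemma first_vertex A C : nested A C -> separated A C -> separated C A -> 0 < #|A| ->
  exists2 x, x \in A & #|nbr C x| + isolated A C = 1.
Proof.
move=> nAC sAC sCA /card_gt0P[x0 x0A].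
case: (@arg_minnP _ x0 (mem A) (fun y => #|nbr C y|) x0A) => x xA xmin.
exists x; first exact: xA.
rewrite -card_below_nbr //; apply/eqP/cards1P; exists x; apply/setP => y; rewrite !inE.
apply/andP/eqP => [[yA yx]|->//]; apply: sAC => //.
by apply/eqP; rewrite eqEcard yx; apply: xmin.
Qed.

(** Compare the vertices of rank 1 in the three classes. By [adj_threshold] two of them are
    non-adjacent exactly when the corresponding summand is 1, and they do not form a triangle, so
    some summand is 1. A non-adjacent pair has a common neighbour in the third class, and the
    thresholds for it force the other two summands to be 0. *)
Lemma one_isolated A B C : triangle_free adj -> tripartite A B C ->
  isolated A C + isolated B A + isolated C B = 1.
Proof.
move=> tf tri; have tri1 := tripartite_rot tri; have tri2 := tripartite_rot tri1.
case: (tri) => -[dAB dBC dCA] [nAB nBC nCA] [nBA nCB nAC] [sAB sBC sCA] [sBA sCB sAC] [A0 B0 C0].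
have [x xA ux] := first_vertex nAC sAC sCA A0.
have [y yB uy] := first_vertex nBA sBA sAB B0.
have [z zC uz] := first_vertex nCB sCB sBC C0.
have xz := adj_threshold tri xA zC; have yx := adj_threshold tri1 yB xA.
have zy := adj_threshold tri2 zC yB.
have nt : ~~ [&& adj x z, adj y x & adj z y].
  by apply/negP => /and3P[h1 h2 h3]; apply: (tf y x z); rewrite h1 h2 sym h3.
have thr (b : bool) (m n : nat) : b -> b = (m <= n) -> m <= n by move=> -> <-.
have dxz : isolated A C -> isolated B A + isolated C B = 0.
  move=> i1; have : ~~ adj x z by rewrite xz; clear -i1 ux uz; rewrite i1 in ux; lia.
  rewrite sym dCA // negbK => /exists_inP[w wB /andP[zw wx]].
  have := thr _ _ _ zw (adj_threshold tri2 zC wB); have := thr _ _ _ wx (adj_threshold tri1 wB xA).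
  clear -i1 ux uz; rewrite i1 in ux *; lia.
have dyx : isolated B A -> isolated C B + isolated A C = 0.
  move=> i1; have : ~~ adj y x by rewrite yx; clear -i1 ux uy; rewrite i1 in uy; lia.
  rewrite sym dAB // negbK => /exists_inP[w wC /andP[xw wy]].
  have := thr _ _ _ xw (adj_threshold tri xA wC); have := thr _ _ _ wy (adj_threshold tri2 wC yB).
  clear -i1 ux uy; rewrite i1 in uy *; lia.
have dzy : isolated C B -> isolated A C + isolated B A = 0.
  move=> i1; have : ~~ adj z y by rewrite zy; clear -i1 uy uz; rewrite i1 in uz; lia.
  rewrite sym dBC // negbK => /exists_inP[w wA /andP[yw wz]].
  have := thr _ _ _ yw (adj_threshold tri1 yB wA); have := thr _ _ _ wz (adj_threshold tri wA zC).
  clear -i1 uy uz; rewrite i1 in uz *; lia.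
move: nt dxz dyx dzy; rewrite xz yx zy; clear -ux uy uz.
case: isolated ux => ux; case: isolated uy => uy; case: isolated uz => uz //= nt h1 h2 h3.
all: try by move: (h1 isT).
all: try by move: (h2 isT).
all: try by move: (h3 isT).
by exfalso; move: nt; rewrite !negb_and -!ltnNge; lia.
Qed.
End Tripartite.
Lemma surjective_count (S : finType) (A : {set S}) (f : S -> nat) k : {in A &, injective f} ->
  (forall x, x \in A -> f x < #|A|) -> k < #|A| -> exists2 x, x \in A & f x = k.
Proof.
move=> inj bd kl; have n0 : 0 < #|A| by apply: leq_ltn_trans kl.
pose g x : 'I_(#|A|.-1.+1) := inord (f x).
have gE x : x \in A -> g x = f x :> nat by move=> xA; rewrite inordK ?prednK ?bd.
have ginj : {in A &, injective g}.
  by move=> x y xA yA /(congr1 val) /=; rewrite !gE //; apply: inj.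
have : g @: A == setT by rewrite eqEcard subsetT cardsT card_ord (card_in_imset ginj) prednK /=.
move=> /eqP/setP/(_ (inord k)); rewrite inE => /imsetP[x xA /(congr1 val)] /=.
by rewrite gE // inordK ?prednK // => ->; exists x.
Qed.

(** * From ranks to positions on the Andrásfai cycle *)

Section Chain.
Variables (T : finType) (adj : rel T).
Hypothesis sym : symmetric adj.
Hypothesis tf : triangle_free adj.

Lemma card_nbr_inj (X Y : {set T}) : nested adj X Y -> separated adj X Y ->
  {in X &, injective (fun x => #|nbr adj Y x|)}.
Proof.
move=> n s x y xX yX /= e; apply: s => //; apply/eqP.
by case/orP: (n x y xX yX) => h; [|rewrite eq_sym]; rewrite eqEcard h e leqnn.
Qed.

(** Put k = |C| + 1. When |A| and |B| are at most k, the values fill initial parts of the blocks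
    0..k-1 and k..2k-1 and all of 2k..3k-2, and [chain_adj] is the adjacency of the Andrásfai graph
    with parameter k. A shorter [B] corresponds to a Vega graph without the number 2k - 1. *)
Record chain_map (A B C : {set T}) (f : T -> nat) : Prop := ChainMap {
  chainA : forall k, k < #|A| -> exists2 x, x \in A & f x = k;
  chainB : forall k, #|C| < k <= #|C| + #|B| -> exists2 x, x \in B & f x = k;
  chainC : forall k, #|C|.*2.+1 < k <= #|C|.*2.+1 + #|C| -> exists2 x, x \in C & f x = k;
  chainA' : forall x, x \in A -> f x < #|A|;
  chainB' : forall x, x \in B -> #|C| < f x <= #|C| + #|B|;
  chainC' : forall x, x \in C -> #|C|.*2.+1 < f x <= #|C|.*2.+1 + #|C|;
  chain_adj : {in A :|: B :|: C &, forall x y,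
    adj x y = (#|C| < f x - f y + (f y - f x) <= #|C|.*2.+1)} }.

(** The position [f] is the rank within the class plus an offset, chosen so that each of the three
    rank comparisons becomes one end of the interval of differences; the other end then holds by the
    bounds on the class sizes. A vertex of [A] without neighbours in [C] gets position 0. *)
Lemma chain_embedding (A B C : {set T}) : tripartite adj A B C ->
  independent adj A -> independent adj B -> independent adj C ->
  [disjoint A & B] -> [disjoint A & C] -> [disjoint B & C] ->
  isolated adj A C ->
  [/\ isolated adj C A + isolated adj A B + isolated adj B C = 1,
      #|A| + isolated adj C A = #|C|.+1, #|B| + isolated adj A B = #|A| &
      exists f, chain_map A B C f].
Proof.
move=> tri iA iB iC dAB dAC dBC alC; have tri1 := tripartite_rot tri; have tri2 := tripartite_rot tri1.
have one := one_isolated sym tf tri; rewrite alC in one.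
case: (tri) => -[deAB deBC deCA] [nAB nBC nCA] [nBA nCB nAC] [sAB sBC sCA] [sBA sCB sAC] [A0 B0 C0].
have [bA gB] : isolated adj B A = false /\ isolated adj C B = false.
  by move: one; do 2!case: isolated.
have cA := card_part sym nAC sAC sCA A0; have cB := card_part sym nBA sBA sAB B0.
have cC := card_part sym nCB sCB sBC C0.
rewrite alC bA gB /= !addn0 addn1 in cA cB cC.
have adjAC x z : x \in A -> z \in C -> adj x z = (#|nbr adj B z| <= #|nbr adj C x|).
  by move=> xA zC; rewrite (adj_threshold sym tri) // gB addn0.
have adjBA y x : y \in B -> x \in A -> adj y x = (#|nbr adj C x| < #|nbr adj A y|).
  by move=> yB xA; rewrite (adj_threshold sym tri1) // alC addn1.
have adjCB z y : z \in C -> y \in B -> adj z y = (#|nbr adj A y| <= #|nbr adj B z|).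
  by move=> zC yB; rewrite (adj_threshold sym tri2) // bA addn0.
have rkA x : x \in A -> #|nbr adj C x| < #|A|.
  move=> xA; have := card_below_nbr sym nAC sAC sCA xA; rewrite alC addn1 => <-.
  by apply: subset_leq_card; apply/subsetP => w; rewrite inE => /andP[].
have rk1 (X Y : {set T}) : nested adj X Y -> separated adj X Y -> separated adj Y X ->
    isolated adj X Y = false -> forall x, x \in X -> 0 < #|nbr adj Y x| <= #|X|.
  move=> n s s' i0 x xX; have := card_below_nbr sym n s s' xX; rewrite i0 addn0 => <-.
  apply/andP; split; first by apply/card_gt0P; exists x; rewrite inE xX subxx.
  by apply: subset_leq_card; apply/subsetP => w; rewrite inE => /andP[].
have rkB := rk1 _ _ nBA sBA sAB bA; have rkC := rk1 _ _ nCB sCB sBC gB.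
have uA := card_nbr_inj nAC sAC; have uB := card_nbr_inj nBA sBA; have uC := card_nbr_inj nCB sCB.
split.
- move: cA cB cC; clear; do 3!case: isolated => /=; lia.
- by [].
- by [].
pose f x := if x \in A then #|nbr adj C x| else
            if x \in B then #|C| + #|nbr adj A x| else #|C|.*2.+1 + #|nbr adj B x|.
have fA x : x \in A -> f x = #|nbr adj C x| by rewrite /f => ->.
have fB x : x \in B -> f x = #|C| + #|nbr adj A x|.
  by move=> xB; rewrite /f xB (disjointFl dAB).
have fC x : x \in C -> f x = #|C|.*2.+1 + #|nbr adj B x|.
  by move=> xC; rewrite /f (disjointFl dBC) // (disjointFl dAC).
exists f; split.
- move=> k kA; have [x xA xk] := surjective_count uA rkA kA; by exists x; rewrite // fA.
(* Degrees from [B] into [A] start at 1, whence the predecessor and the shift by [#|C|.+1]. *)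
- move=> k kB; have [|||x xB xk] := @surjective_count _ B (fun y => #|nbr adj A y|.-1) (k - #|C|.+1).
  + by move=> y y' yB y'B /= e; apply: uB => //; have := rkB _ yB; have := rkB _ y'B; move: e; clear; lia.
  + by move=> y yB; have := rkB _ yB; clear; lia.
  + by move: kB; clear; lia.
  by exists x; rewrite // fB //; have := rkB _ xB; move: kB xk; clear; lia.
- move=> k kC; have [|||x xC xk] := @surjective_count _ C (fun y => #|nbr adj B y|.-1) (k - #|C|.*2.+2).
  + by move=> y y' yC y'C /= e; apply: uC => //; have := rkC _ yC; have := rkC _ y'C; move: e; clear; lia.
  + by move=> y yC; have := rkC _ yC; clear; lia.
  + by move: kC; clear; lia.
  by exists x; rewrite // fC //; have := rkC _ xC; move: kC xk; clear; lia.
- by move=> x xA; rewrite fA // rkA.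
- by move=> x xB; rewrite fB //; have := rkB _ xB; clear; lia.
- by move=> x xC; rewrite fC //; have := rkC _ xC; clear; lia.
have ub : #|A| <= #|C|.+1 by rewrite -cA leq_addr.
have ub' : #|B| <= #|C|.+1 by apply: leq_trans ub; rewrite -cB leq_addr.
pose D := fun x y => adj x y = (#|C| < f x - f y + (f y - f x) <= #|C|.*2.+1).
have dsym x y : D x y -> D y x by rewrite /D sym => ->; rewrite addnC.
have AA x y : x \in A -> y \in A -> D x y.
  move=> xA yA; rewrite /D (negbTE (iA _ _ xA yA)) !fA //; have := rkA _ xA; have := rkA _ yA.
  by move: ub; clear; lia.
have BB x y : x \in B -> y \in B -> D x y.
  move=> xA yA; rewrite /D (negbTE (iB _ _ xA yA)) !fB //; have := rkB _ xA; have := rkB _ yA.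
  by move: ub'; clear; lia.
have CC x y : x \in C -> y \in C -> D x y.
  move=> xA yA; rewrite /D (negbTE (iC _ _ xA yA)) !fC //; have := rkC _ xA; have := rkC _ yA.
  by clear; lia.
have hAC x y : x \in A -> y \in C -> D x y.
  move=> xA yC; rewrite /D adjAC // fA // fC //; have := rkA _ xA; have := rkC _ yC.
  by move: ub; clear; lia.
have BA y x : y \in B -> x \in A -> D y x.
  move=> xB yA; rewrite /D adjBA // fB // fA //; have := rkA _ yA; have := rkB _ xB.
  by move: ub ub'; clear; lia.
have CB y x : y \in C -> x \in B -> D y x.
  move=> yC xB; rewrite /D adjCB // fC // fB //; have := rkC _ yC; have := rkB _ xB.
  by move: ub'; clear; lia.
move=> x y; rewrite !inE -!orbA => /or3P[] hx /or3P[] hy; rewrite -/(D x y).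
all: first [by apply: AA|by apply: BB|by apply: CC|by apply: hAC|by apply: BA|by apply: CB|apply: dsym].
all: first [by apply: hAC|by apply: BA|by apply: CB].
Qed.
End Chain.

(** * Three-colourable graphs *)

Lemma size_foldl_set2 (E : seq (nat * nat)) (R : seq bitseq) n : all (fun p => (p.1 < n) && (p.2 < n)) E ->
  size R <= n -> size R <= size (foldl (fun R p => set2 R p.1 p.2) R E) <= n.
Proof.
elim: E R => [|p E IH] R /=; first by rewrite leqnn.
move=> /andP[/andP[p1 p2] aE] Rn.
have /(IH _ aE)/andP[h ->] : size (set2 R p.1 p.2) <= n by rewrite size_set2 geq_max gtn_max p1 p2.
by rewrite andbT (leq_trans _ h) // size_set2 leq_maxr.
Qed.

Lemma bit2_foldl (E : seq (nat * nat)) (R : seq bitseq) a b : bit2 (foldl (fun R p => set2 R p.1 p.2) R E) a b ->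
  [\/ bit2 R a b, (a, b) \in E | (b, a) \in E].
Proof.
elim: E R => [|[i j] E IH] R /=; first by constructor 1.
case/IH => [/bit2_set2[h|[-> ->]|[-> ->]]|h|h].
- by constructor 1.
- by constructor 2; rewrite inE eqxx.
- by constructor 3; rewrite inE eqxx.
- by constructor 2; rewrite inE h orbT.
- by constructor 3; rewrite inE h orbT.
Qed.

Lemma valid_mkst (T : finType) (adj : rel T) (h : nat -> T) n E N : symmetric adj ->
  all (fun p => (p.1 < n) && (p.2 < n)) (E ++ N) ->
  all (fun p => adj (h p.1) (h p.2)) E -> all (fun p => ~~ adj (h p.1) (h p.2)) N ->
  valid adj h (mkst n E N).
Proof.
rewrite all_cat => sym /andP[bE bN] /allP aE /allP aN; split=> /=.
- have /andP[_] := @size_foldl_set2 N [::] n bN (leq0n n); rewrite /sz /=.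
  have /andP[] := @size_foldl_set2 E (nseq n [::]) n bE (eq_leq (size_nseq n _)).
  by rewrite size_nseq => le _ /leq_trans; apply.
- have e0 i j : bit2 (nseq n [::]) i j = false by rewrite /bit2 !nth_nseq !if_same !nth_nil andbF if_same.
  by move=> i j /bit2_foldl[|/aE|/aE]; rewrite ?e0 // sym.
- have e0 i j : bit2 [::] i j = false by rewrite /bit2 !nth_nil andbF if_same.
  by move=> i j /bit2_foldl[|/aN|/aN]; rewrite ?e0 // sym.
Qed.

Definition hexagon := [:: (0, 1); (1, 2); (2, 3); (3, 4); (4, 5); (0, 5)].

Section Structure.
Variables (T : finType) (adj : rel T).
Hypothesis sym : symmetric adj.
Hypothesis irr : irreflexive adj.
Hypothesis tf : triangle_free adj.
Hypothesis common : forall x y, ~~ adj x y -> exists z, adj z x && adj z y.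
Hypothesis Q4 : property_Q 4 adj.
Hypothesis twin_free : forall x y, adj x =1 adj y -> x = y.

(** The only independent sets of more than two vertices in a six-cycle are the two alternating
    triples, so Q with m = 2 must give one of them a common neighbour. *)
Lemma hexagon_centre (h : nat -> T) : all (fun p => adj (h p.1) (h p.2)) hexagon ->
  exists z, [&& adj z (h 0), adj z (h 2) & adj z (h 4)] || [&& adj z (h 1), adj z (h 3) & adj z (h 5)].
Proof.
move=> hex; have v : valid adj h (mkst 6 hexagon [::]) by apply: valid_mkst.
have hv : heavy (edges (mkst 6 hexagon [::])) 2 [:: (5, 1); (4, 1); (3, 1); (2, 1); (1, 1); (0, 1)] 0 [::] [::]
    = [:: (3, [:: 0; 2; 4]); (3, [:: 1; 3; 5])] by vm_compute.
have [||||o [z []]] := @property_Q_option T adj sym Q4 h _ 2 [:: (5, 1); (4, 1); (3, 1); (2, 1); (1, 1); (0, 1)] v => //.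
  by rewrite hv => o; rewrite !inE => /orP[] /eqP->.
rewrite hv !inE => /orP[] /eqP-> oz; exists z; apply/orP; [left | right];
  by apply/and3P; split; apply: oz; rewrite !inE eqxx ?orbT.
Qed.

Let tfP x y z : adj z x -> adj z y -> ~~ adj x y := @no_triangle _ _ sym tf x y z.

(** The properties [spread] and [uniform] are what the classes of a 3-colouring and the number
    classes of a frame share; together with [determined] they yield [tripartite]. *)
Definition spread (A B C : {set T}) := forall p x y z, x \in A -> y \in B -> z \in C ->
  ~~ [&& adj p x, adj p y & adj p z].
Definition uniform (A B C : {set T}) := forall x x' z, x \in A -> x' \in A ->
  z \notin B -> z \notin C -> adj x z = adj x' z.

Lemma determined_sym (A B C : {set T}) : determined adj A B C -> determined adj B A C.
Proof.
move=> d y x yB xA; rewrite sym d //; congr (~~ _); apply: eq_existsb => z.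
by rewrite ![adj z _]sym ![adj _ z]sym andbC [X in _ = X]andbC; case: (z \in C); rewrite ?andbT ?andbF // andbC.
Qed.

(** If the neighbourhoods of [x] and [x'] crossed, the two missing edges would come with common
    neighbours in [C]. These close a hexagon whose opposite vertices share a class, so its centre
    would see all three classes. *)
Lemma determined_nested (A B C : {set T}) : determined adj A B C -> spread A B C -> nested adj A B.
Proof.
move=> d sp x x' xA x'A; apply/negPn/negP; rewrite negb_or => /andP[/subsetPn[y h1 h2] /subsetPn[y' h3 h4]].
move: h1 h2 h3 h4; rewrite !nbrP => /andP[yB xy]; rewrite yB /= => x'y /andP[y'B x'y']; rewrite y'B /= => xy'.
move: x'y xy'; rewrite !d // !negbK => /exists_inP[z' z'C /andP[x'z' z'y]] /exists_inP[z zC /andP[xz zy']].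
have [|w] := @hexagon_centre (nth x [:: x; y; z'; x'; y'; z]).
  by rewrite /= xy [adj y z']sym z'y [adj z' x']sym x'z' x'y' [adj y' z]sym zy' xz.
move=> /= /orP[] /and3P[h1 h2 h3].
  by have := sp w x y' z' xA y'B z'C; rewrite h1 h2 h3.
by have := sp w x' y z x'A yB zC; rewrite h1 h2 h3.
Qed.

(** The neighbours in [B] fix those in [C], and all other neighbours agree anyway; so vertices with
    the same neighbours in [B] are twins. *)
Lemma determined_separated (A B C : {set T}) :
  determined adj A C B -> uniform A B C -> separated adj A B.
Proof.
move=> d u x x' xA x'A e.
have eB y : y \in B -> adj x y = adj x' y.
  by move=> yB; have /setP/(_ y) := e; rewrite !nbrP yB.
apply: twin_free => z; case: (boolP (z \in B)) => zB; first exact: eB.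
case: (boolP (z \in C)) => zC; last exact: u.
by rewrite !d //; congr (~~ _); apply: eq_existsb => y; case: (boolP (y \in B)) => //= /eB ->.
Qed.

Lemma determined_tripartite (A B C : {set T}) :
  [/\ determined adj A B C, determined adj B C A & determined adj C A B] ->
  [/\ uniform A B C, uniform B C A & uniform C A B] -> spread A B C ->
  [/\ 0 < #|A|, 0 < #|B| & 0 < #|C|] -> tripartite adj A B C.
Proof.
move=> [dA dB dC] [uA uB uC] sp pos; split=> //.
- split; first exact: determined_nested sp.
    by apply: determined_nested dB _ => p x y z xA yB zC; apply: contra (sp p z x y zC xA yB) => /and3P[-> -> ->].
  by apply: determined_nested dC _ => p x y z xA yB zC; apply: contra (sp p y z x yB zC xA) => /and3P[-> -> ->].
- split.
  + apply: determined_nested (determined_sym dA) _ => p x y z xA yB zC.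
    by apply: contra (sp p y x z yB xA zC) => /and3P[-> -> ->].
  + apply: determined_nested (determined_sym dB) _ => p x y z xA yB zC.
    by apply: contra (sp p z y x zC yB xA) => /and3P[-> -> ->].
  + apply: determined_nested (determined_sym dC) _ => p x y z xA yB zC.
    by apply: contra (sp p x z y xA zC yB) => /and3P[-> -> ->].
- by split; [apply: determined_separated (determined_sym dC) _ | apply: determined_separated (determined_sym dA) _
    | apply: determined_separated (determined_sym dB) _].
- by split; [apply: determined_separated dB _ | apply: determined_separated dC _
    | apply: determined_separated dA _] => x x' z ? ? ? ?; [apply: uB|apply: uC|apply: uA].
Qed.

(** * Proper 3-colourings *)

Definition colouring (A B C : {set T}) :=
  [/\ independent adj A, independent adj B & independent adj C] /\
  [/\ [disjoint A & B], [disjoint A & C], [disjoint B & C] & forall x, [|| x \in A, x \in B | x \in C]].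

Lemma colouring_rot A B C : colouring A B C -> colouring B C A.
Proof.
move=> [[iA iB iC] [dAB dAC dBC cov]]; split=> //; split=> //; try by rewrite disjoint_sym.
by move=> x; have := cov x; case: (x \in A); case: (x \in B); case: (x \in C).
Qed.

Lemma colouring_determined A B C : colouring A B C -> determined adj A B C.
Proof.
move=> [[iA iB iC] [_ _ _ cov]] x y xA yB; apply/idP/idP => [xy|].
  apply/exists_inP => -[z zC /andP[xz zy]].
  by have := @tfP x y z; rewrite xy [adj z x]sym xz zy => /(_ isT isT).
apply: contraR => /common[z /andP[zx zy]]; apply/exists_inP; exists z; last by rewrite sym zx.
case/or3P: (cov z) => // zX; first by have := iA _ _ zX xA; rewrite zx.
by have := iB _ _ zX yB; rewrite zy.
Qed.

Lemma uniform_colouring A B C : colouring A B C -> uniform A B C.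
Proof.
move=> [[iA _ _] [_ _ _ cov]] x x' z xA x'A zB zC.
have zA : z \in A by have := cov z; rewrite (negbTE zB) (negbTE zC) !orbF.
by rewrite (negbTE (iA _ _ xA zA)) (negbTE (iA _ _ x'A zA)).
Qed.

Lemma colouring_spread A B C : colouring A B C -> spread A B C.
Proof.
move=> [[iA iB iC] [_ _ _ cov]] p x y z xA yB zC; apply/negP => /and3P[px py pz].
by case/or3P: (cov p) => pX; [have := iA p x pX xA|have := iB p y pX yB|have := iC p z pX zC];
  rewrite ?px ?py ?pz.
Qed.

(** Without a third class nothing obstructs adjacency, so the graph is complete bipartite, and the
    Andrásfai graph for k = 1 is a single edge. *)
Lemma empty_class_andrasfai A B (x0 : T) : colouring A B set0 -> blowup adj (andrasfai_adj 1).
Proof.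
move=> col; have d := colouring_determined col.
case: col => [[iA iB _] [dAB _ _ cov]].
have edge x y : x \in A -> y \in B -> adj x y.
  by move=> xA yB; rewrite d //; apply/exists_inP => -[z]; rewrite inE.
have cov' x : x \notin A -> x \in B by move=> xA; have := cov x; rewrite (negbTE xA) inE orbF.
exists (fun x => if x \in A then @ord0 1 else @ord_max 1); split=> //; split.
  have [z /andP[zx _]] := common (negbT (irr x0)).
  have [x [y [xA yA]]] : exists x y, x \in A /\ y \notin A.
    case: (boolP (x0 \in A)) => h; case: (boolP (z \in A)) => h'.
    - by have := iA _ _ h' h; rewrite zx.
    - by exists x0, z.
    - by exists z, x0.
    - by have := iB _ _ (cov' _ h') (cov' _ h); rewrite zx.
  by case=> [[|[|//]] vl] _; [exists x; rewrite xA | exists y; rewrite (negbTE yA)]; apply: val_inj.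
move=> x y; rewrite andrasfai_adjE //.
case: (boolP (x \in A)) => xA; case: (boolP (y \in A)) => yA /=.
- by rewrite (negbTE (iA _ _ xA yA)).
- by rewrite edge ?cov'.
- by rewrite sym edge ?cov'.
- by rewrite (negbTE (iB _ _ (cov' _ xA) (cov' _ yA))).
Qed.

Lemma colouring_andrasfai_aux A B C : colouring A B C ->
  [/\ 0 < #|A|, 0 < #|B| & 0 < #|C|] -> isolated adj A C -> blowup adj (andrasfai_adj #|C|.+1).
Proof.
move=> col pos alC; have col1 := colouring_rot col; have col2 := colouring_rot col1.
have dA := colouring_determined col; have dB := colouring_determined col1; have dC := colouring_determined col2.
have tri : tripartite adj A B C.
  apply: determined_tripartite => //; last exact: colouring_spread.
  by split; apply: uniform_colouring.
case: (col) => [[iA iB iC] [dAB dAC dBC cov]].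
have [one cA cB [f cm]] := chain_embedding sym tf tri iA iB iC dAB dAC dBC alC.
have /exists_inP[x0 x0A /eqP/setP x0C] := alC.
have x0N z : z \in C -> adj x0 z = false by move=> zC; have := x0C z; rewrite nbrP zC inE.
(* Otherwise [x0] and [z] would both have exactly [B] as neighbourhood and be twins in different
   classes. *)
have n1 : isolated adj C A = false.
  case: (boolP (isolated adj C A)) => // /exists_inP[z zC /eqP/setP zA].
  have zN y : y \in A -> adj z y = false by move=> yA; have := zA y; rewrite nbrP yA inE.
  suff e : x0 = z by move: x0A; rewrite e (disjointFl dAC).
  apply: twin_free => y; case/or3P: (cov y) => yX.
  - by rewrite zN // (negbTE (iA _ _ x0A yX)).
  - rewrite dA // [adj z y]sym dB //; congr (~~ _).
    apply/idP/idP => /exists_inP[w wX /andP[h1 h2]]; first by rewrite x0N in h1.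
    by rewrite sym zN in h2.
  - by rewrite x0N // (negbTE (iC _ _ zC yX)).
(* Otherwise [x] would have neighbours only in [C], where [x0] has none, and the two would lack a
   common neighbour. *)
have n2 : isolated adj A B = false.
  case: (boolP (isolated adj A B)) => // /exists_inP[x xA /eqP/setP xB].
  have xN y : y \in B -> adj x y = false by move=> yB; have := xB y; rewrite nbrP yB inE.
  have [z /andP[h1 h2]] := common (iA _ _ x0A xA).
  case/or3P: (cov z) => zX; first by rewrite (negbTE (iA _ _ zX xA)) in h2.
    by rewrite sym xN in h2.
  by rewrite sym x0N in h1.
rewrite n1 n2 !addn0 in cA cB.
have bd x : f x < 3 * #|C|.+1 - 1.
  case/or3P: (cov x) => xX; [have := chainA' cm xX|have := chainB' cm xX|have := chainC' cm xX];
    by move: cA cB; clear; lia.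
exists (fun x => Ordinal (bd x)); split=> //; split.
  move=> v _; have vl := ltn_ord v.
  case: (ltnP v #|A|) => vA.
    by have [x _ e] := chainA cm vA; exists x; apply: val_inj.
  case: (leqP v (#|C| + #|B|)) => vB.
    have [|x _ e] := chainB cm (k := v); first by move: vA vB cA; clear; lia.
    by exists x; apply: val_inj.
  have [|x _ e] := chainC cm (k := v); first by move: vB vl cA cB; clear; lia.
  by exists x; apply: val_inj.
move=> x y; rewrite andrasfai_adjE //= (chain_adj cm) ?inE -?orbA //; congr (_ && _).
by congr (_ <= _); clear; lia.
Qed.

Lemma colouring_andrasfai (x0 : T) A B C : colouring A B C -> exists2 k, 0 < k & blowup adj (andrasfai_adj k).
Proof.
move=> col; have col1 := colouring_rot col; have col2 := colouring_rot col1.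
case: (posnP #|A|) => [/cards0_eq A0|A0].
  by exists 1 => //; apply: (@empty_class_andrasfai B C x0); rewrite -A0.
case: (posnP #|B|) => [/cards0_eq B0|B0].
  by exists 1 => //; apply: (@empty_class_andrasfai C A x0); rewrite -B0.
case: (posnP #|C|) => [/cards0_eq C0|C0].
  by exists 1 => //; apply: (@empty_class_andrasfai A B x0); rewrite -C0.
have tri : tripartite adj A B C.
  apply: determined_tripartite; last by [].
  - by split; apply: colouring_determined.
  - by split; apply: uniform_colouring.
  - exact: colouring_spread.
have := one_isolated sym tf tri.
case: (boolP (isolated adj A C)) => [i1 _|_].
  by exists #|C|.+1 => //; apply: (colouring_andrasfai_aux col).
case: (boolP (isolated adj B A)) => [i1 _|_].
  by exists #|A|.+1 => //; apply: (colouring_andrasfai_aux col1).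
case: (boolP (isolated adj C B)) => [i1 _|_] //.
by exists #|B|.+1 => //; apply: (colouring_andrasfai_aux col2).
Qed.

(* The classes are the neighbours of [p], and the neighbours and non-neighbours of a vertex [r] that has
   the most neighbours outside [N(p)]. *)
Lemma two_matching_colourable p :
  (forall a b c d, adj a b -> adj c d -> [|| adj a c, adj a d, adj b c, adj b d, adj p a, adj p b, adj p c | adj p d]) ->
  (forall c0 c1 c2 c3 c4, [&& adj c0 c1, adj c1 c2, adj c2 c3, adj c3 c4 & adj c4 c0] ->
     [|| adj p c0, adj p c1, adj p c2, adj p c3 | adj p c4]) ->
  exists A B C, colouring A B C.
Proof.
move=> m2 c5; pose M := [set x | ~~ adj p x].
have pM : p \in M by rewrite inE irr.
case: (@arg_maxnP _ p (mem M) (fun x => #|nbr adj M x|) pM) => r rM0 rmax.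
have rM : ~~ adj p r by have : r \in M := rM0; rewrite inE.
exists [set x | adj p x], (nbr adj M r), (M :\: nbr adj M r); split; last first.
  split; rewrite ?disjoints_subset.
  - by apply/subsetP => x; rewrite !inE => ->.
  - by apply/subsetP => x; rewrite !inE => ->; rewrite andbF.
  - by apply/subsetP => x; rewrite !inE => ->.
  - by move=> x; rewrite !inE; do 2!case: adj.
split=> [x y|x y|s t]; rewrite !inE.
- by move=> px py; apply: tfP px py.
- by move=> /andP[_ rx] /andP[_ ry]; apply: tfP rx ry.
rewrite !negb_and !negbK => /andP[rs ps] /andP[rt pt]; rewrite (negbTE ps) (negbTE pt) /= in rs rt.
apply/negP => st.
(* The edges [r q] and [s t] avoid the neighbours of [p], so they are joined by an edge, which must
   end in [q]; seeing both [s] and [t] would give a triangle. *)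
have hit q : adj r q -> ~~ adj p q -> adj q s (+) adj q t.
  move=> rq pq; have := m2 r q s t rq st.
  rewrite (negbTE rs) (negbTE rt) (negbTE ps) (negbTE pt) (negbTE pq) (negbTE rM) !orbF /=.
  by case/orP=> h; rewrite h ?addbT ?addTb /=; apply/negP => h'; move: st; apply/negP;
    [apply: tfP h h' | apply: tfP h' h].
(* Otherwise [u] would see every neighbour of [r] in [M], and [w] besides, against the choice of
   [r]. *)
have strict u w : u \in M -> w \in M -> adj u w -> ~~ adj r u -> ~~ adj r w ->
    exists q, [&& adj r q, ~~ adj p q & ~~ adj q u].
  move=> uM wM uw ru rw; apply/existsP; apply: contraT => /existsPn h.
  suff : #|nbr adj M r| < #|nbr adj M u| by rewrite ltnNge; have -> : #|nbr adj M u| <= #|nbr adj M r| by exact: rmax.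
  apply: proper_card; apply/properP; split.
    by apply/subsetP => q; rewrite !nbrP inE => /andP[pq rq]; have := h q; rewrite pq rq /= negbK sym.
  by exists w; rewrite !nbrP wM //= negb_and.
have [||q1 /and3P[rq1 pq1 q1s]] := strict s t _ _ st rs rt; rewrite ?inE //.
have ts : adj t s by rewrite sym.
have [||q2 /and3P[rq2 pq2 q2t]] := strict t s _ _ ts rt rs; rewrite ?inE //.
have := hit _ rq1 pq1; have := hit _ rq2 pq2; rewrite (negbTE q1s) (negbTE q2t) addbF /= => q2s q1t.
(* The pentagon [r q1 t s q2] contains no neighbour of [p]. *)
have := c5 r q1 t s q2; rewrite rq1 q1t ts [adj s q2]sym q2s [adj q2 r]sym rq2 => /(_ isT).
by rewrite (negbTE rM) (negbTE pq1) (negbTE pt) (negbTE ps) (negbTE pq2).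
Qed.
End Structure.

(** * Vega graphs from a hexagon *)

(* Traces of a vertex on a hexagon, listed in the order a, b, c, u, v, w. *)
Definition kA := [:: true; false; false; true; false; false].
Definition kB := [:: false; true; false; false; true; false].
Definition kC := [:: false; false; true; false; false; true].
Definition ka := [:: false; false; false; false; true; true].
Definition kb := [:: false; false; false; true; false; true].
Definition kc := [:: false; false; false; true; true; false].
Definition ku := [:: false; true; true; false; false; false].
Definition kv := [:: true; false; true; false; false; false].
Definition kw := [:: true; true; false; false; false; false].
Definition kx := [:: true; true; true; false; false; false].
Definition ky := [:: false; false; false; true; true; true].
(* [kA], [kB], [kC] are the traces of the vertices of the Andrasfai part, the others those of the letters. *)
Definition letters := [:: ka; kb; kc; ku; kv; kw; kx; ky].
Definition numbers := [:: kA; kB; kC].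
Definition meet (s t : bitseq) := has (fun p => p.1 && p.2) (zip s t).
(** The traces of opposite hexagon vertices. They are disjoint, so no common neighbour on the
    hexagon excludes an edge between such vertices; this is the task of [fr_anti]. *)
Definition opposite (s t : bitseq) :=
  (s, t) \in [:: (ka, ku); (kb, kv); (kc, kw); (ku, ka); (kv, kb); (kw, kc)].
Definition apart s t := meet s t || opposite s t.

Lemma vega_letter_num_block i n j :
  [/\ j < i -> vega_letter_num i n j = (n == 0) || (n == 3),
      i <= j < 2 * i -> vega_letter_num i n j = (n == 1) || (n == 4) &
      2 * i <= j < 3 * i - 1 -> vega_letter_num i n j = (n == 2) || (n == 5)].
Proof.
rewrite /vega_letter_num.
by split; case: n => [|[|[|[|[|[|n]]]]]] //=; lia.
Qed.

Section Vega.
Variables (T : finType) (adj : rel T).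
Hypothesis sym : symmetric adj.
Hypothesis irr : irreflexive adj.
Hypothesis tf : triangle_free adj.
Hypothesis common : forall x y, ~~ adj x y -> exists z, adj z x && adj z y.
Hypothesis Q4 : property_Q 4 adj.
Hypothesis twin_free : forall x y, adj x =1 adj y -> x = y.

Definition trace a b c u v w z := [:: adj z a; adj z b; adj z c; adj z u; adj z v; adj z w].

(** The cyclic order of the hexagon is [a v c u b w], with [x] over every second vertex. The fields
    [fr_dom] and [fr_anti] are the two facts that make traces decide adjacency; they are supplied by
    the refutation trees. *)
Record frame (a b c u v w x : T) : Prop := Frame {
  fr_hex : [/\ adj a v, adj v c & adj c u] /\ [/\ adj u b, adj b w & adj w a];
  fr_x : [/\ adj x a, adj x b & adj x c];
  fr_opp : [/\ ~~ adj a u, ~~ adj b v & ~~ adj c w];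
  fr_dom : forall z, 1 < count id (trace a b c u v w z);
  fr_anti : forall z z', [/\ trace a b c u v w z = ka -> trace a b c u v w z' = ku -> ~~ adj z z',
    trace a b c u v w z = kb -> trace a b c u v w z' = kv -> ~~ adj z z' &
    trace a b c u v w z = kc -> trace a b c u v w z' = kw -> ~~ adj z z'] }.

(** Turning the hexagon by two steps preserves the triple seen by [x]. *)
Lemma frame_rot a b c u v w x : frame a b c u v w x -> frame b c a v w u x.
Proof.
move=> [[[av vc cu] [ub bw wa]] [xa xb xc] [au bv cw] dom anti]; split.
- by rewrite [adj b _]sym [adj w a]sym in ub bw wa *; split; split; rewrite // sym.
- by [].
- by [].
- move=> z; have := dom z; rewrite /trace.
  by case: (adj z a); case: (adj z b); case: (adj z c); case: (adj z u); case: (adj z v); case: (adj z w).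
- move=> z z'; have [h1 h2 h3] := anti z z'; rewrite /trace; split=> -[e1 e2 e3 e4 e5 e6] [f1 f2 f3 f4 f5 f6].
  + by apply: h2; rewrite /trace ?e1 ?e2 ?e3 ?e4 ?e5 ?e6 ?f1 ?f2 ?f3 ?f4 ?f5 ?f6.
  + by apply: h3; rewrite /trace ?e1 ?e2 ?e3 ?e4 ?e5 ?e6 ?f1 ?f2 ?f3 ?f4 ?f5 ?f6.
  + by apply: h1; rewrite /trace ?e1 ?e2 ?e3 ?e4 ?e5 ?e6 ?f1 ?f2 ?f3 ?f4 ?f5 ?f6.
Qed.

(** * Adjacency from traces on the hexagon *)

Section Frame.
Variables (a b c u v w x : T).
Hypothesis fr : frame a b c u v w x.
Local Notation tr := (trace a b c u v w).
Let A := [set z | tr z == kA].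
Let B := [set z | tr z == kB].
Let C := [set z | tr z == kC].

(** A trace is an independent set of a six-cycle with at least two elements: one of nine
    non-adjacent pairs or one of two alternating triples. *)
Lemma trace_cases z : tr z \in numbers ++ letters.
Proof.
have [[[av vc cu] [ub bw wa]] _ [au bv cw] dom _] := fr.
have no p q : adj p q -> adj z p && adj z q = false.
  by move=> pq; apply/negP => /andP[zp zq]; have := no_triangle sym tf zp zq; rewrite pq.
have := dom z; have := no _ _ av; have := no _ _ vc; have := no _ _ cu.
have := no _ _ ub; have := no _ _ bw; have := no _ _ wa; rewrite /trace.
by case: (adj z a); case: (adj z b); case: (adj z c); case: (adj z u); case: (adj z v); case: (adj z w).
Qed.

Lemma apartN p q : apart (tr p) (tr q) -> ~~ adj p q.
Proof.
case/orP => [|op].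
  have no y : adj p y && adj q y -> ~~ adj p q.
    by rewrite ![adj _ y]sym => /andP[py qy]; apply: no_triangle py qy.
  by rewrite /meet /= orbF; do 5![case/orP; first exact: no]; exact: no.
have [h1 h2 h3] := fr_anti fr p q; have [h4 h5 h6] := fr_anti fr q p; rewrite [adj q p]sym in h4 h5 h6.
by move: op; rewrite /opposite !inE !xpair_eqE => /or4P[|||/or3P[]] /andP[/eqP e1 /eqP e2]; auto.
Qed.

(** Non-adjacent vertices have a common neighbour, whose trace is apart from neither of theirs.
    Inspection of all traces shows that this requires traces that are apart or two different number
    traces. *)
Lemma adj_trace p q : ~~ ((tr p \in numbers) && (tr q \in numbers) && (tr p != tr q)) ->
  adj p q = ~~ apart (tr p) (tr q).
Proof.
move=> nn; apply/idP/idP => [|ap]; first by apply: contraL; exact: apartN.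
apply: contraR ap => /common[r /andP[rp rq]].
have := trace_cases r; have := trace_cases q; have := trace_cases p.
have := contraL (@apartN r p) rp; have := contraL (@apartN r q) rq; move: nn.
move: (tr p) (tr q) (tr r) => s t k nn hkt hks sP tP kP.
have : all (fun s => all (fun t => all (fun k => [|| (s \in numbers) && (t \in numbers) && (s != t),
   apart s t, apart k s | apart k t]) (numbers ++ letters)) (numbers ++ letters)) (numbers ++ letters) by vm_compute.
move=> /allP/(_ s sP)/allP/(_ t tP)/allP/(_ k kP).
by rewrite (negbTE nn) (negbTE hkt) (negbTE hks) !orbF.
Qed.

(** The only trace that is apart from neither of two different number traces is the third number
    trace, so common neighbours lie in the third class. *)
Lemma number_determined k1 k2 k3 : perm_eq [:: k1; k2; k3] numbers ->
  determined adj [set z | tr z == k1] [set z | tr z == k2] [set z | tr z == k3].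
Proof.
move=> pm p q; rewrite !inE => /eqP pk /eqP qk; apply/idP/idP => [pq|].
  apply/exists_inP => -[r _ /andP[pr rq]].
  by have := no_triangle sym tf pr pq; rewrite rq.
apply: contraR => /common[r /andP[rp rq]]; apply/exists_inP; exists r; last by rewrite sym rp.
have := contraL (@apartN r p) rp; have := contraL (@apartN r q) rq; rewrite inE pk qk.
have := trace_cases r; move: (tr r) => k kP.
have : k1 \in numbers /\ k2 \in numbers by rewrite -!(perm_mem pm) !inE !eqxx ?orbT.
case=> h1 h2 /negbTE a2 /negbTE a1.
have : uniq [:: k1; k2; k3] by rewrite (perm_uniq pm).
rewrite /= !inE negb_or => /and3P[/andP[/negbTE n12 /negbTE n13] /negbTE n23 _].
have h3 : k3 \in numbers by rewrite -(perm_mem pm) !inE eqxx ?orbT.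
have : all (fun s => all (fun t => all (fun l => all (fun k => [|| s == t, s == l, t == l, apart k s, apart k t | k == l])
  (numbers ++ letters)) numbers) numbers) numbers by vm_compute.
move=> /allP/(_ k1 h1)/allP/(_ k2 h2)/allP/(_ k3 h3)/allP/(_ k kP).
by rewrite n12 n13 n23 a1 a2.
Qed.

Lemma letter_not_number p : tr p \in letters -> (tr p \in numbers) = false.
Proof. by move: (tr p) => t; rewrite !inE => /or4P[|||/or4P[|||/orP[]]] /eqP->. Qed.

Lemma trace_letters : [/\ tr a = ka, tr b = kb & tr c = kc] /\ [/\ tr u = ku, tr v = kv & tr w = kw] /\ tr x = kx.
Proof.
have [[[av vc cu] [ub bw wa]] [xa xb xc] [au bv cw] _ _] := fr.
have ea := trace_cases a; have eb := trace_cases b; have ec := trace_cases c; have ex := trace_cases x.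
have eu := trace_cases u; have ev := trace_cases v; have ew := trace_cases w.
split; [split|split; [split|]].
- move: ea; rewrite /trace av [adj a w]sym wa (negbTE au).
  by case: (adj a a); case: (adj a b); case: (adj a c).
- move: eb; rewrite /trace bw [adj b u]sym ub (negbTE bv).
  by case: (adj b a); case: (adj b b); case: (adj b c).
- move: ec; rewrite /trace cu [adj c v]sym vc (negbTE cw).
  by case: (adj c a); case: (adj c b); case: (adj c c).
- move: eu; rewrite /trace ub [adj u c]sym cu [adj u a]sym (negbTE au).
  by case: (adj u u); case: (adj u v); case: (adj u w).
- move: ev; rewrite /trace vc [adj v a]sym av [adj v b]sym (negbTE bv).
  by case: (adj v u); case: (adj v v); case: (adj v w).
- move: ew; rewrite /trace wa [adj w b]sym bw [adj w c]sym (negbTE cw).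
  by case: (adj w u); case: (adj w v); case: (adj w w).
- move: ex; rewrite /trace xa xb xc.
  by case: (adj x u); case: (adj x v); case: (adj x w).
Qed.

(** A common neighbour of two opposite hexagon vertices has a number trace. *)
Lemma numbers_pos : [/\ 0 < #|A|, 0 < #|B| & 0 < #|C|].
Proof.
have [_ _ [au bv cw] _ _] := fr.
split; apply/card_gt0P.
- have [z /andP[h1 h2]] := common au; exists z; rewrite inE; move: (trace_cases z); rewrite /trace h1 h2.
  by case: (adj z b); case: (adj z c); case: (adj z v); case: (adj z w).
- have [z /andP[h1 h2]] := common bv; exists z; rewrite inE; move: (trace_cases z); rewrite /trace h1 h2.
  by case: (adj z a); case: (adj z c); case: (adj z u); case: (adj z w).
- have [z /andP[h1 h2]] := common cw; exists z; rewrite inE; move: (trace_cases z); rewrite /trace h1 h2.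
  by case: (adj z a); case: (adj z b); case: (adj z u); case: (adj z v).
Qed.

Lemma number_independent k : k \in numbers -> independent adj [set z | tr z == k].
Proof.
move=> kn p q; rewrite !inE => /eqP pk /eqP qk; apply: apartN; rewrite pk qk.
by move: kn; rewrite !inE => /or3P[] /eqP->.
Qed.

Lemma number_disjoint k l : k != l -> [disjoint [set z | tr z == k] & [set z | tr z == l]].
Proof.
move=> kl; rewrite disjoints_subset; apply/subsetP => z; rewrite !inE => /eqP->.
by [].
Qed.

Lemma number_uniform k1 k2 k3 : perm_eq [:: k1; k2; k3] numbers ->
  uniform adj [set z | tr z == k1] [set z | tr z == k2] [set z | tr z == k3].
Proof.
move=> pm p q z; rewrite !inE => /eqP pk /eqP qk z2 z3.
have zn : tr z \in numbers -> tr z = k1.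
  by rewrite -(perm_mem pm) !inE (negbTE z2) (negbTE z3) !orbF => /eqP.
have side r : tr r = k1 -> ~~ ((tr r \in numbers) && (tr z \in numbers) && (tr r != tr z)).
  by move=> ->; apply/negP => /andP[/andP[_ /zn ->]]; rewrite eqxx.
by rewrite !adj_trace ?side // pk qk.
Qed.

Lemma number_tripartite : tripartite adj A B C.
Proof.
apply: (determined_tripartite sym Q4 twin_free) numbers_pos.
- by split; apply: number_determined.
- by split; apply: number_uniform.
- move=> p y1 y2 y3; rewrite !inE => /eqP h1 /eqP h2 /eqP h3; apply/negP => /and3P[p1 p2 p3].
  have := contraL (@apartN p y1) p1; have := contraL (@apartN p y2) p2; have := contraL (@apartN p y3) p3.
  rewrite h1 h2 h3; move: (trace_cases p); move: (tr p) => t tP.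
  have : all (fun k => [|| apart k kA, apart k kB | apart k kC]) (numbers ++ letters) by vm_compute.
  by move=> /allP/(_ t tP)/or3P[] ->.
Qed.

(** The hexagon [a w q c u p] has a centre that sees [a], [q], [u] and so lies in [A], or sees [w],
    [c], [p] and so lies in [C]; either way [q] or [p] gets a neighbour it must not have. This
    excludes [#|A| = #|C|], the outcome of [chain_embedding] that no Vega graph realises. *)
Lemma not_both_isolated : isolated adj A C -> isolated adj C A = false.
Proof.
have [[[av vc cu] [ub bw wa]] [xa xb xc] [au bv cw] _ _] := fr.
move=> /exists_inP[p]; rewrite inE => /eqP[pa _ _ pu _ _] /eqP/setP pC.
apply/negbTE/negP => /exists_inP[q]; rewrite inE => /eqP[_ _ qc _ _ qw] /eqP/setP qA.
have [|z] := @hexagon_centre T adj sym Q4 (nth a [:: a; w; q; c; u; p]).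
  by rewrite /= [adj a w]sym wa [adj w q]sym qw qc cu [adj u p]sym pu [adj a p]sym pa.
move=> /= /orP[] /and3P[h1 h2 h3].
- have := trace_cases z; have := qA z; rewrite nbrP in_set in_set0 [adj q z]sym h2 andbT /trace h1 h3.
  by case: (adj z b); case: (adj z c); case: (adj z v); case: (adj z w).
- have := trace_cases z; have := pC z; rewrite nbrP in_set in_set0 [adj p z]sym h3 andbT /trace h1 h2.
  by case: (adj z a); case: (adj z b); case: (adj z u); case: (adj z v).
Qed.

Lemma trace_letter l : l \in letters -> (l == ky) ==> [exists y, tr y == ky] -> exists z, tr z = l.
Proof.
have [[ea eb ec] [[eu ev ew] ex]] := trace_letters.
rewrite !inE => /or4P[|||/or4P[|||/orP[]]] /eqP->; last by move=> /existsP[y /eqP yk]; exists y.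
all: by move=> _; eexists; eassumption.
Qed.

Lemma frame_blowup_aux : isolated adj A C -> exists i mu nu,
  2 <= i /\ blowup_on adj (vega_adj i) (vega_vertices i mu nu).
Proof.
move=> alC; have tri := number_tripartite; have [A0 B0 C0] := numbers_pos.
have nn k : k \in numbers -> independent adj [set z | tr z == k] by exact: number_independent.
have [||||||one cA cB [f cm]] := chain_embedding sym tf tri _ _ _ _ _ _ alC.
1-3: exact: nn. 1-3: exact: number_disjoint.
rewrite not_both_isolated // addn0 in cA.
(* The block of [C] has i - 1 numbers. An isolated vertex of [A] towards [B] means that [B] is one
   short, so that 2i - 1 is missing; [mu] records that nothing plays the part of [y]. *)
pose i := #|C|.+1; pose mu := ~~ [exists y, tr y == ky]; pose nu := isolated adj A B.
have cB' : #|B| + nu = i by rewrite cB cA.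
exists i, mu, nu; split=> //.
have N0 : 0 < 3 * i - 1 by rewrite /i; clear; lia.
(* The default serves vertices with a letter trace, for which [f] is not bounded. *)
pose num z : 'I_(3 * i - 1) := insubd (Ordinal N0) (f z).
pose letter z : 'I_8 := inord (index (tr z) letters).
pose F z : 'I_(3 * i - 1) + 'I_8 := if tr z \in numbers then inl (num z) else inr (letter z).
have fA z : tr z = kA -> f z < i by move=> e; have := chainA' cm; rewrite cA => /(_ z); apply; rewrite inE e.
have fB z : tr z = kB -> i <= f z < 2 * i - nu.
  move=> e; have : z \in B by rewrite inE e.
  by move=> /(chainB' cm); move: cB'; rewrite /i; clear; lia.
have fC z : tr z = kC -> 2 * i <= f z < 3 * i - 1.
  move=> e; have : z \in C by rewrite inE e.
  by move=> /(chainC' cm); rewrite /i; clear; lia.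
have numbersP z : tr z \in numbers -> [\/ tr z = kA, tr z = kB | tr z = kC].
  by rewrite !inE => /or3P[] /eqP; [constructor 1|constructor 2|constructor 3].
have numE z : tr z \in numbers -> num z = f z :> nat.
  move=> zn; rewrite val_insubd; case: ifP => // /negbT/negP[].
  by case: (numbersP z zn) => [/fA|/fB|/fC]; clear; lia.
have letE z : tr z \in letters -> letter z = index (tr z) letters :> nat.
  by move=> zl; rewrite inordK //; have := zl; rewrite -index_mem.
have FN z : tr z \in numbers -> F z = inl (num z) by rewrite /F => ->.
have FL z : tr z \in letters -> F z = inr (letter z) by rewrite /F => /letter_not_number ->.
have cases z : tr z \in numbers \/ tr z \in letters by apply/orP; rewrite -mem_cat; exact: trace_cases.
exists F; split; [|split].
- move=> z; case: (cases z) => zX; rewrite ?(FN _ zX) ?(FL _ zX) /=.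
    rewrite numE //; apply/negP => /andP[nu1 /eqP e].
    by case: (numbersP z zX) => [/fA|/fB|/fC]; rewrite e ?nu1 /=; clear; lia.
  rewrite letE //; apply/negP => /andP[/negP m8 /eqP i7]; apply: m8; apply/existsP; exists z.
  by rewrite -(nth_index [::] zX) i7.
- case=> [j|l] /= ok.
    have jl := ltn_ord j.
    have wit z : z \in A :|: B :|: C -> f z = j -> exists z, F z = inl j.
      rewrite !inE => zn fz; exists z; have zn' : tr z \in numbers by rewrite !inE orbA.
      by rewrite FN //; congr inl; apply: val_inj; rewrite /= numE.
    case: (ltnP j #|A|) => jA.
      by have [z zX fz] := chainA cm jA; apply: (wit z) => //; rewrite 2!in_setU zX.
    case: (leqP j (#|C| + #|B|)) => jB.
      have [|z zX fz] := chainB cm (k := j); first by move: jA; rewrite cA jB andbT.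
      by apply: (wit z) => //; rewrite 2!in_setU zX orbT.
    have [|z zX fz] := chainC cm (k := j); last by apply: (wit z) => //; rewrite 2!in_setU zX orbT.
    by move: jB jl cB' ok; rewrite /i; move: (nu) => m; clear; case: m => /=; lia.
  have lP : nth [::] letters l \in letters by rewrite mem_nth //= ltn_ord.
  have [|z zl] := trace_letter lP.
    apply/implyP => /eqP e; move: ok; rewrite /mu; have -> : l == 7 :> nat; last by rewrite andbT negbK.
    by rewrite -(@nth_uniq _ [::] letters l 7) // e.
  have zL : tr z \in letters by rewrite zl.
  exists z; rewrite FL //; congr inr; apply: val_inj; rewrite /= letE // zl.
  by rewrite index_uniq //= ltn_ord.
have FLN p q : tr p \in letters -> tr q \in numbers -> adj p q = vega_letter_num i (letter p) (num q).
  move=> pl qn; rewrite numE // letE // adj_trace; last by rewrite letter_not_number.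
  have chk : all (fun l => [&& ~~ apart l kA == ((index l letters == 0) || (index l letters == 3)),
     ~~ apart l kB == ((index l letters == 1) || (index l letters == 4)) &
     ~~ apart l kC == ((index l letters == 2) || (index l letters == 5))]) letters by vm_compute.
  have /and3P[/eqP hA /eqP hB /eqP hC] := allP chk _ pl.
  have [nA nB nC] := vega_letter_num_block i (index (tr p) letters) (f q).
  case: (numbersP q qn) => e; rewrite e ?hA ?hB ?hC; [have := fA _ e|have := fB _ e|have := fC _ e].
  - by move=> /nA ->.
  - by move=> h; rewrite nB //; move: h; clear; lia.
  - by move=> /nC ->.
move=> p q; case: (cases p) => pX; case: (cases q) => qX; rewrite ?(FN _ pX) ?(FL _ pX) ?(FN _ qX) ?(FL _ qX) /=.
- rewrite andrasfai_adjE // !numE // (chain_adj cm) ?inE -?orbA; first last.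
  + by move: qX; rewrite !inE.
  + by move: pX; rewrite !inE.
  by congr (_ && _); congr (_ <= _); rewrite /i; clear; lia.
- by rewrite sym FLN.
- by rewrite FLN.
rewrite !letE // adj_trace ?letter_not_number //.
have chk : all (fun s => all (fun t => ~~ apart s t == vega_letter_adj (index s letters) (index t letters))
  letters) letters by vm_compute.
by apply/eqP; exact: (allP (allP chk _ pX) _ qX).
Qed.
End Frame.

(** By [one_isolated] one of the three classes opens the chain; rotating the frame makes it the
    class [A]. *)
Lemma frame_blowup a b c u v w x : frame a b c u v w x -> exists i mu nu,
  2 <= i /\ blowup_on adj (vega_adj i) (vega_vertices i mu nu).
Proof.
move=> fr; have fr1 := frame_rot fr; have fr2 := frame_rot fr1.
have := one_isolated sym tf (number_tripartite fr).
have rot z : [/\ (trace b c a v w u z == kA) = (trace a b c u v w z == kB),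
  (trace b c a v w u z == kC) = (trace a b c u v w z == kA),
  (trace c a b w u v z == kA) = (trace a b c u v w z == kC) &
  (trace c a b w u v z == kC) = (trace a b c u v w z == kB)].
  rewrite /trace; split; by case: (adj z a); case: (adj z b); case: (adj z c);
    case: (adj z u); case: (adj z v); case: (adj z w).
have e1 : [set z | trace b c a v w u z == kA] = [set z | trace a b c u v w z == kB].
  by apply/setP => z; rewrite !inE; case: (rot z).
have e2 : [set z | trace b c a v w u z == kC] = [set z | trace a b c u v w z == kA].
  by apply/setP => z; rewrite !inE; case: (rot z).
have e3 : [set z | trace c a b w u v z == kA] = [set z | trace a b c u v w z == kC].
  by apply/setP => z; rewrite !inE; case: (rot z).
have e4 : [set z | trace c a b w u v z == kC] = [set z | trace a b c u v w z == kB].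
  by apply/setP => z; rewrite !inE; case: (rot z).
case: (boolP (isolated adj _ [set z | trace a b c u v w z == kC])) => [i1 _|_].
  exact: (frame_blowup_aux fr).
case: (boolP (isolated adj _ [set z | trace a b c u v w z == kA])) => [i1 _|_].
  by apply: (frame_blowup_aux fr1); rewrite e1 e2.
case: (boolP (isolated adj _ [set z | trace a b c u v w z == kB])) => [i1 _|_] //.
by apply: (frame_blowup_aux fr2); rewrite e3 e4.
Qed.
End Vega.

(** * Finite configurations *)

(* The edges of the Vega graphs with parameters i, mu, nu = (3, 1, 1), (2, 0, 0), (2, 1, 0), (2, 1, 1);
   the vertices a, v, c, u, b, w, x are numbered 0, ..., 6. The graph for (2, 0, 1) is isomorphic to that
   for (2, 1, 0). *)
Definition cores : seq (nat * seq (nat * nat)) :=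
  [:: (14, [:: (0, 1); (1, 2); (2, 3); (3, 4); (0, 5); (4, 5); (0, 6); (2, 6); (4, 6); (0, 7); (3, 7); (0, 8); (3, 8); (0, 9); (3, 9); (1, 10); (4, 10); (7, 10); (1, 11); (4, 11); (7, 11); (8, 11); (2, 12); (5, 12); (8, 12); (9, 12); (10, 12); (2, 13); (5, 13); (9, 13); (10, 13); (11, 13)]);
     (13, [:: (0, 1); (1, 2); (2, 3); (3, 4); (0, 5); (4, 5); (0, 6); (2, 6); (4, 6); (1, 7); (3, 7); (5, 7); (6, 7); (0, 8); (3, 8); (0, 9); (3, 9); (1, 10); (4, 10); (8, 10); (1, 11); (4, 11); (8, 11); (9, 11); (2, 12); (5, 12); (9, 12); (10, 12)]);
     (12, [:: (0, 1); (1, 2); (2, 3); (3, 4); (0, 5); (4, 5); (0, 6); (2, 6); (4, 6); (0, 7); (3, 7); (0, 8); (3, 8); (1, 9); (4, 9); (7, 9); (1, 10); (4, 10); (7, 10); (8, 10); (2, 11); (5, 11); (8, 11); (9, 11)]);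
     (11, [:: (0, 1); (1, 2); (2, 3); (3, 4); (0, 5); (4, 5); (0, 6); (2, 6); (4, 6); (0, 7); (3, 7); (0, 8); (3, 8); (1, 9); (4, 9); (7, 9); (2, 10); (5, 10); (8, 10); (9, 10)])].

Definition core k := nth (0, [::]) cores k.
Definition core_state k := mkst (core k).1 (core k).2 [::].
(* A core with a new vertex whose neighbours on the hexagon are those in [s]. *)
Definition narrow k (s : seq nat) :=
  let n := (core k).1 in
  mkst n.+1 ((core k).2 ++ [seq (i, n) | i <- s]) [seq (i, n) | i <- iota 0 6 & i \notin s].
(* A core with two new adjacent vertices whose neighbours on the hexagon are those in [s] and [s']. *)
Definition opposed k (s s' : seq nat) :=
  let n := (core k).1 in
  mkst n.+2 ((core k).2 ++ [seq (i, n) | i <- s] ++ [seq (i, n.+1) | i <- s'] ++ [:: (n, n.+1)])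
    ([seq (i, n) | i <- iota 0 6 & i \notin s] ++ [seq (i, n.+1) | i <- iota 0 6 & i \notin s']).

Definition induced_hexagon := mkst 6 hexagon [:: (0, 3); (1, 4); (2, 5)].
Definition centred_hexagon :=
  mkst 7 (hexagon ++ [:: (0, 6); (2, 6); (4, 6)]) [:: (0, 3); (1, 4); (2, 5)].
Definition point_matching := mkst 5 [:: (0, 1); (2, 3)]
  [:: (0, 2); (0, 3); (1, 2); (1, 3); (0, 4); (1, 4); (2, 4); (3, 4)].
Definition point_pentagon := mkst 6 [:: (0, 1); (1, 2); (2, 3); (3, 4); (0, 4)]
  [:: (0, 5); (1, 5); (2, 5); (3, 5); (4, 5)].

(** * Refutation trees *)

Definition hexagon_lemmas : seq (state * cert) := [::
 (mkst 7 [:: (0, 1); (0, 4); (1, 2); (2, 3); (2, 6); (3, 4); (4, 6); (5, 6)] [:: (0, 5); (1, 5); (3, 5)], Join 3 5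
 (Split 0 7 (Instance 0 [:: 0; 1; 2; 6; 5; 7]) (Join 0 5 (Split 2 8 (Instance 0 [:: 0; 4; 3; 7; 5; 8]) (Instance 0
 [:: 0; 1; 2; 6; 5; 8])))));
 (mkst 8 [:: (0, 1); (0, 4); (1, 2); (2, 3); (2, 6); (3, 4); (3, 7); (5, 6); (5, 7)] [:: (0, 5); (0, 6); (0, 7); (1,
 5); (4, 5)], Join 0 5 (Split 2 8 (Instance 0 [:: 0; 4; 3; 7; 5; 8]) (Instance 0 [:: 0; 1; 2; 6; 5; 8])));
 (mkst 6 [:: (0, 1); (0, 4); (1, 2); (2, 3); (3, 4)] [:: (0, 5); (1, 5); (2, 5); (3, 5); (4, 5)], Join 2 5 (Split 4 6
 (Instance 1 [:: 0; 1; 2; 3; 4; 5; 6]) (Split 0 6 (Instance 1 [:: 3; 4; 0; 1; 2; 5; 6]) (Join 0 5 (Join 1 5 (Split 3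
 7 (Instance 1 [:: 2; 1; 0; 4; 3; 5; 7]) (Split 3 8 (Instance 1 [:: 4; 0; 1; 8; 3; 6; 2]) (Instance 2 [:: 3; 4; 0; 1;
 2; 5; 7; 8]))))))));
 (mkst 7 [:: (0, 1); (1, 5); (1, 6); (2, 3); (4, 5); (4, 6)] [:: (0, 2); (0, 3); (0, 4); (1, 2); (1, 3); (2, 4); (2,
 5); (3, 4); (3, 6)], Join 0 4 (Split 2 7 (Instance 3 [:: 0; 1; 6; 4; 7; 3]) (Instance 3 [:: 0; 1; 5; 4; 7; 2])));
 (mkst 6 [:: (0, 1); (1, 5); (2, 3); (4, 5)] [:: (0, 2); (0, 3); (0, 4); (1, 2); (1, 3); (2, 4); (2, 5); (3, 4)],
 Split 3 5 (Join 0 3 (Split 4 6 (Instance 4 [:: 2; 3; 0; 1; 4; 5; 6]) (Join 4 6 (Split 1 7 (Instance 4 [:: 0; 1; 2;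
 3; 4; 5; 7]) (Instance 0 [:: 0; 1; 5; 4; 7; 6]))))) (Instance 4 [:: 0; 1; 2; 3; 4; 5; 5]));
 (mkst 5 [:: (0, 1); (2, 3)] [:: (0, 2); (0, 3); (0, 4); (1, 2); (1, 3); (1, 4); (2, 4); (3, 4)], Join 1 4 (Split 2 5
 (Instance 5 [:: 0; 1; 3; 2; 4; 5]) (Instance 5 [:: 0; 1; 2; 3; 4; 5])))].

(** Index 0 is the induced hexagon, assumed not to map into the graph; the auxiliary states follow
    from index 1 on. *)
Definition hexagon_certs : seq cert := [::
 Instance 6 [:: 0; 1; 2; 3; 4];
 Instance 3 [:: 0; 1; 2; 3; 4; 5]].

Definition centre_lemmas : seq (state * cert) := [::
 (mkst 10 [:: (0, 1); (0, 5); (0, 6); (0, 9); (1, 2); (1, 8); (2, 3); (2, 6); (2, 7); (3, 4); (3, 9); (4, 5); (4, 6);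
 (4, 8); (5, 7); (7, 8); (7, 9)] [::], Prop_Q 2 (units [:: 9; 8; 4; 3; 1; 0]) [:: Instance 0 [:: 0; 9; 7; 8; 4; 6; 5;
 10; 1; 3; 2]; Instance 0 [:: 4; 8; 7; 9; 0; 6; 5; 10; 3; 1; 2]]);
 (mkst 9 [:: (0, 1); (0, 5); (0, 6); (1, 2); (1, 8); (2, 3); (2, 6); (2, 7); (3, 4); (4, 5); (4, 6); (4, 8); (5, 7);
 (7, 8)] [:: (0, 3)], Join 0 3 (Prop_Q 4 [:: (9, 2); (8, 1); (7, 1); (5, 1); (4, 1); (3, 2); (2, 1); (1, 1); (0, 2)]
 [:: Instance 1 [:: 0; 10; 7; 8; 4; 6; 5; 2; 3; 1]; Instance 1 [:: 0; 10; 8; 7; 2; 6; 1; 4; 3; 5]; Instance 1 [:: 2;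
 7; 10; 9; 0; 6; 1; 4; 5; 3]; Instance 1 [:: 4; 8; 10; 9; 0; 6; 5; 2; 1; 3]]));
 (mkst 7 [:: (0, 1); (0, 5); (0, 6); (1, 2); (2, 3); (2, 6); (3, 4); (4, 5); (4, 6)] [:: (0, 3); (1, 4); (2, 5)],
 Join 2 5 (Join 0 3 (Split 7 8 (Instance 2 [:: 4; 5; 0; 1; 2; 3; 6; 8; 7]) (Prop_Q 2 (units [:: 8; 7; 5; 3; 2; 0])
 [:: Instance 2 [:: 7; 5; 0; 8; 3; 2; 9; 6; 4]; Instance 2 [:: 8; 3; 2; 7; 5; 0; 9; 6; 4]]))))].

Definition centre_certs : seq cert := [::
 Instance 3 [:: 0; 1; 2; 3; 4; 5; 6]].

Definition core0_lemmas : seq (state * cert) := [::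
 (mkst 12 [:: (0, 1); (0, 2); (0, 4); (0, 7); (1, 3); (1, 5); (1, 8); (2, 6); (2, 9); (3, 6); (3, 9); (4, 8); (4, 9);
 (4, 10); (5, 7); (5, 9); (5, 10); (6, 7); (6, 8); (6, 10); (7, 11); (8, 11)] [:: (10, 11)], Join 10 11 (Prop_Q 4
 (units [:: 12; 11; 10; 9; 8; 7; 6; 5; 4; 2; 1; 0]) [:: Prop_Q 4 (units [:: 13; 12; 11; 10; 9; 8; 7; 6; 5; 4; 3; 1])
 [::]]));
 (mkst 12 [:: (0, 1); (0, 2); (0, 4); (0, 7); (1, 3); (1, 5); (1, 8); (1, 11); (2, 6); (2, 9); (2, 11); (3, 6); (3,
 9); (4, 8); (4, 9); (4, 10); (5, 7); (5, 9); (5, 10); (6, 7); (6, 8); (6, 10)] [:: (4, 11); (7, 11)], Join 7 11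
 (Prop_Q 3 (units [:: 12; 11; 9; 8; 7; 6; 5; 2; 1]) [:: Instance 0 [:: 7; 6; 5; 3; 13; 2; 1; 0; 8; 9; 11; 4];
 Instance 0 [:: 6; 2; 10; 9; 8; 0; 5; 7; 13; 4; 1; 12]; Instance 0 [:: 5; 1; 10; 8; 9; 0; 6; 7; 13; 4; 2; 12]]));
 (mkst 11 [:: (0, 1); (0, 2); (0, 5); (0, 9); (1, 4); (1, 7); (1, 10); (2, 6); (2, 7); (2, 8); (3, 5); (3, 7); (3,
 8); (3, 10); (4, 5); (4, 6); (4, 8); (6, 10); (9, 10)] [:: (4, 9); (7, 9)], Prop_Q 2 (units [:: 10; 6; 5; 3; 2; 0])
 [:: Instance 1 [:: 1; 0; 10; 11; 4; 2; 3; 7; 5; 6; 8; 9]; Instance 1 [:: 1; 10; 0; 11; 4; 3; 2; 7; 6; 5; 8; 9]]);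
 (mkst 12 [:: (0, 1); (0, 2); (0, 4); (0, 7); (1, 3); (1, 5); (1, 8); (2, 6); (2, 9); (3, 6); (3, 9); (4, 8); (4, 9);
 (4, 11); (5, 7); (5, 9); (5, 11); (6, 7); (6, 8); (7, 10); (8, 10); (10, 11)] [:: (6, 11); (9, 10)], Prop_Q 4 (units
 [:: 11; 10; 9; 8; 7; 6; 5; 4; 3; 2; 1; 0]) [:: Instance 0 [:: 0; 1; 2; 3; 7; 8; 12; 4; 5; 6; 10; 9]; Instance 0 [::
 0; 1; 2; 3; 4; 5; 12; 7; 8; 9; 11; 6]]);
 (mkst 12 [:: (0, 2); (0, 3); (0, 4); (0, 7); (1, 3); (1, 5); (1, 8); (1, 11); (2, 5); (2, 8); (3, 6); (3, 9); (4,
 8); (4, 9); (4, 10); (5, 7); (5, 9); (5, 10); (6, 7); (6, 8); (6, 10); (7, 11)] [:: (4, 11); (9, 11)], Split 10 11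
 (Instance 0 [:: 8; 6; 2; 7; 4; 3; 5; 1; 10; 0; 9; 11]) (Split 2 11 (Join 4 11 (Prop_Q 4 [:: (11, 1); (10, 1); (9,
 1); (8, 1); (7, 1); (6, 1); (5, 1); (4, 2); (3, 1); (1, 1); (0, 1)] [:: Instance 3 [:: 3; 0; 1; 2; 13; 7; 8; 6; 4;
 11; 10; 5]; Instance 3 [:: 6; 8; 7; 2; 13; 1; 0; 3; 4; 11; 9; 5]; Instance 3 [:: 3; 6; 9; 10; 1; 7; 4; 0; 8; 5; 13;
 11]])) (Instance 0 [:: 3; 6; 9; 10; 0; 8; 5; 1; 7; 4; 2; 11])));
 (mkst 12 [:: (0, 2); (0, 3); (0, 4); (0, 7); (1, 3); (1, 5); (1, 8); (1, 11); (2, 8); (2, 11); (3, 6); (3, 9); (4,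
 8); (4, 9); (4, 10); (5, 7); (5, 9); (5, 10); (6, 7); (6, 8); (6, 10); (7, 11)] [:: (4, 11); (9, 11); (10, 11)],
 Join 4 11 (Prop_Q 4 [:: (11, 1); (10, 1); (9, 1); (8, 1); (7, 1); (6, 1); (5, 1); (4, 2); (3, 1); (1, 1); (0, 1)]
 [:: Instance 3 [:: 3; 0; 1; 2; 13; 7; 8; 6; 4; 11; 10; 5]; Instance 3 [:: 6; 8; 7; 2; 13; 1; 0; 3; 4; 11; 9; 5];
 Instance 3 [:: 3; 6; 9; 10; 1; 7; 4; 0; 8; 5; 13; 11]]));
 (mkst 12 [:: (0, 1); (0, 3); (0, 6); (1, 2); (1, 4); (1, 7); (2, 5); (2, 8); (2, 10); (3, 7); (3, 8); (3, 9); (4,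
 6); (4, 8); (4, 9); (5, 6); (5, 7); (5, 9); (6, 10); (9, 11); (10, 11)] [:: (0, 11); (1, 11); (3, 10); (7, 10)],
 Prop_Q 3 (units [:: 11; 10; 9; 8; 6; 5; 3; 2; 0]) [:: Instance 4 [:: 0; 2; 12; 1; 3; 5; 4; 6; 8; 7; 9; 10]; Instance
 5 [:: 0; 2; 12; 1; 3; 5; 4; 6; 8; 7; 9; 10]; Instance 4 [:: 4; 12; 8; 6; 1; 3; 5; 9; 2; 0; 7; 11]; Instance 4 [:: 4;
 12; 6; 8; 1; 5; 3; 9; 0; 2; 7; 11]]);
 (mkst 12 [:: (0, 1); (0, 2); (0, 4); (0, 7); (1, 3); (1, 5); (1, 11); (2, 6); (2, 8); (3, 6); (3, 8); (4, 8); (4,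
 9); (4, 11); (5, 7); (5, 8); (5, 9); (6, 7); (6, 9); (7, 10); (10, 11)] [:: (2, 11); (3, 10); (8, 10)], Split 6 11
 (Instance 4 [:: 5; 11; 9; 1; 8; 6; 0; 7; 4; 3; 2; 10]) (Instance 6 [:: 3; 8; 4; 6; 5; 0; 1; 2; 9; 7; 11; 10]));
 (mkst 11 [:: (0, 2); (0, 3); (0, 5); (0, 9); (1, 4); (1, 6); (1, 9); (2, 4); (2, 6); (2, 8); (3, 6); (3, 7); (4, 5);
 (4, 7); (5, 10); (6, 10); (7, 10); (8, 9); (9, 10)] [:: (3, 8); (5, 8); (7, 8)], Prop_Q 2 (units [:: 9; 7; 4; 3; 1;
 0]) [:: Instance 7 [:: 1; 6; 11; 3; 4; 10; 0; 9; 7; 5; 8; 2]; Instance 2 [:: 9; 0; 10; 4; 3; 11; 6; 5; 7; 8; 2]]);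
 (mkst 11 [:: (0, 2); (0, 4); (0, 6); (1, 3); (1, 4); (1, 6); (1, 9); (2, 3); (2, 7); (3, 5); (3, 8); (4, 7); (4, 8);
 (5, 6); (5, 7); (6, 10); (8, 10); (9, 10)] [:: (0, 9); (2, 9); (5, 9); (7, 9)], Prop_Q 3 (units [:: 10; 8; 7; 6; 5;
 4; 3; 2; 0]) [:: Instance 8 [:: 6; 8; 1; 0; 3; 5; 4; 2; 9; 10; 11]; Instance 8 [:: 6; 8; 1; 5; 4; 0; 3; 7; 9; 10;
 11]]);
 (mkst 12 [:: (0, 2); (0, 3); (0, 4); (0, 7); (1, 3); (1, 5); (1, 8); (1, 11); (2, 5); (2, 8); (3, 6); (3, 9); (4,
 8); (4, 9); (4, 10); (5, 7); (5, 9); (5, 10); (6, 7); (6, 8); (6, 10)] [:: (0, 11); (2, 11); (6, 11); (7, 11); (9,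
 11)], Join 9 11 (Prop_Q 4 (units [:: 12; 11; 10; 9; 8; 6; 5; 4; 3; 2; 1; 0]) [:: Instance 9 [:: 2; 1; 0; 3; 5; 6; 8;
 7; 9; 11; 13]; Instance 9 [:: 2; 1; 0; 3; 5; 6; 13; 7; 9; 11; 12]]));
 (mkst 12 [:: (0, 2); (0, 4); (0, 7); (1, 3); (1, 4); (1, 7); (1, 11); (2, 3); (2, 5); (2, 8); (3, 6); (3, 9); (4,
 8); (4, 9); (4, 10); (5, 7); (5, 9); (5, 10); (6, 7); (6, 8); (6, 10)] [:: (0, 11); (6, 11); (8, 11); (9, 11)],
 Split 2 11 (Instance 2 [:: 1; 3; 4; 5; 6; 7; 8; 9; 10; 11; 2]) (Instance 10 [:: 2; 1; 0; 3; 5; 4; 6; 8; 7; 9; 10;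
 11]));
 (mkst 12 [:: (0, 1); (0, 2); (0, 4); (0, 10); (1, 3); (1, 5); (1, 7); (2, 6); (2, 8); (3, 6); (3, 8); (4, 7); (4,
 8); (4, 9); (5, 8); (5, 9); (5, 10); (6, 7); (6, 9); (7, 11); (9, 11); (10, 11)] [:: (3, 10); (6, 10); (8, 11)],
 Split 2 11 (Instance 5 [:: 2; 5; 11; 8; 6; 1; 4; 0; 9; 3; 7; 10]) (Instance 7 [:: 1; 0; 3; 2; 5; 4; 6; 7; 8; 9; 11;
 10]));
 (mkst 12 [:: (0, 2); (0, 3); (0, 6); (0, 11); (1, 2); (1, 4); (1, 7); (2, 5); (2, 8); (3, 7); (3, 8); (3, 9); (4,
 6); (4, 8); (4, 9); (5, 6); (5, 7); (5, 9); (6, 10); (7, 11); (9, 10); (10, 11)] [:: (2, 10); (8, 10); (8, 11)],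
 Split 4 11 (Instance 7 [:: 7; 3; 1; 8; 5; 0; 4; 11; 2; 6; 10; 9]) (Instance 12 [:: 7; 3; 1; 8; 5; 0; 4; 9; 2; 6; 11;
 10]));
 (mkst 12 [:: (0, 2); (0, 3); (0, 6); (1, 2); (1, 4); (1, 7); (1, 10); (2, 5); (2, 8); (3, 7); (3, 8); (3, 9); (4,
 6); (4, 8); (4, 9); (5, 6); (5, 7); (5, 9); (5, 11); (8, 11); (10, 11)] [:: (0, 10); (3, 10); (6, 10); (9, 10)],
 Prop_Q 3 (units [:: 11; 10; 8; 7; 6; 5; 4; 3; 1]) [:: Instance 8 [:: 4; 7; 12; 6; 3; 8; 5; 0; 10; 1; 2]; Instance 8
 [:: 7; 4; 12; 3; 6; 5; 8; 0; 10; 1; 2]; Instance 8 [:: 12; 2; 11; 3; 5; 6; 8; 9; 10; 1; 4]]);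
 (mkst 12 [:: (0, 2); (0, 3); (0, 4); (0, 7); (1, 3); (1, 5); (1, 8); (2, 5); (2, 8); (2, 11); (3, 6); (3, 10); (4,
 8); (4, 9); (4, 10); (5, 7); (5, 9); (6, 7); (6, 8); (6, 9); (7, 11); (10, 11)] [:: (5, 10)], Split 9 11 (Instance
 12 [:: 3; 0; 1; 2; 6; 4; 5; 7; 8; 9; 10; 11]) (Instance 7 [:: 0; 4; 7; 9; 3; 8; 5; 2; 6; 1; 11; 10]));
 (mkst 15 [:: (0, 3); (0, 4); (0, 7); (0, 10); (1, 4); (1, 5); (1, 7); (1, 10); (2, 5); (2, 6); (2, 7); (2, 10); (3,
 5); (3, 8); (3, 11); (4, 6); (4, 8); (4, 11); (5, 9); (5, 12); (6, 9); (6, 12); (7, 11); (7, 12); (7, 13); (8, 10);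
 (8, 12); (8, 13); (9, 10); (9, 11); (9, 13); (12, 14)] [:: (9, 14); (10, 14); (11, 14)], Split 3 14 (Split 4 14
 (Instance 7 [:: 7; 1; 13; 10; 11; 5; 8; 12; 9; 3; 14; 4]) (Split 13 14 (Split 1 14 (Instance 7 [:: 8; 4; 13; 11; 10;
 6; 7; 12; 9; 2; 14; 1]) (Instance 7 [:: 9; 11; 10; 4; 5; 7; 8; 13; 1; 12; 14; 3])) (Split 1 14 (Instance 7 [:: 4; 8;
 11; 13; 6; 10; 7; 1; 9; 2; 14; 12]) (Prop_Q 3 (units [:: 14; 12; 11; 10; 9; 8; 7; 4; 1]) [:: Instance 7 [:: 6; 4; 2;
 0; 9; 8; 7; 12; 10; 13; 14; 15]; Instance 7 [:: 5; 1; 3; 4; 9; 7; 8; 12; 11; 13; 14; 15]; Instance 7 [:: 11; 9; 4;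
 10; 7; 5; 8; 3; 1; 12; 14; 15]; Instance 7 [:: 8; 4; 13; 11; 10; 6; 7; 12; 9; 2; 14; 15]; Instance 7 [:: 7; 1; 13;
 10; 11; 5; 8; 12; 9; 3; 14; 15]])))) (Join 3 14 (Split 1 15 (Split 2 15 (Split 9 15 (Prop_Q 3 (units [:: 15; 14; 12;
 11; 10; 8; 7; 3; 2]) [:: Instance 7 [:: 8; 3; 13; 11; 10; 5; 7; 12; 9; 1; 14; 16]; Instance 7 [:: 7; 2; 13; 10; 11;
 5; 8; 12; 9; 3; 14; 16]; Instance 7 [:: 11; 4; 16; 8; 7; 6; 10; 9; 12; 2; 15; 1]]) (Instance 1 [:: 5; 1; 3; 4; 9; 7;
 8; 12; 10; 11; 13; 15])) (Instance 11 [:: 2; 1; 6; 4; 7; 9; 8; 10; 12; 11; 13; 15])) (Split 0 14 (Instance 7 [:: 8;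
 3; 13; 11; 10; 5; 7; 12; 9; 1; 14; 0]) (Split 9 15 (Instance 7 [:: 5; 3; 1; 0; 9; 8; 7; 12; 10; 13; 14; 15]) (Prop_Q
 4 (units [:: 15; 14; 12; 11; 10; 9; 8; 7; 5; 4; 3; 1]) [:: Instance 7 [:: 5; 3; 1; 0; 9; 8; 7; 12; 10; 13; 14; 16];
 Instance 7 [:: 8; 3; 13; 11; 10; 5; 7; 12; 9; 1; 14; 16]; Instance 7 [:: 8; 4; 13; 11; 10; 6; 7; 12; 9; 2; 14; 16];
 Instance 1 [:: 5; 3; 16; 0; 9; 8; 7; 12; 11; 10; 13; 15]]))))));
 (mkst 15 [:: (0, 3); (0, 4); (0, 7); (0, 10); (1, 4); (1, 5); (1, 7); (1, 10); (2, 5); (2, 6); (2, 7); (2, 10); (3,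
 5); (3, 8); (3, 11); (4, 6); (4, 8); (4, 11); (5, 9); (5, 12); (6, 9); (6, 12); (7, 11); (7, 12); (7, 13); (8, 10);
 (8, 12); (8, 13); (9, 10); (9, 11); (9, 13); (9, 14)] [:: (7, 14); (8, 14); (12, 14)], Join 12 14 (Split 2 15 (Split
 0 15 (Prop_Q 3 (units [:: 15; 14; 12; 10; 9; 8; 6; 4; 0]) [:: Instance 15 [:: 6; 0; 2; 16; 9; 7; 8; 12; 10; 13; 14;
 15]; Instance 15 [:: 10; 11; 0; 9; 16; 7; 6; 2; 4; 12; 14; 15]]) (Split 11 15 (Instance 7 [:: 5; 3; 1; 0; 9; 8; 7;
 12; 10; 13; 15; 11]) (Instance 16 [:: 0; 1; 2; 3; 4; 5; 6; 7; 8; 9; 10; 11; 12; 13; 15]))) (Split 1 15 (Instance 0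
 [:: 4; 8; 11; 13; 6; 10; 7; 1; 12; 9; 2; 15]) (Split 4 15 (Split 13 15 (Split 3 15 (Prop_Q 3 (units [:: 15; 14; 12;
 11; 9; 7; 5; 4; 1]) [:: Instance 15 [:: 5; 4; 3; 16; 9; 8; 7; 12; 11; 13; 14; 15]; Instance 15 [:: 11; 12; 3; 16; 9;
 8; 1; 4; 5; 10; 14; 15]]) (Instance 7 [:: 7; 11; 12; 3; 1; 9; 8; 13; 5; 10; 15; 4])) (Instance 7 [:: 1; 7; 10; 13;
 5; 11; 8; 4; 9; 3; 15; 12])) (Split 10 15 (Split 11 15 (Instance 16 [:: 0; 1; 2; 3; 4; 5; 6; 10; 11; 12; 7; 8; 9;
 15; 14]) (Instance 7 [:: 5; 1; 3; 4; 9; 7; 8; 12; 11; 13; 15; 10])) (Split 11 15 (Instance 7 [:: 3; 5; 0; 1; 8; 9;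
 7; 11; 10; 13; 15; 12]) (Instance 16 [:: 0; 1; 2; 3; 4; 5; 6; 7; 8; 9; 10; 11; 12; 13; 15])))))));
 (mkst 12 [:: (0, 1); (0, 3); (0, 6); (1, 2); (1, 4); (1, 7); (2, 5); (2, 8); (2, 10); (3, 7); (3, 8); (3, 9); (4,
 6); (4, 8); (4, 9); (4, 11); (5, 6); (5, 7); (5, 9); (7, 11); (10, 11)] [:: (0, 10); (3, 10); (6, 10)], Split 9 10
 (Instance 8 [:: 5; 8; 9; 6; 3; 7; 4; 0; 10; 2; 1]) (Instance 14 [:: 0; 2; 1; 3; 5; 4; 6; 8; 7; 9; 10; 11]));
 (mkst 15 [:: (0, 3); (0, 4); (0, 7); (0, 10); (1, 4); (1, 5); (1, 7); (1, 10); (2, 5); (2, 6); (2, 7); (2, 10); (3,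
 5); (3, 6); (3, 8); (3, 11); (4, 6); (4, 8); (4, 11); (5, 9); (5, 12); (6, 9); (6, 12); (7, 11); (7, 12); (7, 13);
 (8, 10); (8, 12); (8, 13); (9, 10); (9, 11); (9, 13); (10, 14)] [:: (7, 14); (11, 14); (12, 14)], Join 11 14 (Split
 8 15 (Split 13 14 (Split 6 15 (Split 3 14 (Instance 7 [:: 9; 5; 13; 12; 11; 1; 8; 10; 7; 4; 14; 3]) (Split 1 15
 (Prop_Q 3 (units [:: 14; 13; 7; 6; 5; 4; 3; 2; 0]) [:: Instance 13 [:: 10; 16; 2; 9; 3; 7; 0; 13; 5; 11; 4; 8];
 Instance 13 [:: 10; 16; 0; 8; 6; 7; 2; 13; 4; 12; 5; 9]; Instance 7 [:: 8; 15; 12; 1; 13; 11; 5; 3; 7; 9; 16; 14];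
 Instance 13 [:: 1; 3; 5; 7; 8; 9; 10; 11; 12; 13; 14; 15]; Instance 7 [:: 1; 4; 5; 6; 7; 8; 9; 10; 12; 13; 14; 16];
 Instance 13 [:: 1; 3; 5; 7; 8; 9; 10; 11; 12; 13; 14; 15]; Instance 13 [:: 1; 3; 5; 7; 8; 9; 10; 11; 12; 13; 14;
 15]]) (Split 5 14 (Instance 15 [:: 12; 11; 6; 7; 5; 15; 13; 8; 9; 14; 1; 4]) (Prop_Q 3 (units [:: 15; 14; 12; 11;
 10; 8; 7; 5; 2]) [:: Instance 13 [:: 9; 4; 11; 5; 8; 7; 13; 1; 3; 16; 14; 10]; Instance 13 [:: 2; 3; 5; 7; 8; 9; 10;
 11; 12; 13; 14; 16]; Instance 7 [:: 9; 5; 13; 12; 11; 1; 8; 10; 7; 4; 14; 16]; Instance 7 [:: 5; 9; 12; 13; 3; 10;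
 7; 2; 8; 0; 16; 11]; Instance 13 [:: 16; 3; 5; 7; 8; 9; 10; 11; 12; 13; 14; 15]])))) (Split 4 14 (Split 5 14
 (Instance 7 [:: 13; 9; 8; 6; 7; 5; 4; 14; 12; 1; 15; 11]) (Instance 13 [:: 1; 3; 5; 7; 8; 9; 10; 11; 12; 13; 14;
 4])) (Split 5 14 (Instance 13 [:: 1; 6; 4; 7; 9; 8; 10; 12; 11; 13; 14; 5]) (Prop_Q 4 [:: (15, 1); (14, 1); (12, 1);
 (11, 2); (10, 1); (9, 1); (8, 1); (7, 1); (5, 1); (4, 1); (1, 1)] [:: Instance 13 [:: 1; 3; 5; 7; 8; 9; 10; 11; 12;
 13; 14; 16]; Instance 7 [:: 9; 5; 13; 12; 11; 1; 8; 10; 7; 4; 14; 16]; Instance 2 [:: 16; 1; 11; 8; 5; 12; 9; 4; 3;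
 14; 10]; Instance 13 [:: 16; 3; 5; 7; 8; 9; 10; 11; 12; 13; 14; 15]])))) (Split 3 14 (Instance 7 [:: 5; 9; 12; 13;
 1; 11; 8; 3; 7; 4; 14; 10]) (Split 5 15 (Instance 7 [:: 5; 9; 12; 13; 1; 11; 8; 15; 7; 4; 14; 10]) (Split 0 15
 (Split 1 15 (Split 5 14 (Split 6 15 (Prop_Q 3 (units [:: 15; 14; 13; 12; 9; 7; 6; 5; 0]) [:: Instance 13 [:: 10; 16;
 0; 8; 6; 7; 2; 13; 4; 12; 5; 9]; Instance 13 [:: 0; 13; 7; 3; 9; 12; 16; 8; 11; 5; 14; 10]; Instance 13 [:: 10; 16;
 0; 8; 6; 7; 2; 13; 4; 12; 5; 9]; Instance 13 [:: 9; 0; 10; 5; 16; 8; 13; 3; 14; 12; 7; 11]]) (Prop_Q 4 [:: (15, 1);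
 (14, 1); (13, 1); (12, 1); (11, 1); (10, 1); (9, 1); (8, 1); (7, 2); (6, 1); (2, 1)] [:: Instance 2 [:: 10; 8; 9; 7;
 3; 0; 6; 13; 11; 14; 16]; Instance 13 [:: 11; 14; 15; 7; 5; 8; 3; 16; 1; 12; 6; 9]; Instance 15 [:: 9; 0; 11; 10; 5;
 7; 8; 13; 3; 12; 14; 16]; Instance 16 [:: 3; 4; 15; 5; 6; 1; 16; 8; 9; 7; 11; 12; 10; 13; 14]])) (Split 6 15 (Prop_Q
 4 [:: (14, 1); (13, 1); (12, 1); (11, 1); (10, 1); (9, 1); (8, 1); (7, 2); (5, 1); (3, 1); (0, 1)] [:: Instance 2
 [:: 16; 8; 7; 9; 3; 5; 0; 13; 11; 14; 10]; Instance 2 [:: 16; 9; 7; 8; 5; 3; 1; 13; 12; 14; 10]; Instance 13 [:: 9;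
 12; 5; 11; 8; 1; 10; 7; 3; 15; 14; 16]; Instance 13 [:: 11; 12; 7; 9; 8; 1; 15; 5; 13; 10; 14; 16]; Instance 2 [::
 16; 0; 5; 8; 7; 13; 1; 3; 12; 14; 10]; Instance 15 [:: 8; 2; 12; 10; 15; 7; 9; 13; 6; 11; 14; 16]]) (Join 6 15
 (Prop_Q 3 (units [:: 16; 15; 12; 11; 10; 9; 8; 7; 6]) [:: Instance 16 [:: 3; 4; 15; 5; 6; 1; 17; 8; 9; 7; 11; 12;
 10; 13; 14]; Instance 15 [:: 11; 16; 9; 15; 7; 6; 8; 3; 17; 12; 1; 5]; Instance 15 [:: 8; 16; 12; 15; 10; 6; 11; 3;
 17; 9; 1; 5]])))) (Split 6 15 (Prop_Q 3 (units [:: 15; 14; 13; 11; 8; 7; 5; 3; 2]) [:: Instance 2 [:: 16; 8; 7; 9;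
 3; 5; 0; 13; 11; 14; 10]; Instance 13 [:: 2; 13; 7; 6; 8; 11; 16; 9; 12; 15; 14; 10]; Instance 7 [:: 9; 5; 13; 12;
 11; 1; 8; 10; 7; 4; 14; 16]; Instance 13 [:: 10; 16; 2; 9; 3; 7; 0; 13; 5; 11; 4; 8]; Instance 13 [:: 8; 2; 10; 15;
 16; 9; 13; 6; 14; 11; 7; 12]; Instance 16 [:: 2; 1; 0; 6; 5; 4; 3; 7; 9; 8; 10; 12; 11; 13; 16]; Instance 13 [:: 10;
 16; 2; 9; 3; 7; 0; 13; 5; 11; 4; 8]]) (Instance 2 [:: 8; 4; 12; 9; 1; 10; 7; 6; 5; 15; 11]))) (Instance 2 [:: 8; 3;
 10; 7; 5; 12; 9; 0; 1; 15; 11]))))) (Split 1 15 (Split 12 15 (Split 13 15 (Split 4 14 (Instance 15 [:: 8; 2; 12; 10;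
 4; 7; 9; 13; 6; 11; 14; 15]) (Split 5 14 (Instance 15 [:: 9; 0; 11; 10; 5; 7; 8; 13; 3; 12; 14; 15]) (Instance 2 [::
 10; 1; 9; 12; 4; 8; 11; 5; 6; 14; 15]))) (Instance 7 [:: 4; 8; 11; 13; 6; 10; 7; 1; 9; 2; 15; 12])) (Instance 16 [::
 2; 1; 0; 6; 5; 4; 3; 7; 9; 8; 10; 12; 11; 13; 15])) (Split 12 15 (Instance 7 [:: 3; 5; 0; 1; 8; 9; 7; 11; 10; 13;
 15; 12]) (Instance 16 [:: 2; 1; 0; 6; 5; 4; 3; 7; 9; 8; 10; 12; 11; 13; 15])))));
 (mkst 15 [:: (0, 3); (0, 4); (0, 7); (0, 10); (1, 4); (1, 5); (1, 7); (1, 10); (2, 5); (2, 6); (2, 7); (2, 10); (3,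
 5); (3, 6); (3, 8); (3, 11); (4, 6); (4, 8); (4, 11); (5, 9); (5, 12); (6, 9); (6, 12); (7, 11); (7, 12); (7, 13);
 (7, 14); (8, 10); (8, 12); (8, 13); (9, 10); (9, 11); (9, 13)] [:: (8, 14); (9, 14); (10, 14)], Join 10 14 (Split 4
 15 (Split 12 15 (Split 3 15 (Split 13 15 (Prop_Q 3 (units [:: 15; 14; 11; 10; 9; 7; 5; 3; 1]) [:: Instance 13 [:: 1;
 3; 16; 7; 15; 9; 10; 11; 14; 13; 8; 4]; Instance 13 [:: 11; 10; 16; 7; 15; 5; 3; 1; 14; 12; 8; 4]]) (Instance 13 [::
 11; 12; 7; 9; 8; 1; 4; 5; 13; 10; 15; 3])) (Instance 7 [:: 1; 5; 4; 3; 7; 9; 8; 10; 11; 13; 15; 12])) (Instance 19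
 [:: 0; 1; 2; 3; 4; 5; 6; 7; 8; 9; 10; 11; 12; 13; 15])) (Split 6 15 (Split 13 15 (Split 11 15 (Split 5 15 (Prop_Q 3
 (units [:: 15; 14; 12; 10; 8; 7; 6; 4; 1]) [:: Instance 13 [:: 1; 6; 16; 7; 15; 8; 10; 12; 14; 13; 9; 5]; Instance
 13 [:: 12; 10; 16; 7; 15; 4; 6; 1; 14; 11; 9; 5]]) (Instance 13 [:: 6; 13; 15; 4; 7; 10; 2; 8; 11; 1; 5; 12]))
 (Instance 19 [:: 0; 1; 2; 3; 4; 5; 6; 7; 8; 9; 10; 11; 12; 13; 15])) (Instance 7 [:: 4; 8; 11; 13; 1; 12; 9; 6; 7;
 5; 15; 10])) (Split 5 15 (Split 11 15 (Instance 7 [:: 1; 4; 5; 6; 7; 8; 9; 10; 12; 13; 15; 11]) (Instance 19 [:: 0;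
 1; 2; 3; 4; 5; 6; 7; 8; 9; 10; 11; 12; 13; 15])) (Split 13 15 (Split 12 15 (Split 11 15 (Instance 19 [:: 0; 1; 2; 3;
 4; 5; 6; 10; 11; 12; 7; 8; 9; 15; 14]) (Instance 13 [:: 7; 3; 11; 1; 8; 9; 13; 5; 4; 10; 15; 12])) (Split 11 15
 (Instance 13 [:: 7; 6; 12; 1; 9; 8; 13; 4; 5; 10; 15; 11]) (Instance 19 [:: 0; 1; 2; 3; 4; 5; 6; 7; 8; 9; 10; 11;
 12; 13; 15]))) (Instance 11 [:: 5; 10; 12; 8; 9; 7; 4; 1; 6; 13; 11; 15]))))));
 (mkst 15 [:: (0, 3); (0, 4); (0, 7); (0, 10); (1, 4); (1, 5); (1, 7); (1, 10); (2, 5); (2, 6); (2, 7); (2, 10); (3,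
 5); (3, 6); (3, 8); (3, 11); (4, 6); (4, 8); (4, 11); (5, 9); (5, 12); (6, 9); (6, 12); (7, 11); (7, 12); (7, 13);
 (8, 10); (8, 12); (8, 13); (9, 10); (9, 11); (9, 13)] [:: (7, 14); (8, 14); (9, 14); (10, 14); (11, 14); (12, 14)],
 Split 2 14 (Split 0 14 (Split 1 14 (Join 9 14 (Split 4 15 (Split 12 15 (Instance 11 [:: 5; 15; 1; 4; 9; 7; 8; 12;
 10; 11; 13; 14]) (Instance 13 [:: 4; 13; 8; 6; 7; 10; 0; 9; 12; 2; 14; 15])) (Split 12 15 (Instance 11 [:: 13; 12;
 9; 6; 7; 10; 4; 8; 11; 2; 0; 15]) (Prop_Q 4 [:: (15, 1); (14, 1); (12, 1); (11, 1); (10, 1); (9, 2); (8, 1); (7, 1);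
 (6, 1); (4, 1); (1, 1)] [:: Instance 13 [:: 4; 13; 8; 6; 7; 10; 0; 9; 12; 2; 14; 16]; Instance 11 [:: 10; 16; 1; 7;
 8; 5; 11; 9; 4; 12; 3; 14]; Instance 11 [:: 5; 16; 1; 4; 9; 7; 8; 12; 10; 11; 13; 14]; Instance 13 [:: 16; 13; 8; 6;
 7; 10; 1; 9; 12; 2; 14; 15]])))) (Instance 11 [:: 1; 0; 5; 3; 7; 9; 8; 10; 12; 11; 13; 14])) (Instance 11 [:: 0; 2;
 3; 5; 7; 8; 9; 10; 11; 12; 13; 14])) (Split 0 14 (Instance 11 [:: 2; 0; 5; 3; 7; 9; 8; 10; 12; 11; 13; 14]) (Split 1
 14 (Instance 11 [:: 2; 1; 6; 4; 7; 9; 8; 10; 12; 11; 13; 14]) (Split 5 14 (Split 6 14 (Join 8 14 (Split 0 15 (Prop_Q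
 4 (units [:: 15; 14; 13; 9; 8; 7; 6; 5; 4; 3; 1; 0]) [:: Instance 13 [:: 4; 13; 8; 1; 9; 12; 6; 7; 10; 5; 14; 16];
 Instance 13 [:: 1; 13; 7; 4; 9; 12; 5; 8; 11; 6; 14; 16]; Instance 18 [:: 0; 3; 5; 7; 8; 9; 10; 16; 12; 13; 14;
 15]]) (Prop_Q 3 (units [:: 15; 14; 13; 9; 8; 7; 6; 4; 1]) [:: Instance 13 [:: 4; 13; 8; 1; 9; 12; 6; 7; 10; 5; 14;
 16]; Instance 13 [:: 1; 13; 7; 4; 9; 12; 5; 8; 11; 6; 14; 16]; Instance 11 [:: 11; 16; 3; 8; 7; 5; 10; 9; 0; 12; 1;
 14]; Instance 11 [:: 13; 16; 8; 4; 7; 10; 6; 9; 12; 0; 2; 15]; Instance 7 [:: 8; 12; 10; 5; 13; 6; 1; 4; 9; 16; 0;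
 7]]))) (Instance 11 [:: 6; 5; 4; 1; 9; 8; 7; 12; 11; 10; 13; 14])) (Split 13 14 (Instance 11 [:: 11; 13; 3; 8; 7; 5;
 10; 9; 0; 12; 1; 14]) (Split 3 14 (Split 4 14 (Join 9 14 (Split 12 15 (Instance 18 [:: 1; 5; 3; 7; 9; 8; 10; 12; 11;
 13; 14; 15]) (Prop_Q 4 [:: (15, 1); (14, 1); (12, 1); (11, 1); (10, 1); (9, 2); (8, 1); (7, 1); (5, 1); (4, 1); (1,
 1)] [:: Instance 13 [:: 1; 13; 7; 5; 8; 11; 4; 9; 12; 3; 14; 16]; Instance 11 [:: 11; 16; 3; 8; 7; 5; 10; 9; 0; 12;
 1; 14]; Instance 11 [:: 6; 16; 4; 1; 9; 8; 7; 12; 11; 10; 13; 14]; Instance 13 [:: 16; 13; 7; 5; 8; 11; 4; 9; 12; 3;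
 14; 15]]))) (Instance 11 [:: 4; 3; 1; 5; 8; 7; 9; 11; 10; 12; 13; 14])) (Split 4 14 (Instance 11 [:: 3; 4; 5; 1; 8;
 9; 7; 11; 12; 10; 13; 14]) (Join 7 14 (Split 3 15 (Split 10 15 (Instance 11 [:: 1; 15; 5; 3; 7; 9; 8; 10; 12; 11;
 13; 14]) (Split 9 15 (Instance 11 [:: 13; 15; 8; 3; 7; 10; 5; 9; 12; 0; 1; 14]) (Instance 20 [:: 0; 1; 2; 3; 4; 5;
 6; 7; 8; 9; 10; 11; 12; 13; 15]))) (Split 10 15 (Split 4 15 (Instance 11 [:: 2; 15; 6; 4; 7; 9; 8; 10; 12; 11; 13;
 14]) (Split 5 15 (Instance 11 [:: 0; 15; 3; 5; 7; 8; 9; 10; 11; 12; 13; 14]) (Instance 11 [:: 4; 10; 11; 9; 8; 7; 5;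
 1; 3; 13; 12; 15]))) (Split 8 15 (Prop_Q 3 (units [:: 15; 11; 10; 9; 8; 7; 6; 4; 2]) [:: Instance 11 [:: 2; 15; 10;
 8; 7; 9; 4; 16; 0; 13; 11; 14]; Instance 11 [:: 12; 15; 6; 16; 7; 3; 10; 8; 2; 11; 0; 14]]) (Split 9 15 (Split 6 14
 (Instance 11 [:: 5; 6; 1; 4; 9; 7; 8; 12; 10; 11; 13; 14]) (Prop_Q 4 (units [:: 15; 14; 12; 10; 9; 8; 7; 6; 5; 4; 2;
 1]) [:: Instance 11 [:: 13; 16; 9; 5; 7; 10; 3; 8; 11; 1; 0; 14]; Instance 11 [:: 13; 16; 7; 1; 8; 11; 5; 9; 12; 4;
 3; 14]; Instance 11 [:: 2; 16; 6; 4; 7; 9; 8; 10; 12; 11; 13; 14]; Instance 11 [:: 0; 16; 3; 5; 7; 8; 9; 10; 11; 12;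
 13; 14]; Instance 11 [:: 6; 16; 4; 1; 9; 8; 7; 12; 11; 10; 13; 14]; Instance 11 [:: 5; 16; 1; 4; 9; 7; 8; 12; 10;
 11; 13; 14]])) (Instance 20 [:: 0; 1; 2; 3; 4; 5; 6; 7; 8; 9; 10; 11; 12; 13; 15])))))))))))))].

Definition core0_certs : seq cert := [::
 Instance 21 [:: 7; 8; 9; 10; 11; 12; 13; 0; 4; 2; 3; 1; 5; 6; 14];
 Instance 20 [:: 7; 8; 9; 10; 11; 12; 13; 0; 4; 2; 3; 1; 5; 6; 14];
 Instance 16 [:: 9; 8; 7; 13; 12; 11; 10; 0; 2; 4; 3; 5; 1; 6; 14];
 Instance 17 [:: 7; 8; 9; 10; 11; 12; 13; 0; 4; 2; 3; 1; 5; 6; 14];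
 Instance 19 [:: 7; 8; 9; 10; 11; 12; 13; 0; 4; 2; 3; 1; 5; 6; 14];
 Instance 17 [:: 9; 8; 7; 13; 12; 11; 10; 0; 2; 4; 3; 5; 1; 6; 14];
 Instance 16 [:: 7; 8; 9; 10; 11; 12; 13; 0; 4; 2; 3; 1; 5; 6; 14];
 Instance 3 [:: 10; 12; 7; 8; 1; 5; 3; 4; 2; 0; 15; 14];
 Instance 3 [:: 8; 12; 11; 10; 0; 2; 4; 3; 5; 1; 15; 14];
 Instance 3 [:: 8; 11; 12; 13; 0; 4; 2; 3; 1; 5; 14; 15]].

Definition core1_lemmas : seq (state * cert) := [::
 (mkst 12 [:: (0, 2); (0, 3); (0, 4); (0, 7); (1, 3); (1, 5); (1, 8); (1, 11); (2, 5); (2, 8); (3, 6); (3, 9); (4,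
 8); (4, 9); (4, 10); (5, 7); (5, 9); (5, 10); (6, 7); (6, 8); (6, 10); (10, 11)] [:: (9, 11)], Join 9 11 (Instance 0
 [:: 8; 6; 2; 7; 4; 3; 5; 1; 10; 0; 9; 11]));
 (mkst 12 [:: (0, 2); (0, 3); (0, 4); (0, 7); (1, 3); (1, 5); (1, 8); (1, 11); (2, 5); (2, 8); (3, 6); (3, 9); (4,
 8); (4, 9); (4, 10); (5, 7); (5, 9); (5, 10); (6, 7); (6, 8); (6, 10); (7, 11)] [:: (4, 11); (9, 11)], Instance 4
 [:: 0; 1; 2; 3; 4; 5; 6; 7; 8; 9; 10; 11]);
 (mkst 12 [:: (0, 2); (0, 4); (0, 7); (1, 3); (1, 4); (1, 7); (2, 3); (2, 5); (2, 8); (3, 6); (3, 9); (3, 11); (4,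
 8); (4, 9); (4, 10); (5, 7); (5, 9); (5, 10); (6, 7); (6, 8); (6, 10); (10, 11)] [:: (7, 11); (8, 11)], Instance 1
 [:: 6; 3; 10; 9; 7; 2; 4; 8; 1; 5; 0; 11]);
 (mkst 11 [:: (0, 3); (0, 6); (0, 10); (1, 2); (1, 3); (1, 6); (2, 5); (2, 7); (2, 10); (3, 7); (3, 8); (4, 6); (4,
 7); (4, 8); (4, 10); (5, 6); (5, 8); (8, 9); (9, 10)] [:: (6, 9); (7, 9)], Prop_Q 2 (units [:: 10; 8; 5; 3; 2; 0])
 [:: Instance 35 [:: 1; 5; 3; 8; 2; 0; 4; 6; 7; 11; 10; 9]; Instance 35 [:: 1; 0; 2; 10; 3; 5; 4; 6; 7; 11; 8; 9]]);
 (mkst 11 [:: (0, 1); (0, 2); (0, 5); (0, 9); (1, 3); (1, 6); (2, 6); (2, 7); (3, 5); (3, 7); (4, 5); (4, 6); (4, 9);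
 (5, 10); (6, 10); (7, 9); (7, 10); (8, 9); (8, 10)] [:: (2, 8); (3, 8)], Prop_Q 2 (units [:: 9; 7; 6; 4; 3; 1]) [::
 Instance 33 [:: 1; 9; 11; 0; 6; 7; 5; 3; 4; 2; 10; 8]; Instance 36 [:: 11; 1; 0; 6; 7; 5; 3; 2; 10; 8; 9]]);
 (mkst 11 [:: (0, 2); (0, 3); (0, 4); (0, 9); (1, 3); (1, 5); (1, 6); (1, 9); (2, 5); (2, 6); (3, 7); (4, 6); (4, 7);
 (4, 8); (5, 7); (5, 8); (7, 10); (9, 10)] [:: (3, 8); (8, 10)], Prop_Q 3 (units [:: 10; 9; 7; 6; 5; 4; 2; 1; 0]) [::
 Instance 37 [:: 1; 9; 3; 10; 2; 11; 0; 7; 8; 5; 4]; Instance 37 [:: 0; 9; 3; 10; 6; 11; 1; 7; 8; 4; 5]]);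
 (mkst 12 [:: (0, 1); (0, 3); (0, 6); (1, 2); (1, 4); (1, 7); (2, 5); (2, 8); (2, 10); (3, 7); (3, 8); (4, 6); (4,
 8); (4, 11); (5, 6); (5, 7); (6, 9); (7, 9); (7, 11); (8, 9); (10, 11)] [:: (3, 10); (6, 10)], Prop_Q 3 (units [::
 11; 10; 8; 7; 6; 5; 4; 3; 2]) [:: Instance 38 [:: 3; 1; 8; 7; 12; 2; 4; 5; 10; 0; 6]; Instance 38 [:: 6; 1; 5; 4;
 12; 2; 7; 8; 10; 0; 3]; Instance 38 [:: 8; 7; 4; 3; 2; 11; 1; 12; 10; 9; 6]]);
 (mkst 12 [:: (0, 2); (0, 3); (0, 4); (0, 6); (1, 3); (1, 5); (1, 7); (1, 11); (2, 5); (2, 7); (3, 8); (3, 10); (4,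
 7); (4, 8); (4, 11); (5, 6); (5, 8); (6, 9); (6, 10); (7, 9); (8, 9); (10, 11)] [:: (7, 10)], Prop_Q 4 (units [::
 11; 10; 9; 8; 7; 6; 5; 4; 3; 2; 1; 0]) [:: Instance 34 [:: 0; 1; 2; 3; 6; 12; 8; 4; 5; 10; 9; 7]]);
 (mkst 12 [:: (0, 2); (0, 3); (0, 4); (0, 7); (1, 3); (1, 5); (1, 8); (1, 11); (2, 5); (2, 8); (2, 11); (3, 6); (3,
 10); (4, 8); (4, 9); (4, 10); (5, 7); (5, 9); (6, 7); (6, 8); (6, 9); (10, 11)] [:: (5, 10); (6, 11); (9, 11)],
 Prop_Q 3 (units [:: 11; 10; 9; 5; 4; 3; 2; 1; 0]) [:: Instance 34 [:: 1; 4; 12; 8; 5; 0; 6; 3; 9; 2; 7; 10];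
 Instance 40 [:: 0; 9; 7; 4; 2; 6; 3; 5; 8; 1; 10; 12]; Instance 34 [:: 8; 12; 1; 4; 6; 5; 0; 2; 3; 9; 7; 11]]);
 (mkst 12 [:: (0, 2); (0, 4); (0, 7); (0, 11); (1, 3); (1, 4); (1, 7); (1, 11); (2, 3); (2, 5); (2, 8); (3, 6); (3,
 10); (4, 8); (4, 9); (5, 7); (5, 9); (5, 10); (6, 7); (6, 8); (6, 9); (10, 11)] [:: (4, 10); (6, 11)], Split 9 11
 (Instance 40 [:: 2; 9; 8; 5; 0; 6; 3; 4; 7; 1; 10; 11]) (Instance 41 [:: 2; 1; 0; 3; 5; 4; 6; 8; 7; 9; 10; 11]));
 (mkst 12 [:: (0, 1); (0, 2); (0, 3); (0, 6); (1, 4); (1, 7); (1, 11); (2, 5); (2, 8); (2, 10); (3, 7); (3, 8); (3,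
 10); (4, 6); (4, 8); (5, 6); (5, 7); (5, 11); (6, 9); (7, 9); (8, 9); (10, 11)] [:: (4, 10); (6, 10); (9, 10)],
 Split 8 11 (Instance 34 [:: 5; 3; 2; 7; 6; 8; 1; 11; 0; 9; 4; 10]) (Instance 41 [:: 7; 2; 3; 5; 1; 8; 6; 9; 0; 4;
 11; 10]));
 (mkst 12 [:: (0, 1); (0, 2); (0, 3); (0, 6); (1, 4); (1, 7); (1, 10); (2, 5); (2, 8); (2, 11); (3, 7); (3, 8); (3,
 9); (4, 6); (4, 8); (4, 9); (5, 6); (5, 7); (5, 9); (6, 10); (7, 11); (10, 11)] [:: (3, 10); (8, 10)], Split 9 10
 (Instance 42 [:: 6; 9; 0; 3; 10; 2; 7; 5; 1; 11; 8; 4]) (Instance 43 [:: 0; 2; 1; 6; 8; 7; 3; 5; 4; 9; 10; 11]));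
 (mkst 12 [:: (0, 2); (0, 4); (0, 7); (0, 10); (1, 3); (1, 4); (1, 7); (1, 10); (2, 3); (2, 5); (2, 8); (3, 6); (3,
 11); (4, 8); (4, 9); (5, 7); (5, 9); (5, 11); (6, 7); (6, 8); (6, 9); (10, 11)] [:: (6, 10); (8, 10)], Split 4 11
 (Instance 44 [:: 3; 1; 2; 6; 4; 5; 11; 7; 8; 9; 10; 0]) (Instance 42 [:: 0; 1; 2; 3; 4; 5; 6; 7; 8; 9; 11; 10]));
 (mkst 12 [:: (0, 2); (0, 4); (0, 7); (0, 10); (1, 3); (1, 4); (1, 7); (2, 3); (2, 5); (2, 8); (3, 6); (3, 11); (4,
 8); (4, 9); (5, 7); (5, 9); (5, 11); (6, 7); (6, 8); (6, 9); (8, 10); (10, 11)] [:: (4, 11)], Prop_Q 4 (units [::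
 11; 10; 9; 8; 7; 6; 5; 4; 3; 2; 1; 0]) [:: Instance 44 [:: 2; 0; 3; 5; 12; 6; 8; 7; 11; 9; 4; 1]]);
 (mkst 12 [:: (0, 2); (0, 4); (0, 7); (0, 11); (1, 3); (1, 4); (1, 7); (1, 10); (2, 3); (2, 5); (2, 8); (3, 6); (4,
 8); (4, 9); (5, 7); (5, 9); (6, 7); (6, 8); (6, 9); (8, 11); (9, 10); (10, 11)] [:: (3, 11)], Split 2 10 (Instance
 34 [:: 7; 10; 5; 1; 6; 2; 4; 0; 9; 3; 8; 11]) (Instance 46 [:: 0; 5; 4; 9; 2; 1; 6; 7; 8; 3; 11; 10]));
 (mkst 12 [:: (0, 1); (0, 3); (0, 6); (1, 2); (1, 4); (1, 7); (2, 5); (2, 8); (2, 11); (3, 7); (3, 8); (3, 9); (3,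
 11); (4, 6); (4, 8); (4, 9); (5, 6); (5, 7); (5, 9); (6, 11); (8, 10); (10, 11)] [:: (0, 10); (1, 10); (5, 10); (9,
 10)], Join 1 10 (Prop_Q 4 [:: (12, 1); (11, 1); (10, 1); (9, 1); (6, 1); (5, 1); (4, 1); (3, 1); (2, 1); (1, 2); (0,
 1)] [:: Instance 47 [:: 8; 1; 3; 0; 2; 9; 6; 4; 11; 5; 13; 10]; Instance 45 [:: 8; 11; 4; 6; 3; 1; 5; 2; 9; 7; 10;
 13]; Instance 45 [:: 8; 11; 4; 6; 3; 1; 5; 2; 9; 7; 10; 13]; Instance 45 [:: 8; 11; 4; 13; 3; 1; 5; 2; 9; 7; 10;
 12]]));
 (mkst 12 [:: (0, 2); (0, 3); (0, 4); (0, 7); (1, 3); (1, 5); (1, 8); (1, 11); (2, 5); (2, 8); (3, 6); (3, 9); (4,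
 8); (4, 9); (4, 10); (5, 7); (5, 9); (5, 10); (6, 7); (6, 8); (6, 10); (9, 11)] [:: (0, 11); (2, 11); (6, 11)],
 Split 10 11 (Instance 45 [:: 1; 9; 8; 4; 5; 6; 0; 3; 2; 7; 11; 10]) (Instance 48 [:: 10; 6; 3; 5; 8; 0; 4; 7; 1; 2;
 11; 9]));
 (mkst 12 [:: (0, 2); (0, 3); (0, 4); (1, 3); (1, 5); (1, 8); (1, 10); (2, 5); (2, 8); (3, 6); (4, 8); (4, 9); (4,
 11); (5, 7); (5, 9); (6, 7); (6, 8); (6, 9); (7, 11); (9, 10); (10, 11)] [:: (3, 11)], Prop_Q 4 (units [:: 11; 10;
 9; 8; 7; 6; 5; 4; 3; 2; 1; 0]) [:: Instance 49 [:: 6; 10; 3; 9; 8; 12; 5; 7; 1; 4; 2; 11]]);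
 (mkst 12 [:: (0, 2); (0, 4); (0, 7); (1, 3); (1, 4); (1, 7); (2, 3); (2, 5); (2, 8); (3, 6); (3, 9); (3, 11); (4,
 8); (4, 9); (4, 10); (5, 7); (5, 9); (5, 10); (6, 7); (6, 8); (6, 10)] [:: (4, 11); (5, 11); (7, 11); (8, 11)], Join
 8 11 (Split 7 12 (Instance 39 [:: 10; 6; 3; 5; 8; 1; 4; 7; 2; 0; 11; 12]) (Split 0 12 (Split 5 12 (Instance 39 [::
 0; 2; 3; 7; 8; 9; 4; 5; 6; 10; 11; 12]) (Prop_Q 3 (units [:: 12; 11; 10; 7; 6; 5; 3; 2; 0]) [:: Instance 42 [:: 8;
 0; 6; 13; 4; 3; 5; 2; 10; 9; 11; 12]; Instance 50 [:: 12; 13; 0; 11; 8; 7; 3; 1; 2; 6; 10; 4]; Instance 49 [:: 5; 8;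
 10; 2; 7; 4; 3; 9; 6; 0; 1; 12]; Instance 49 [:: 5; 8; 10; 2; 7; 4; 3; 9; 6; 0; 1; 12]])) (Split 10 12 (Instance 49
 [:: 7; 8; 0; 6; 5; 4; 3; 1; 2; 10; 9; 12]) (Prop_Q 3 (units [:: 12; 11; 9; 8; 7; 6; 5; 4; 3]) [:: Instance 38 [::
 13; 3; 5; 6; 4; 2; 9; 8; 0; 11; 12]; Instance 38 [:: 7; 2; 6; 5; 13; 3; 8; 9; 11; 0; 4]; Instance 38 [:: 6; 5; 3;
 10; 8; 13; 2; 4; 12; 7; 0]; Instance 49 [:: 7; 8; 0; 6; 5; 4; 3; 1; 2; 13; 9; 12]; Instance 38 [:: 7; 2; 6; 0; 13;
 8; 3; 4; 12; 5; 10]])))));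
 (mkst 12 [:: (0, 2); (0, 3); (0, 4); (0, 7); (1, 3); (1, 5); (1, 8); (1, 11); (2, 5); (2, 8); (3, 6); (3, 9); (4,
 8); (4, 9); (5, 7); (5, 9); (6, 7); (6, 8); (6, 11); (7, 10); (8, 10); (9, 10)] [:: (0, 11); (4, 11); (9, 11)],
 Split 10 11 (Instance 49 [:: 0; 10; 4; 7; 3; 8; 5; 2; 9; 6; 1; 11]) (Instance 49 [:: 9; 6; 10; 3; 5; 8; 0; 4; 7; 1;
 2; 11]));
 (mkst 12 [:: (0, 2); (0, 3); (0, 6); (1, 2); (1, 4); (1, 7); (1, 11); (2, 5); (2, 8); (3, 7); (3, 8); (3, 9); (3,
 11); (4, 6); (4, 8); (4, 9); (5, 6); (5, 7); (5, 9); (6, 11); (10, 11)] [:: (0, 10); (2, 10); (4, 10); (7, 10); (8,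
 10); (9, 10)], Join 4 10 (Instance 10 [:: 2; 11; 0; 1; 5; 3; 4; 8; 6; 7; 9; 10]));
 (mkst 12 [:: (0, 2); (0, 3); (0, 4); (1, 3); (1, 5); (1, 7); (1, 10); (2, 5); (2, 7); (2, 11); (3, 6); (3, 8); (4,
 7); (4, 8); (4, 9); (5, 8); (5, 9); (6, 7); (6, 9); (9, 11); (10, 11)] [:: (0, 10); (4, 10); (6, 10)], Split 8 11
 (Instance 38 [:: 2; 8; 0; 5; 7; 3; 4; 1; 6; 11; 10]) (Instance 7 [:: 5; 2; 8; 0; 9; 7; 3; 1; 4; 6; 10; 11]));
 (mkst 12 [:: (0, 2); (0, 4); (0, 6); (1, 3); (1, 4); (1, 6); (2, 3); (2, 7); (2, 11); (3, 5); (3, 8); (4, 7); (4,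
 8); (5, 6); (5, 7); (5, 10); (6, 9); (7, 9); (8, 9); (8, 11); (10, 11)] [:: (4, 10); (9, 10)], Split 0 10 (Instance
 50 [:: 6; 8; 1; 9; 0; 3; 7; 5; 4; 2; 11; 10]) (Instance 54 [:: 0; 5; 2; 6; 4; 3; 9; 7; 1; 8; 10; 11]));
 (mkst 12 [:: (0, 2); (0, 3); (0, 4); (1, 3); (1, 5); (1, 7); (2, 5); (2, 7); (2, 11); (3, 6); (3, 8); (4, 7); (4,
 8); (4, 9); (5, 8); (5, 9); (6, 7); (6, 9); (8, 10); (9, 11); (10, 11)] [:: (6, 10); (7, 10)], Split 0 10 (Instance
 44 [:: 4; 0; 9; 7; 3; 5; 8; 2; 6; 1; 10; 11]) (Instance 55 [:: 6; 1; 9; 5; 7; 8; 3; 4; 2; 0; 10; 11]));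
 (mkst 10 [:: (0, 2); (0, 4); (0, 6); (0, 9); (1, 3); (1, 4); (1, 6); (2, 3); (2, 7); (3, 5); (3, 8); (4, 7); (4, 8);
 (5, 6); (5, 7); (5, 9); (8, 9)] [:: (1, 9); (6, 8)], Join 1 9 (Instance 38 [:: 0; 5; 2; 6; 4; 3; 7; 1; 8; 9; 10]));
 (mkst 14 [:: (0, 2); (0, 5); (0, 8); (1, 3); (1, 4); (1, 5); (1, 8); (2, 4); (2, 6); (2, 9); (3, 6); (3, 9); (4, 7);
 (4, 10); (5, 9); (5, 10); (5, 11); (6, 8); (6, 10); (6, 11); (7, 8); (7, 9); (7, 11); (8, 12); (9, 12); (10, 12);
 (11, 12)] [:: (5, 13); (6, 13); (7, 13); (8, 13); (9, 13); (10, 13)], Split 0 13 (Split 11 13 (Instance 38 [:: 2; 7;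
 6; 9; 0; 11; 8; 5; 13; 4; 10]) (Split 4 13 (Instance 53 [:: 9; 8; 7; 5; 6; 4; 2; 1; 11; 10; 13; 0]) (Split 1 13
 (Instance 51 [:: 2; 3; 4; 1; 6; 7; 5; 9; 10; 8; 11; 13]) (Instance 53 [:: 1; 2; 4; 5; 6; 7; 8; 9; 10; 11; 13; 0]))))
 (Split 2 13 (Instance 51 [:: 1; 0; 4; 2; 5; 7; 6; 8; 10; 9; 11; 13]) (Split 3 13 (Instance 11 [:: 2; 3; 4; 1; 6; 7;
 5; 9; 10; 8; 11; 13]) (Split 12 13 (Instance 10 [:: 2; 12; 6; 9; 4; 8; 5; 0; 10; 7; 1; 13]) (Split 11 13 (Instance
 10 [:: 2; 11; 9; 6; 4; 5; 8; 0; 7; 10; 1; 13]) (Split 1 13 (Instance 51 [:: 2; 3; 4; 1; 6; 7; 5; 9; 10; 8; 11; 13])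
 (Split 4 13 (Instance 51 [:: 3; 2; 1; 4; 6; 5; 7; 9; 8; 10; 11; 13]) (Join 2 13 (Split 12 14 (Split 1 14 (Instance
 53 [:: 8; 2; 6; 1; 9; 10; 12; 4; 3; 5; 13; 14]) (Split 7 14 (Split 5 14 (Instance 53 [:: 11; 2; 6; 5; 4; 8; 7; 0;
 10; 1; 13; 14]) (Instance 56 [:: 7; 3; 8; 9; 4; 6; 5; 1; 2; 10; 14; 12])) (Instance 55 [:: 3; 5; 6; 10; 1; 12; 9; 8;
 4; 7; 14; 2]))) (Split 7 14 (Split 10 14 (Prop_Q 3 (units [:: 14; 10; 9; 8; 7; 6; 5; 3; 1]) [:: Instance 51 [:: 3;
 2; 15; 14; 6; 5; 7; 9; 8; 10; 11; 13]; Instance 53 [:: 4; 15; 1; 7; 6; 5; 10; 9; 8; 11; 13; 14]]) (Split 5 14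
 (Instance 53 [:: 11; 2; 6; 5; 4; 8; 7; 0; 10; 1; 13; 14]) (Split 1 14 (Prop_Q 3 (units [:: 14; 12; 10; 9; 8; 6; 5;
 2; 1]) [:: Instance 53 [:: 4; 15; 10; 2; 8; 5; 1; 9; 6; 0; 13; 14]; Instance 51 [:: 11; 15; 7; 14; 5; 8; 2; 6; 9; 1;
 0; 13]]) (Instance 52 [:: 10; 7; 12; 4; 5; 8; 2; 6; 9; 1; 3; 14])))) (Split 5 14 (Split 8 14 (Instance 10 [:: 4; 14;
 1; 2; 7; 5; 6; 10; 8; 9; 11; 13]) (Instance 56 [:: 3; 7; 1; 9; 6; 4; 12; 8; 2; 10; 14; 5])) (Split 10 14 (Split 11
 14 (Prop_Q 4 (units [:: 14; 13; 10; 9; 8; 7; 6; 5; 4; 3; 2; 1]) [:: Instance 53 [:: 11; 2; 6; 5; 4; 8; 7; 0; 10; 1;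
 13; 15]; Instance 53 [:: 1; 2; 4; 5; 6; 7; 8; 9; 10; 11; 13; 15]; Instance 53 [:: 0; 4; 2; 5; 7; 6; 8; 10; 9; 11;
 13; 15]; Instance 51 [:: 3; 2; 1; 15; 6; 5; 7; 9; 8; 10; 11; 13]; Instance 53 [:: 4; 3; 1; 7; 6; 5; 10; 9; 8; 11;
 13; 15]; Instance 53 [:: 12; 2; 9; 8; 4; 5; 10; 0; 7; 1; 13; 15]; Instance 53 [:: 5; 2; 9; 15; 6; 7; 11; 4; 3; 8;
 13; 14]]) (Split 1 14 (Prop_Q 3 (units [:: 14; 11; 9; 8; 7; 6; 5; 2; 1]) [:: Instance 53 [:: 4; 15; 7; 2; 5; 8; 1;
 6; 9; 0; 13; 14]; Instance 51 [:: 12; 15; 10; 14; 8; 5; 2; 9; 6; 1; 0; 13]]) (Instance 49 [:: 7; 10; 11; 4; 9; 6; 1;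
 8; 5; 2; 3; 14]))) (Split 1 14 (Instance 53 [:: 7; 5; 9; 8; 10; 2; 4; 0; 12; 6; 14; 1]) (Split 3 14 (Instance 49 [::
 5; 2; 10; 9; 1; 6; 7; 11; 4; 3; 8; 14]) (Instance 53 [:: 3; 4; 1; 9; 10; 8; 6; 7; 5; 12; 14; 2])))))))))))))));
 (mkst 14 [:: (0, 2); (0, 5); (0, 8); (1, 3); (1, 4); (1, 5); (1, 8); (2, 4); (2, 6); (2, 9); (3, 6); (3, 9); (4, 7);
 (4, 10); (5, 9); (5, 10); (5, 11); (6, 8); (6, 10); (6, 11); (6, 13); (7, 8); (7, 9); (7, 11); (8, 12); (9, 12);
 (10, 12); (11, 12)] [:: (5, 13); (7, 13); (9, 13)], Split 1 13 (Instance 34 [:: 2; 1; 0; 4; 9; 8; 10; 6; 5; 7; 12;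
 13]) (Split 4 13 (Split 12 13 (Prop_Q 3 (units [:: 13; 11; 9; 7; 6; 5; 4; 3; 1]) [:: Instance 46 [:: 10; 13; 5; 14;
 12; 1; 7; 4; 11; 8; 6; 3]; Instance 42 [:: 9; 11; 2; 6; 5; 4; 8; 7; 0; 1; 13; 14]]) (Join 12 13 (Prop_Q 3 (units [::
 14; 13; 12; 10; 9; 6; 5; 3; 1]) [:: Instance 40 [:: 2; 1; 0; 4; 9; 8; 6; 5; 7; 11; 13; 15]; Instance 46 [:: 5; 3;
 10; 6; 9; 4; 8; 1; 12; 7; 15; 13]; Instance 40 [:: 10; 15; 5; 6; 12; 1; 4; 9; 8; 7; 13; 14]; Instance 46 [:: 15; 3;
 10; 6; 9; 4; 8; 1; 12; 7; 14; 13]]))) (Split 12 13 (Instance 49 [:: 4; 12; 7; 10; 2; 8; 5; 1; 9; 6; 0; 13])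
 (Instance 51 [:: 7; 2; 8; 6; 9; 1; 10; 4; 12; 3; 5; 13]))));
 (mkst 12 [:: (0, 2); (0, 3); (0, 6); (0, 11); (1, 2); (1, 4); (1, 7); (2, 5); (2, 8); (3, 7); (3, 8); (4, 6); (4,
 8); (4, 11); (5, 6); (5, 7); (6, 9); (7, 9); (7, 11); (8, 9); (10, 11)] [:: (1, 10); (2, 10); (3, 10); (5, 10); (6,
 10)], Split 9 10 (Instance 38 [:: 0; 8; 6; 3; 11; 9; 4; 7; 10; 2; 1]) (Instance 53 [:: 1; 0; 2; 7; 6; 8; 4; 3; 5; 9;
 10; 11]));
 (mkst 12 [:: (0, 2); (0, 4); (0, 7); (1, 3); (1, 4); (1, 7); (2, 3); (2, 5); (2, 8); (3, 6); (3, 9); (4, 8); (4, 9);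
 (4, 10); (5, 7); (5, 9); (5, 10); (6, 7); (6, 8); (6, 10); (9, 11)] [:: (2, 11); (6, 11); (7, 11); (8, 11)], Split 0
 11 (Instance 56 [:: 1; 10; 7; 4; 3; 5; 8; 6; 9; 2; 11; 0]) (Split 10 11 (Instance 52 [:: 7; 9; 1; 5; 0; 3; 10; 6; 4;
 2; 8; 11]) (Split 1 11 (Instance 52 [:: 2; 1; 0; 3; 8; 7; 9; 5; 4; 6; 10; 11]) (Instance 60 [:: 3; 10; 6; 1; 5; 8;
 2; 4; 7; 0; 11; 9]))));
 (mkst 12 [:: (0, 2); (0, 4); (0, 7); (1, 3); (1, 4); (1, 7); (2, 3); (2, 5); (2, 8); (3, 6); (3, 9); (4, 8); (4, 9);
 (5, 7); (5, 9); (6, 7); (6, 8); (6, 11); (7, 10); (8, 10); (9, 10)] [:: (1, 11); (2, 11); (4, 11); (9, 11)], Split 5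
 11 (Instance 61 [:: 6; 10; 3; 9; 7; 2; 4; 8; 1; 5; 0; 11]) (Instance 61 [:: 0; 1; 2; 3; 7; 8; 9; 4; 5; 6; 10; 11]));
 (mkst 12 [:: (0, 2); (0, 3); (0, 4); (0, 7); (1, 3); (1, 5); (1, 8); (2, 5); (2, 8); (3, 6); (3, 9); (4, 8); (4, 9);
 (4, 10); (5, 7); (5, 9); (5, 10); (6, 7); (6, 8); (6, 10); (9, 11)] [:: (0, 11); (6, 11); (10, 11)], Split 8 11
 (Instance 38 [:: 5; 6; 1; 10; 9; 8; 3; 4; 11; 7; 0]) (Instance 62 [:: 7; 10; 0; 4; 6; 2; 9; 5; 3; 8; 1; 11]));
 (mkst 15 [:: (0, 2); (0, 3); (0, 5); (0, 8); (1, 3); (1, 4); (1, 5); (1, 8); (1, 13); (2, 4); (2, 6); (2, 9); (2,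
 13); (3, 6); (4, 7); (4, 10); (5, 9); (5, 10); (5, 11); (5, 14); (6, 8); (6, 10); (6, 11); (6, 14); (7, 8); (7, 9);
 (7, 11); (7, 13); (8, 12); (9, 12); (10, 12); (11, 12); (12, 13); (13, 14)] [::], Split 4 14 (Instance 32 [:: 5; 9;
 2; 6; 8; 1; 0; 11; 10; 14; 7; 12; 4; 13]) (Instance 57 [:: 2; 10; 0; 5; 6; 1; 4; 3; 14; 13]));
 (mkst 14 [:: (0, 2); (0, 3); (0, 5); (0, 8); (1, 3); (1, 4); (1, 5); (1, 8); (1, 13); (2, 4); (2, 6); (2, 9); (2,
 13); (3, 6); (3, 9); (4, 7); (4, 10); (5, 9); (5, 10); (5, 11); (6, 8); (6, 10); (6, 11); (7, 8); (7, 9); (7, 11);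
 (7, 13); (8, 12); (9, 12); (10, 12); (11, 12); (12, 13)] [::], Prop_Q 2 (units [:: 13; 11; 6; 5; 2; 1]) [:: Instance
 64 [:: 3; 5; 6; 0; 10; 1; 2; 12; 9; 8; 4; 13; 7; 11; 14]; Instance 64 [:: 0; 1; 2; 3; 4; 5; 6; 7; 8; 9; 10; 11; 12;
 13; 14]]);
 (mkst 14 [:: (0, 2); (0, 3); (0, 5); (0, 8); (1, 3); (1, 4); (1, 5); (1, 8); (1, 12); (2, 4); (2, 6); (2, 9); (2,
 12); (3, 6); (3, 9); (4, 7); (4, 10); (5, 9); (5, 10); (5, 11); (6, 8); (6, 10); (6, 11); (7, 8); (7, 9); (7, 11);
 (7, 12); (8, 13); (9, 13); (10, 13); (12, 13)] [::], Split 11 13 (Instance 65 [:: 0; 1; 2; 3; 4; 5; 6; 7; 8; 9; 10;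
 11; 13; 12]) (Instance 57 [:: 5; 7; 0; 8; 9; 6; 11; 2; 13; 10]));
 (mkst 14 [:: (0, 2); (0, 3); (0, 5); (0, 8); (1, 3); (1, 4); (1, 5); (1, 8); (2, 4); (2, 6); (2, 9); (3, 6); (3, 9);
 (4, 7); (4, 10); (5, 9); (5, 10); (5, 11); (6, 8); (6, 10); (6, 11); (7, 8); (7, 9); (7, 11); (7, 13); (8, 12); (9,
 12); (10, 12)] [:: (5, 13); (6, 13); (10, 13)], Split 3 13 (Instance 63 [:: 8; 2; 7; 6; 1; 9; 10; 12; 4; 3; 5; 13])
 (Split 2 13 (Split 1 13 (Join 10 13 (Split 8 14 (Split 9 14 (Instance 66 [:: 0; 1; 2; 3; 4; 5; 6; 7; 8; 9; 10; 11;
 13; 14]) (Instance 63 [:: 1; 11; 8; 5; 4; 6; 9; 3; 7; 10; 2; 14])) (Instance 63 [:: 2; 11; 9; 6; 4; 5; 8; 0; 7; 10;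
 1; 14]))) (Instance 63 [:: 10; 7; 12; 4; 6; 9; 1; 5; 8; 2; 3; 13])) (Instance 61 [:: 0; 1; 2; 4; 8; 9; 10; 5; 6; 7;
 12; 13])));
 (mkst 14 [:: (0, 2); (0, 3); (0, 5); (0, 8); (1, 3); (1, 4); (1, 5); (1, 8); (1, 12); (2, 4); (2, 6); (2, 9); (2,
 12); (3, 6); (3, 9); (4, 7); (4, 10); (5, 9); (5, 10); (5, 11); (6, 8); (6, 10); (6, 11); (7, 8); (7, 9); (7, 11);
 (7, 12); (10, 13); (12, 13)] [::], Split 8 13 (Split 9 13 (Instance 66 [:: 0; 1; 2; 3; 4; 5; 6; 7; 8; 9; 10; 11; 12;
 13]) (Instance 63 [:: 1; 11; 8; 5; 4; 6; 9; 3; 7; 10; 2; 13])) (Instance 63 [:: 2; 11; 9; 6; 4; 5; 8; 0; 7; 10; 1;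
 13]));
 (mkst 14 [:: (0, 2); (0, 3); (0, 5); (0, 8); (1, 3); (1, 4); (1, 5); (1, 8); (2, 4); (2, 6); (2, 9); (3, 6); (3, 9);
 (4, 7); (4, 10); (5, 9); (5, 10); (5, 11); (6, 8); (6, 10); (6, 11); (7, 8); (7, 9); (7, 11); (8, 12); (9, 12); (10,
 12); (11, 12); (11, 13)] [:: (8, 13); (9, 13)], Split 1 13 (Prop_Q 4 [:: (13, 1); (11, 1); (9, 1); (8, 1); (7, 1);
 (6, 1); (5, 1); (4, 1); (2, 2); (1, 1); (0, 1)] [:: Instance 63 [:: 8; 10; 1; 6; 7; 5; 2; 0; 4; 11; 9; 13]; Instance
 63 [:: 8; 10; 1; 6; 7; 5; 2; 0; 4; 11; 9; 13]; Instance 68 [:: 3; 8; 9; 0; 7; 1; 14; 11; 6; 5; 4; 13; 12; 10]])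
 (Instance 63 [:: 9; 10; 2; 5; 7; 6; 1; 3; 4; 11; 8; 13]));
 (mkst 14 [:: (0, 2); (0, 3); (0, 5); (0, 8); (1, 3); (1, 4); (1, 5); (1, 8); (2, 4); (2, 6); (2, 9); (3, 6); (3, 9);
 (4, 10); (4, 12); (5, 9); (5, 10); (5, 13); (6, 8); (6, 10); (6, 13); (7, 8); (7, 9); (8, 11); (8, 12); (9, 11); (9,
 12); (10, 11); (11, 13); (12, 13)] [:: (7, 13)], Join 7 13 (Instance 69 [:: 0; 1; 2; 3; 4; 5; 6; 12; 8; 9; 10; 13;
 11; 14]));
 (mkst 15 [:: (0, 2); (0, 3); (0, 5); (0, 8); (1, 3); (1, 4); (1, 5); (1, 8); (2, 4); (2, 6); (2, 9); (3, 6); (3, 9);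
 (4, 7); (4, 10); (5, 9); (5, 10); (5, 11); (5, 14); (6, 8); (6, 10); (6, 11); (6, 14); (7, 8); (7, 9); (7, 11); (8,
 12); (8, 13); (9, 12); (9, 13); (10, 12); (11, 12); (13, 14)] [:: (7, 14); (10, 13)], Split 12 14 (Split 11 13
 (Prop_Q 3 (units [:: 14; 9; 8; 7; 6; 5; 4; 2; 1]) [:: Instance 70 [:: 0; 1; 2; 3; 15; 8; 9; 10; 5; 6; 7; 11; 14;
 13]; Instance 70 [:: 0; 1; 2; 3; 4; 5; 6; 7; 8; 9; 10; 12; 15; 14]]) (Instance 70 [:: 0; 1; 2; 3; 4; 5; 6; 13; 8; 9;
 10; 12; 7; 11])) (Instance 70 [:: 0; 1; 2; 3; 4; 8; 9; 14; 5; 6; 7; 11; 10; 12]))].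

Definition core1_certs : seq cert := [::
 Instance 58 [:: 8; 9; 10; 11; 12; 0; 4; 2; 3; 1; 5; 6; 7; 13];
 Instance 59 [:: 11; 10; 9; 8; 12; 4; 0; 2; 1; 3; 5; 6; 7; 13];
 Instance 59 [:: 8; 9; 10; 11; 12; 3; 1; 5; 0; 4; 2; 7; 6; 13];
 Instance 67 [:: 8; 9; 10; 11; 12; 0; 4; 2; 3; 1; 5; 6; 7; 13];
 Instance 59 [:: 11; 10; 9; 8; 12; 1; 3; 5; 4; 0; 2; 7; 6; 13];
 Instance 59 [:: 8; 9; 10; 11; 12; 0; 4; 2; 3; 1; 5; 6; 7; 13];
 Instance 67 [:: 11; 10; 9; 8; 12; 1; 3; 5; 4; 0; 2; 7; 6; 13];
 Instance 3 [:: 10; 12; 8; 9; 1; 5; 3; 4; 2; 0; 14; 13];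
 Instance 3 [:: 9; 12; 11; 10; 0; 2; 4; 3; 5; 1; 14; 13];
 Instance 71 [:: 8; 9; 10; 11; 12; 0; 4; 2; 3; 1; 5; 6; 7; 13; 14]].

Definition core2_lemmas : seq (state * cert) := [::
 (mkst 12 [:: (0, 2); (0, 3); (0, 4); (0, 7); (1, 3); (1, 5); (1, 8); (2, 5); (2, 8); (2, 10); (3, 6); (3, 9); (4,
 8); (4, 9); (5, 7); (5, 9); (6, 7); (6, 8); (7, 11); (8, 11); (9, 11); (10, 11)] [:: (3, 10); (4, 10)], Join 4 10
 (Instance 0 [:: 5; 7; 1; 6; 9; 0; 8; 2; 11; 3; 4; 10]));
 (mkst 12 [:: (0, 2); (0, 4); (0, 7); (0, 11); (1, 3); (1, 4); (1, 7); (2, 3); (2, 5); (2, 8); (3, 6); (3, 9); (4,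
 8); (4, 9); (4, 10); (5, 7); (5, 9); (5, 10); (6, 7); (6, 8); (6, 10); (10, 11)] [:: (8, 11)], Split 3 11 (Instance
 0 [:: 5; 7; 9; 1; 10; 0; 3; 2; 6; 4; 11; 8]) (Instance 83 [:: 2; 1; 0; 3; 8; 7; 9; 5; 4; 6; 11; 10]));
 (mkst 12 [:: (0, 2); (0, 3); (0, 4); (0, 10); (1, 3); (1, 7); (1, 10); (2, 5); (2, 7); (3, 6); (3, 8); (4, 7); (4,
 8); (4, 9); (5, 8); (5, 9); (6, 9); (6, 11); (8, 11); (10, 11)] [:: (9, 10)], Join 9 10 (Prop_Q 4 (units [:: 11; 10;
 9; 8; 7; 6; 5; 4; 3; 2; 1; 0]) [::]));
 (mkst 12 [:: (0, 2); (0, 4); (0, 7); (1, 3); (1, 4); (1, 7); (1, 11); (2, 3); (2, 5); (2, 8); (2, 11); (3, 6); (3,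
 9); (4, 8); (4, 9); (4, 10); (5, 7); (5, 9); (5, 10); (6, 7); (6, 8); (6, 10)] [:: (6, 11); (9, 11); (10, 11)], Join
 9 11 (Instance 1 [:: 3; 2; 1; 0; 6; 5; 4; 9; 8; 7; 10; 11]));
 (mkst 12 [:: (0, 2); (0, 4); (0, 7); (1, 3); (1, 4); (1, 7); (2, 3); (2, 5); (2, 8); (3, 6); (3, 9); (4, 8); (4, 9);
 (4, 10); (5, 7); (5, 9); (5, 10); (6, 7); (6, 8); (6, 10); (7, 11); (8, 11)] [:: (3, 11); (10, 11)], Split 9 11
 (Instance 84 [:: 8; 0; 6; 7; 4; 3; 5; 2; 10; 1; 9; 11]) (Instance 86 [:: 0; 8; 7; 6; 4; 5; 3; 2; 1; 10; 9; 11]));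
 (mkst 11 [:: (0, 1); (0, 2); (0, 5); (0, 10); (1, 3); (1, 6); (2, 6); (2, 7); (2, 9); (3, 5); (3, 7); (3, 9); (4,
 5); (4, 6); (4, 10); (5, 8); (6, 8); (8, 9); (9, 10)] [:: (7, 8); (7, 10)], Prop_Q 2 (units [:: 10; 9; 6; 4; 3; 1])
 [:: Instance 84 [:: 3; 11; 5; 4; 9; 0; 6; 1; 8; 10; 2; 7]; Instance 87 [:: 1; 11; 0; 10; 6; 5; 9; 3; 2; 4; 8; 7]]);
 (mkst 12 [:: (0, 2); (0, 4); (0, 6); (0, 11); (1, 3); (1, 4); (1, 6); (2, 3); (2, 7); (3, 5); (3, 9); (4, 7); (4,
 8); (4, 9); (5, 6); (5, 7); (5, 8); (6, 10); (8, 10); (9, 10); (9, 11)] [:: (1, 11); (7, 11); (8, 11)], Prop_Q 2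
 (units [:: 10; 9; 6; 3; 2; 0]) [:: Instance 88 [:: 2; 12; 0; 9; 5; 3; 6; 11; 1; 4; 7]; Instance 88 [:: 10; 12; 9; 0;
 5; 6; 3; 11; 1; 4; 8]]);
 (mkst 12 [:: (0, 1); (0, 2); (0, 3); (0, 6); (1, 4); (1, 7); (2, 5); (2, 8); (2, 11); (3, 7); (3, 8); (3, 9); (4,
 8); (4, 9); (5, 6); (5, 7); (5, 9); (6, 10); (7, 11); (8, 10); (10, 11)] [:: (4, 11)], Prop_Q 4 (units [:: 11; 10;
 9; 8; 7; 6; 5; 4; 3; 2; 1; 0]) [:: Instance 83 [:: 7; 6; 1; 5; 11; 0; 9; 3; 12; 2; 4; 8]]);
 (mkst 12 [:: (0, 2); (0, 4); (0, 7); (0, 11); (1, 3); (1, 4); (1, 7); (2, 3); (2, 5); (2, 8); (3, 6); (3, 10); (4,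
 9); (5, 7); (5, 9); (5, 10); (6, 7); (6, 8); (6, 9); (8, 11); (10, 11)] [:: (4, 10)], Split 1 11 (Instance 90 [:: 6;
 9; 3; 7; 4; 2; 8; 5; 1; 0; 11; 10]) (Instance 90 [:: 5; 10; 7; 2; 11; 6; 9; 3; 0; 8; 4; 1]));
 (mkst 12 [:: (0, 2); (0, 4); (0, 7); (0, 11); (1, 3); (1, 4); (1, 7); (2, 3); (2, 5); (2, 8); (3, 6); (3, 9); (4,
 8); (4, 9); (4, 10); (5, 7); (5, 9); (5, 10); (6, 7); (6, 8); (6, 10); (9, 11)] [:: (6, 11); (8, 11); (10, 11)],
 Prop_Q 4 [:: (11, 1); (10, 1); (9, 1); (8, 1); (7, 1); (6, 2); (5, 1); (4, 1); (3, 1); (2, 1); (0, 1)] [:: Instance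
 91 [:: 0; 12; 7; 6; 11; 5; 3; 2; 1; 9; 10; 4]; Instance 91 [:: 9; 12; 3; 6; 11; 2; 7; 5; 1; 0; 8; 4]; Instance 91
 [:: 8; 3; 4; 9; 6; 0; 5; 2; 10; 7; 11; 12]]);
 (mkst 12 [:: (0, 2); (0, 3); (0, 4); (0, 7); (1, 3); (1, 5); (1, 8); (2, 5); (2, 8); (2, 11); (3, 6); (3, 9); (4,
 8); (4, 9); (4, 10); (5, 7); (5, 9); (5, 10); (6, 7); (6, 8); (6, 10); (9, 11)] [:: (6, 11); (10, 11)], Split 7 11
 (Instance 91 [:: 2; 7; 8; 6; 11; 4; 3; 0; 1; 9; 10; 5]) (Instance 92 [:: 2; 1; 0; 3; 5; 4; 6; 8; 7; 9; 10; 11]));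
 (mkst 12 [:: (0, 2); (0, 4); (0, 6); (0, 11); (1, 3); (1, 4); (1, 6); (2, 3); (2, 7); (3, 5); (3, 9); (4, 7); (4,
 8); (4, 9); (5, 6); (5, 7); (5, 8); (6, 10); (8, 10); (9, 10); (9, 11)] [:: (1, 11); (2, 8); (7, 11); (8, 11)],
 Instance 89 [:: 0; 1; 2; 3; 4; 5; 6; 7; 8; 9; 10; 11]);
 (mkst 12 [:: (0, 2); (0, 3); (0, 4); (0, 7); (1, 3); (1, 5); (1, 8); (2, 5); (2, 8); (2, 11); (3, 6); (3, 10); (4,
 8); (4, 9); (4, 10); (5, 7); (5, 9); (6, 7); (6, 8); (6, 9); (10, 11)] [:: (5, 10); (6, 11); (7, 10); (7, 11)],
 Prop_Q 3 (units [:: 11; 10; 9; 5; 4; 3; 2; 1; 0]) [:: Instance 93 [:: 8; 12; 4; 1; 6; 0; 5; 2; 9; 3; 7; 10];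
 Instance 90 [:: 8; 1; 4; 6; 5; 0; 2; 3; 9; 7; 12; 10]; Instance 93 [:: 4; 1; 12; 8; 0; 5; 6; 9; 3; 2; 7; 11];
 Instance 94 [:: 2; 4; 5; 9; 0; 6; 8; 7; 3; 12; 1; 11]]);
 (mkst 12 [:: (0, 1); (0, 2); (0, 3); (0, 6); (1, 4); (1, 7); (2, 5); (2, 8); (2, 11); (3, 7); (3, 8); (3, 9); (4,
 6); (4, 8); (4, 9); (5, 6); (5, 7); (5, 9); (6, 10); (7, 11); (10, 11)] [:: (3, 10); (8, 10); (9, 10); (9, 11)],
 Split 4 11 (Instance 93 [:: 5; 1; 6; 7; 2; 4; 3; 9; 0; 11; 8; 10]) (Instance 95 [:: 5; 1; 6; 7; 2; 4; 3; 9; 0; 8;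
 11; 10]));
 (mkst 12 [:: (0, 1); (0, 2); (0, 3); (0, 6); (1, 4); (1, 7); (2, 5); (2, 8); (2, 10); (3, 7); (3, 8); (3, 9); (4,
 6); (4, 8); (4, 9); (5, 6); (5, 7); (5, 9); (7, 10); (9, 11); (10, 11)] [:: (0, 11); (4, 10); (6, 10)], Prop_Q 4
 (units [:: 11; 10; 9; 8; 7; 6; 5; 4; 3; 2; 1; 0]) [:: Instance 93 [:: 0; 9; 6; 3; 2; 12; 7; 1; 5; 8; 10; 4];
 Instance 96 [:: 3; 8; 7; 0; 4; 5; 9; 2; 1; 6; 11; 10]]);
 (mkst 12 [:: (0, 2); (0, 3); (0, 6); (1, 3); (1, 4); (1, 6); (1, 8); (2, 4); (2, 7); (3, 7); (3, 10); (4, 5); (4,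
 10); (5, 6); (5, 7); (5, 11); (6, 9); (7, 9); (8, 9); (8, 11); (9, 10)] [:: (2, 11)], Prop_Q 3 (units [:: 11; 10; 9;
 8; 7; 5; 4; 3; 1]) [:: Instance 88 [:: 7; 9; 5; 12; 0; 3; 6; 11; 1; 4; 2]; Instance 88 [:: 12; 10; 7; 4; 8; 1; 9; 2;
 6; 5; 11]]);
 (mkst 12 [:: (0, 2); (0, 3); (0, 4); (0, 7); (1, 3); (1, 5); (1, 8); (2, 5); (2, 8); (3, 6); (3, 11); (4, 8); (4,
 9); (5, 7); (5, 9); (6, 7); (6, 8); (6, 9); (7, 10); (8, 10); (10, 11)] [:: (4, 11); (5, 11)], Prop_Q 3 (units [::
 11; 10; 8; 7; 5; 4; 3; 1; 0]) [:: Instance 89 [:: 3; 4; 1; 8; 12; 2; 0; 5; 5; 10; 7; 11]; Instance 98 [:: 10; 6; 11;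
 7; 3; 1; 8; 12; 9; 4; 0; 5]; Instance 98 [:: 10; 6; 11; 8; 3; 0; 7; 12; 9; 5; 1; 4]]);
 (mkst 12 [:: (0, 2); (0, 3); (0, 4); (0, 7); (1, 3); (1, 5); (1, 8); (2, 5); (2, 8); (3, 6); (3, 9); (4, 8); (4, 9);
 (4, 10); (4, 11); (5, 7); (5, 9); (5, 10); (6, 7); (6, 8); (6, 10)] [:: (2, 11); (3, 11); (5, 11); (6, 11); (7,
 11)], Join 2 11 (Instance 51 [:: 7; 10; 0; 4; 5; 3; 8; 6; 2; 9; 1; 11]));
 (mkst 12 [:: (0, 2); (0, 4); (0, 7); (1, 3); (1, 4); (1, 7); (2, 3); (2, 5); (2, 8); (3, 6); (3, 9); (4, 8); (4, 9);
 (4, 10); (5, 7); (5, 9); (5, 10); (5, 11); (6, 7); (6, 8); (6, 10)] [:: (0, 11); (4, 11); (6, 11); (8, 11)], Split 3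
 11 (Join 0 11 (Join 8 11 (Split 7 13 (Split 6 12 (Instance 97 [:: 6; 12; 8; 7; 11; 2; 3; 0; 13; 5; 4; 9]) (Instance
 97 [:: 6; 10; 3; 7; 4; 2; 8; 5; 1; 0; 11; 12])) (Instance 97 [:: 7; 1; 5; 6; 4; 2; 0; 3; 10; 8; 11; 13]))))
 (Instance 100 [:: 2; 1; 0; 3; 5; 4; 6; 8; 7; 9; 10; 11]));
 (mkst 12 [:: (0, 2); (0, 3); (0, 4); (0, 7); (0, 11); (1, 3); (1, 5); (1, 8); (2, 5); (2, 8); (3, 6); (3, 9); (4,
 8); (4, 9); (4, 10); (5, 7); (5, 9); (5, 10); (6, 7); (6, 8); (6, 10)] [:: (5, 11); (6, 11); (8, 11); (9, 11)],
 Split 1 11 (Instance 89 [:: 0; 9; 7; 5; 3; 10; 4; 6; 6; 1; 8; 11]) (Instance 101 [:: 9; 10; 3; 6; 5; 0; 8; 4; 1; 7;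
 2; 11]));
 (mkst 12 [:: (0, 2); (0, 3); (0, 4); (0, 7); (1, 3); (1, 5); (1, 8); (2, 5); (2, 8); (3, 6); (3, 9); (4, 8); (4, 9);
 (4, 10); (5, 7); (5, 9); (5, 10); (6, 7); (6, 8); (6, 10); (8, 11)] [:: (5, 11); (7, 11); (9, 11); (10, 11)], Split
 3 11 (Instance 101 [:: 7; 2; 6; 8; 5; 3; 4; 0; 10; 1; 9; 11]) (Instance 101 [:: 10; 7; 4; 0; 5; 8; 3; 6; 9; 2; 1;
 11]));
 (mkst 14 [:: (0, 2); (0, 3); (0, 5); (0, 8); (1, 3); (1, 4); (1, 5); (1, 8); (2, 4); (2, 6); (2, 9); (3, 6); (3, 9);
 (4, 7); (4, 10); (5, 9); (5, 10); (5, 11); (5, 13); (6, 8); (6, 10); (6, 11); (6, 13); (7, 8); (7, 9); (7, 11); (8,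
 12); (9, 12); (12, 13)] [:: (7, 13); (10, 12)], Split 11 12 (Split 4 13 (Instance 82 [:: 5; 9; 7; 8; 6; 13; 11; 12;
 0; 1; 2; 3; 4]) (Join 7 13 (Split 2 14 (Prop_Q 3 (units [:: 14; 13; 9; 8; 7; 6; 5; 3; 1]) [:: Instance 82 [:: 6; 8;
 7; 9; 5; 13; 11; 12; 3; 2; 15; 0; 14]; Instance 90 [:: 15; 14; 1; 9; 13; 8; 6; 7; 5; 12; 10; 4]]) (Split 1 14 (Split
 10 14 (Prop_Q 3 (units [:: 14; 10; 9; 8; 7; 6; 5; 2; 0]) [:: Instance 90 [:: 15; 14; 2; 8; 13; 9; 5; 7; 6; 12; 10;
 4]; Instance 82 [:: 6; 8; 7; 9; 5; 13; 11; 12; 3; 15; 1; 0; 14]]) (Instance 88 [:: 1; 3; 5; 6; 7; 8; 9; 10; 12; 13;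
 14])) (Instance 51 [:: 10; 11; 4; 7; 6; 1; 9; 5; 2; 8; 3; 14]))))) (Instance 57 [:: 5; 7; 0; 8; 9; 6; 11; 2; 12;
 13]));
 (mkst 11 [:: (0, 2); (0, 4); (0, 6); (0, 9); (1, 3); (1, 4); (1, 6); (1, 10); (2, 3); (2, 7); (3, 5); (3, 8); (4,
 7); (4, 8); (5, 6); (5, 7); (5, 9); (8, 9); (9, 10)] [:: (6, 8)], Join 6 8 (Instance 38 [:: 0; 5; 2; 6; 4; 3; 7; 1;
 8; 9; 10]));
 (mkst 12 [:: (0, 2); (0, 3); (0, 4); (0, 7); (1, 3); (1, 5); (1, 8); (1, 11); (2, 5); (2, 8); (3, 6); (3, 9); (4,
 8); (4, 9); (4, 10); (5, 7); (5, 9); (5, 10); (6, 7); (6, 8); (6, 10); (9, 11)] [:: (0, 11); (2, 11); (6, 11); (7,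
 11); (10, 11)], Join 0 11 (Instance 48 [:: 10; 6; 3; 5; 8; 0; 4; 7; 1; 2; 11; 9]));
 (mkst 12 [:: (0, 2); (0, 4); (0, 7); (1, 3); (1, 4); (1, 7); (2, 3); (2, 5); (2, 8); (3, 6); (3, 9); (4, 8); (4, 9);
 (4, 10); (5, 7); (5, 9); (5, 10); (6, 7); (6, 8); (6, 10); (9, 11); (10, 11)] [:: (0, 11); (2, 11); (7, 11); (8,
 11)], Split 1 11 (Instance 96 [:: 3; 9; 6; 2; 4; 7; 1; 5; 8; 0; 11; 10]) (Instance 106 [:: 7; 9; 1; 5; 6; 4; 2; 0;
 3; 10; 8; 11]));
 (mkst 13 [:: (0, 2); (0, 3); (0, 5); (0, 8); (1, 3); (1, 4); (1, 5); (1, 8); (2, 4); (2, 6); (2, 9); (3, 6); (3, 9);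
 (4, 7); (4, 10); (5, 9); (5, 10); (5, 11); (6, 8); (6, 10); (6, 11); (7, 8); (7, 9); (7, 11); (10, 12)] [:: (7, 12);
 (8, 12); (9, 12)], Split 2 12 (Split 11 12 (Split 3 12 (Instance 97 [:: 5; 11; 1; 9; 12; 4; 10; 7; 3; 2; 8; 6])
 (Split 1 12 (Instance 82 [:: 1; 5; 11; 6; 2; 4; 12; 10; 3; 8; 9; 0; 7]) (Instance 96 [:: 4; 10; 7; 1; 6; 9; 2; 5; 8;
 3; 12; 11]))) (Split 3 12 (Instance 96 [:: 4; 2; 1; 7; 6; 5; 10; 9; 8; 11; 12; 3]) (Split 1 12 (Join 7 12 (Split 5
 13 (Split 3 13 (Prop_Q 3 (units [:: 13; 12; 11; 8; 7; 6; 5; 2; 0]) [:: Instance 105 [:: 14; 10; 0; 5; 6; 13; 12; 3;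
 11; 7; 4]; Instance 104 [:: 0; 9; 8; 3; 7; 5; 6; 4; 2; 1; 11; 10; 12; 14]; Instance 93 [:: 7; 10; 11; 4; 9; 6; 1; 8;
 5; 2; 3; 14]]) (Split 6 13 (Instance 104 [:: 0; 9; 8; 3; 7; 5; 6; 4; 2; 1; 11; 10; 12; 13]) (Instance 101 [:: 2; 10;
 9; 5; 6; 7; 1; 4; 3; 11; 8; 13]))) (Split 0 13 (Split 6 13 (Prop_Q 3 (units [:: 13; 12; 11; 9; 7; 6; 5; 3; 1]) [::
 Instance 105 [:: 14; 10; 3; 6; 5; 13; 12; 0; 11; 7; 4]; Instance 104 [:: 0; 9; 8; 3; 7; 5; 6; 4; 2; 1; 11; 10; 12;
 14]; Instance 93 [:: 7; 10; 11; 4; 8; 5; 2; 9; 6; 1; 0; 14]]) (Instance 100 [:: 4; 3; 2; 1; 7; 6; 5; 10; 9; 8; 11;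
 13])) (Instance 101 [:: 1; 10; 8; 6; 5; 7; 2; 4; 0; 11; 9; 13])))) (Instance 48 [:: 11; 7; 4; 6; 9; 1; 5; 8; 2; 3;
 12; 10])))) (Instance 61 [:: 0; 1; 2; 4; 5; 6; 7; 8; 9; 10; 11; 12]));
 (mkst 12 [:: (0, 1); (0, 3); (0, 6); (1, 2); (1, 4); (1, 7); (1, 10); (2, 5); (2, 8); (3, 7); (3, 8); (3, 9); (3,
 10); (4, 6); (4, 8); (4, 9); (5, 6); (5, 7); (5, 9); (6, 11); (9, 11); (10, 11)] [:: (5, 10); (7, 11); (8, 11)],
 Join 5 10 (Prop_Q 4 [:: (12, 1); (10, 1); (9, 1); (8, 1); (6, 1); (5, 2); (4, 1); (3, 1); (2, 1); (1, 1); (0, 1)]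
 [:: Instance 88 [:: 4; 13; 9; 10; 2; 1; 5; 11; 7; 3; 8]; Instance 99 [:: 5; 4; 2; 6; 7; 8; 0; 13; 1; 3; 10; 11];
 Instance 88 [:: 13; 12; 9; 10; 2; 1; 5; 11; 7; 3; 8]]));
 (mkst 13 [:: (0, 2); (0, 3); (0, 5); (0, 8); (1, 3); (1, 4); (1, 5); (1, 8); (2, 4); (2, 6); (2, 9); (3, 6); (3, 9);
 (4, 7); (4, 10); (5, 9); (5, 10); (5, 11); (6, 8); (6, 10); (6, 11); (7, 8); (7, 9); (7, 11); (7, 12)] [:: (5, 12);
 (6, 12); (10, 12)], Split 1 12 (Split 2 12 (Join 10 12 (Instance 68 [:: 0; 1; 2; 3; 4; 5; 6; 7; 8; 9; 10; 11; 12;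
 13])) (Instance 101 [:: 2; 3; 4; 1; 6; 7; 5; 9; 10; 8; 11; 12])) (Instance 101 [:: 1; 0; 4; 2; 5; 7; 6; 8; 10; 9;
 11; 12]));
 (mkst 11 [:: (0, 2); (0, 4); (0, 7); (0, 9); (1, 3); (1, 4); (1, 7); (2, 3); (2, 5); (2, 8); (3, 6); (4, 8); (4,
 10); (5, 7); (5, 10); (6, 7); (6, 8); (9, 10)] [:: (1, 9); (8, 9)], Prop_Q 3 (units [:: 10; 8; 7; 6; 5; 4; 3; 2; 1])
 [:: Instance 38 [:: 11; 7; 2; 1; 10; 0; 5; 4; 9; 6; 8]; Instance 38 [:: 11; 2; 7; 8; 10; 0; 5; 4; 9; 3; 1]]);
 (mkst 12 [:: (0, 2); (0, 4); (0, 7); (0, 10); (1, 3); (1, 4); (1, 7); (2, 3); (2, 5); (2, 8); (3, 6); (3, 9); (4,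
 8); (4, 9); (5, 7); (5, 9); (5, 10); (6, 7); (6, 8); (8, 11); (9, 11); (10, 11)] [:: (1, 11); (3, 10); (6, 10)],
 Split 1 10 (Instance 97 [:: 4; 1; 8; 9; 10; 2; 0; 3; 11; 5; 6; 7]) (Instance 96 [:: 2; 5; 8; 3; 7; 4; 0; 9; 6; 1;
 10; 11]));
 (mkst 12 [:: (0, 1); (0, 3); (0, 6); (1, 2); (1, 4); (1, 7); (1, 10); (2, 5); (2, 8); (2, 11); (3, 7); (3, 8); (3,
 9); (3, 10); (4, 6); (4, 8); (4, 9); (5, 6); (5, 7); (5, 9); (6, 11); (10, 11)] [:: (5, 10); (7, 11); (9, 11)], Join
 7 11 (Prop_Q 3 (units [:: 12; 11; 9; 8; 7; 5; 4; 3; 2]) [:: Instance 105 [:: 13; 7; 4; 1; 3; 2; 5; 8; 10; 11; 12];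
 Instance 97 [:: 4; 8; 6; 1; 3; 5; 9; 2; 0; 7; 11; 13]; Instance 97 [:: 4; 8; 6; 1; 3; 5; 9; 2; 0; 7; 11; 12];
 Instance 97 [:: 4; 8; 6; 1; 3; 5; 9; 2; 0; 7; 11; 12]]));
 (mkst 12 [:: (0, 1); (0, 3); (0, 6); (1, 2); (1, 4); (1, 7); (1, 10); (2, 5); (2, 8); (2, 11); (3, 7); (3, 8); (3,
 9); (3, 10); (4, 6); (4, 8); (4, 9); (5, 6); (5, 7); (5, 9); (6, 11); (10, 11)] [:: (5, 10); (7, 11)], Split 9 11
 (Instance 109 [:: 0; 1; 2; 3; 4; 5; 6; 7; 8; 9; 10; 11]) (Instance 113 [:: 0; 1; 2; 3; 4; 5; 6; 7; 8; 9; 10; 11]));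
 (mkst 12 [:: (0, 2); (0, 4); (0, 7); (0, 10); (1, 3); (1, 4); (1, 7); (1, 11); (2, 3); (2, 5); (2, 8); (3, 6); (4,
 8); (4, 9); (5, 7); (5, 9); (5, 10); (6, 7); (6, 8); (6, 9); (9, 11); (10, 11)] [:: (6, 10); (8, 10); (8, 11)],
 Split 3 10 (Instance 97 [:: 1; 3; 4; 7; 10; 9; 11; 6; 0; 5; 8; 2]) (Instance 112 [:: 0; 8; 7; 6; 4; 5; 3; 2; 1; 9;
 10; 11]));
 (mkst 13 [:: (0, 2); (0, 3); (0, 5); (0, 8); (1, 3); (1, 4); (1, 5); (1, 8); (2, 4); (2, 6); (2, 9); (3, 6); (3, 9);
 (4, 7); (4, 10); (5, 9); (5, 10); (5, 11); (6, 8); (6, 10); (6, 11); (6, 12); (7, 8); (7, 9); (7, 11)] [:: (5, 12);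
 (7, 12); (9, 12)], Split 1 12 (Split 0 12 (Join 7 12 (Split 2 13 (Join 9 12 (Split 10 14 (Instance 112 [:: 0; 1; 2;
 4; 5; 6; 7; 8; 9; 10; 12; 14]) (Split 5 13 (Split 3 13 (Prop_Q 3 (units [:: 14; 12; 11; 9; 6; 5; 4; 2; 1]) [::
 Instance 64 [:: 10; 11; 4; 5; 15; 6; 1; 9; 5; 2; 12; 3; 13; 7; 8]; Instance 112 [:: 0; 1; 2; 4; 5; 6; 7; 8; 9; 15;
 12; 14]; Instance 112 [:: 0; 6; 5; 11; 2; 1; 7; 8; 9; 15; 12; 14]]) (Instance 114 [:: 8; 1; 5; 6; 4; 9; 7; 3; 10; 2;
 12; 13])) (Split 10 13 (Split 8 14 (Split 4 14 (Instance 85 [:: 1; 14; 3; 4; 5; 6; 7; 9; 10; 11; 12; 13]) (Prop_Q 4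
 [:: (14, 1); (13, 1); (12, 1); (10, 1); (9, 2); (8, 1); (7, 1); (6, 1); (5, 1); (3, 1); (1, 1)] [:: Instance 115 [::
 1; 10; 8; 15; 4; 0; 9; 5; 7; 2; 12; 6]; Instance 96 [:: 6; 11; 15; 10; 7; 1; 8; 5; 13; 4; 14; 9]])) (Prop_Q 4 [::
 (14, 1); (13, 1); (12, 2); (11, 1); (10, 1); (9, 1); (7, 1); (6, 1); (5, 1); (4, 1); (1, 1)] [:: Instance 93 [:: 4;
 3; 2; 1; 15; 6; 5; 10; 9; 12; 11; 13]; Instance 112 [:: 0; 1; 2; 4; 5; 6; 7; 8; 9; 10; 12; 15]; Instance 112 [:: 0;
 6; 5; 15; 2; 1; 14; 12; 9; 4; 8; 7]])) (Instance 103 [:: 7; 0; 9; 8; 4; 5; 6; 11; 2; 1; 10; 13]))))) (Split 3 13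
 (Join 2 13 (Split 10 14 (Prop_Q 4 (units [:: 14; 13; 12; 10; 9; 8; 7; 6; 5; 4; 2; 1]) [:: Instance 108 [:: 0; 1; 2;
 3; 4; 5; 6; 7; 8; 9; 10; 11; 14]; Instance 108 [:: 0; 1; 2; 3; 4; 5; 6; 7; 8; 9; 10; 11; 14]]) (Instance 98 [:: 5;
 3; 10; 1; 6; 2; 9; 4; 13; 7; 8; 14]))) (Instance 101 [:: 2; 10; 9; 5; 6; 7; 1; 4; 3; 11; 8; 13])))) (Instance 102
 [:: 6; 9; 11; 2; 8; 5; 4; 10; 7; 0; 1; 12])) (Split 4 12 (Split 0 12 (Join 9 12 (Split 10 13 (Split 8 13 (Instance
 59 [:: 13; 7; 10; 11; 4; 9; 6; 1; 8; 5; 2; 3; 0; 12]) (Instance 93 [:: 4; 11; 10; 7; 2; 5; 8; 1; 6; 9; 0; 13]))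
 (Split 11 13 (Split 8 13 (Instance 108 [:: 0; 9; 8; 3; 7; 5; 6; 4; 2; 1; 11; 10; 13]) (Instance 109 [:: 2; 4; 1; 6;
 7; 5; 9; 10; 8; 11; 12; 13])) (Instance 101 [:: 11; 8; 5; 1; 6; 9; 4; 7; 10; 3; 2; 13])))) (Instance 103 [:: 6; 1;
 10; 8; 2; 5; 7; 11; 4; 0; 9; 12])) (Split 0 12 (Join 7 12 (Split 5 13 (Split 2 13 (Join 1 12 (Split 11 14 (Instance
 112 [:: 0; 13; 8; 7; 5; 6; 4; 2; 1; 11; 12; 14]) (Split 9 14 (Instance 93 [:: 4; 0; 1; 2; 7; 5; 6; 10; 8; 9; 11;
 14]) (Split 3 13 (Split 2 14 (Split 7 14 (Split 10 14 (Join 9 12 (Prop_Q 3 (units [:: 15; 14; 12; 11; 9; 7; 6; 3;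
 1]) [:: Instance 103 [:: 7; 16; 14; 11; 8; 12; 5; 13; 1; 6; 0; 4]; Instance 85 [:: 7; 15; 13; 16; 14; 5; 6; 12; 1;
 10; 9; 3]; Instance 98 [:: 6; 0; 11; 8; 5; 9; 2; 7; 12; 14; 1; 15]])) (Instance 110 [:: 0; 1; 2; 3; 4; 5; 6; 7; 8;
 9; 10; 11; 14])) (Split 10 14 (Instance 108 [:: 0; 1; 2; 3; 4; 5; 6; 7; 8; 9; 10; 11; 14]) (Instance 102 [:: 1; 2;
 3; 4; 5; 6; 7; 8; 9; 10; 11; 14]))) (Split 7 14 (Instance 114 [:: 3; 13; 7; 6; 5; 4; 1; 2; 11; 10; 12; 14])
 (Instance 61 [:: 11; 10; 7; 4; 5; 8; 2; 6; 9; 1; 0; 14]))) (Split 7 14 (Split 10 14 (Join 3 13 (Split 8 15 (Split 10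
 15 (Instance 102 [:: 5; 6; 0; 10; 13; 8; 14; 1; 12; 15; 7; 9]) (Split 4 15 (Instance 89 [:: 6; 9; 10; 5; 2; 1; 3; 4;
 4; 13; 15; 12]) (Instance 107 [:: 10; 11; 4; 7; 6; 1; 9; 5; 2; 8; 3; 15]))) (Instance 98 [:: 7; 2; 8; 4; 6; 3; 9; 1;
 13; 5; 10; 15]))) (Instance 110 [:: 0; 1; 2; 3; 4; 5; 6; 7; 8; 9; 10; 11; 14])) (Split 10 14 (Instance 108 [:: 0; 1;
 2; 3; 4; 5; 6; 7; 8; 9; 10; 11; 14]) (Instance 102 [:: 1; 2; 3; 4; 5; 6; 7; 8; 9; 10; 11; 14]))))))) (Instance 109
 [:: 11; 7; 4; 5; 8; 2; 6; 9; 1; 0; 13; 12])) (Split 1 13 (Split 2 13 (Join 9 12 (Split 10 13 (Prop_Q 3 (units [::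
 14; 13; 12; 10; 9; 8; 7; 5; 0]) [:: Instance 115 [:: 0; 9; 8; 7; 5; 6; 4; 2; 1; 10; 12; 15]; Instance 103 [:: 6; 15;
 8; 10; 2; 7; 5; 11; 0; 4; 9; 12]; Instance 85 [:: 13; 14; 2; 15; 7; 6; 5; 9; 8; 11; 12; 0]]) (Instance 110 [:: 0; 1;
 2; 3; 4; 5; 6; 7; 8; 9; 10; 11; 13]))) (Split 10 13 (Join 9 12 (Split 8 14 (Split 4 14 (Instance 41 [:: 8; 10; 1; 6;
 14; 5; 2; 0; 4; 9; 12; 13]) (Split 11 14 (Instance 108 [:: 0; 9; 8; 3; 7; 5; 6; 4; 2; 1; 11; 10; 14]) (Instance 102
 [:: 8; 10; 1; 6; 7; 5; 2; 0; 4; 11; 9; 14]))) (Split 11 14 (Split 10 14 (Instance 115 [:: 9; 4; 5; 1; 2; 11; 8; 7;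
 0; 6; 14; 10]) (Instance 94 [:: 11; 10; 7; 13; 6; 1; 5; 8; 3; 12; 0; 14])) (Split 1 14 (Instance 93 [:: 4; 0; 1; 2;
 7; 5; 6; 10; 8; 9; 11; 14]) (Instance 101 [:: 11; 10; 7; 4; 6; 9; 1; 5; 8; 2; 3; 14]))))) (Instance 103 [:: 7; 3; 8;
 9; 4; 6; 5; 11; 1; 2; 10; 13]))) (Split 10 13 (Split 2 13 (Join 1 13 (Split 6 14 (Split 0 14 (Split 9 14 (Prop_Q 2
 (units [:: 13; 12; 11; 7; 5; 0]) [:: Prop_Q 2 (units [:: 13; 10; 8; 7; 5; 0]) [:: Instance 103 [:: 6; 16; 8; 10; 2;
 7; 5; 11; 0; 4; 9; 12]; Instance 103 [:: 6; 16; 10; 8; 14; 5; 7; 11; 13; 1; 9; 12]]; Instance 90 [:: 6; 10; 8; 11;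
 13; 0; 2; 5; 7; 15; 4; 1]]) (Join 9 12 (Prop_Q 3 (units [:: 15; 13; 12; 10; 9; 8; 7; 5; 0]) [:: Instance 115 [:: 1;
 10; 8; 16; 4; 0; 9; 5; 7; 2; 14; 6]; Instance 103 [:: 6; 16; 8; 10; 2; 7; 5; 11; 0; 4; 9; 12]; Instance 85 [:: 13;
 15; 2; 16; 7; 6; 5; 9; 8; 11; 12; 0]]))) (Instance 102 [:: 6; 9; 11; 2; 8; 5; 4; 10; 7; 0; 1; 14])) (Instance 62 [::
 11; 10; 7; 4; 6; 9; 1; 5; 8; 2; 0; 14]))) (Instance 102 [:: 7; 10; 11; 4; 9; 6; 1; 8; 5; 2; 3; 13])) (Instance 103
 [:: 6; 9; 11; 2; 8; 5; 4; 10; 7; 0; 1; 13]))))) (Instance 102 [:: 6; 9; 11; 2; 8; 5; 4; 10; 7; 0; 1; 12]))));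
 (mkst 12 [:: (0, 2); (0, 3); (0, 5); (0, 7); (1, 3); (1, 4); (1, 5); (1, 7); (2, 4); (2, 6); (2, 8); (3, 6); (3, 8);
 (4, 9); (4, 11); (5, 8); (5, 9); (6, 7); (6, 9); (7, 11); (8, 11); (10, 11)] [:: (2, 10); (3, 10); (5, 10); (6, 10);
 (9, 10)], Prop_Q 2 (units [:: 11; 9; 8; 7; 6; 5]) [:: Instance 108 [:: 0; 1; 2; 3; 4; 7; 8; 9; 5; 6; 11; 12; 10];
 Instance 103 [:: 1; 12; 7; 5; 4; 6; 8; 3; 11; 9; 2; 10]]);
 (mkst 12 [:: (0, 2); (0, 3); (0, 5); (0, 8); (1, 3); (1, 4); (1, 5); (1, 8); (2, 4); (2, 6); (2, 9); (3, 6); (3, 9);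
 (4, 7); (5, 9); (5, 11); (6, 8); (6, 11); (7, 8); (7, 9); (10, 11)] [:: (0, 10); (1, 10); (2, 10); (3, 10); (4, 10);
 (7, 10); (8, 10); (9, 10)], Prop_Q 3 (units [:: 11; 9; 8; 7; 6; 5; 4; 2; 1]) [:: Instance 117 [:: 0; 1; 2; 3; 12; 8;
 9; 5; 6; 7; 10; 11]; Instance 117 [:: 3; 8; 9; 0; 12; 1; 2; 6; 5; 4; 10; 11]]);
 (mkst 13 [:: (0, 2); (0, 3); (0, 5); (0, 8); (1, 3); (1, 4); (1, 5); (1, 8); (2, 4); (2, 6); (2, 9); (3, 6); (3, 9);
 (4, 7); (4, 10); (5, 9); (5, 10); (5, 11); (6, 8); (6, 10); (6, 11); (7, 8); (7, 9); (7, 11)] [:: (5, 12); (6, 12);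
 (7, 12); (8, 12); (9, 12); (10, 12)], Join 6 12 (Split 0 12 (Instance 63 [:: 6; 1; 10; 8; 2; 5; 7; 11; 4; 0; 9; 12])
 (Split 0 13 (Split 7 13 (Split 1 13 (Split 11 12 (Instance 11 [:: 9; 11; 2; 6; 5; 4; 8; 7; 0; 10; 1; 12]) (Instance
 103 [:: 4; 0; 1; 2; 7; 5; 6; 10; 13; 9; 11; 12])) (Instance 116 [:: 0; 9; 8; 3; 7; 5; 6; 4; 2; 1; 11; 10; 13]))
 (Join 8 12 (Split 5 14 (Split 4 13 (Split 9 13 (Instance 102 [:: 13; 1; 0; 4; 6; 5; 7; 9; 8; 10; 11; 12]) (Instance
 116 [:: 0; 1; 2; 3; 4; 5; 6; 7; 8; 9; 10; 11; 13])) (Split 9 13 (Split 2 12 (Instance 102 [:: 2; 1; 0; 4; 6; 5; 7;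
 9; 8; 10; 11; 12]) (Split 1 13 (Instance 38 [:: 5; 8; 11; 1; 9; 6; 7; 13; 2; 14; 12]) (Instance 116 [:: 0; 9; 8; 3;
 7; 5; 6; 4; 2; 1; 11; 10; 13]))) (Instance 116 [:: 0; 1; 2; 3; 4; 5; 6; 7; 8; 9; 10; 11; 13]))) (Split 11 14 (Split
 1 12 (Instance 102 [:: 1; 2; 3; 4; 5; 6; 7; 8; 9; 10; 11; 12]) (Split 2 14 (Split 10 14 (Instance 103 [:: 7; 10; 11;
 4; 8; 5; 2; 9; 14; 1; 0; 12]) (Instance 90 [:: 9; 2; 5; 7; 14; 1; 3; 4; 11; 8; 6; 10])) (Split 4 14 (Split 9 13
 (Prop_Q 4 (units [:: 14; 13; 12; 11; 9; 8; 7; 6; 5; 4; 2; 0]) [:: Instance 102 [:: 15; 1; 0; 4; 6; 5; 7; 9; 8; 10;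
 11; 12]; Instance 52 [:: 6; 15; 2; 11; 10; 0; 14; 8; 4; 5; 1; 12]; Instance 117 [:: 3; 2; 1; 0; 4; 6; 5; 9; 8; 10;
 12; 15]; Instance 103 [:: 6; 15; 11; 2; 8; 5; 4; 10; 14; 0; 1; 12]]) (Instance 116 [:: 0; 1; 2; 3; 4; 5; 6; 7; 8; 9;
 10; 11; 13])) (Instance 108 [:: 0; 9; 8; 3; 7; 5; 6; 4; 2; 1; 11; 10; 14])))) (Split 2 14 (Instance 7 [:: 4; 7; 10;
 11; 1; 9; 6; 2; 5; 3; 14; 8]) (Split 4 14 (Instance 110 [:: 0; 9; 8; 3; 7; 5; 6; 4; 2; 1; 11; 10; 14]) (Instance 102
 [:: 8; 10; 1; 6; 7; 5; 2; 0; 4; 11; 9; 14]))))))) (Split 1 13 (Split 7 13 (Split 4 12 (Instance 102 [:: 4; 3; 2; 1;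
 7; 6; 5; 10; 9; 8; 11; 12]) (Instance 61 [:: 2; 3; 4; 1; 6; 7; 5; 9; 10; 13; 11; 12])) (Instance 111 [:: 1; 0; 4; 2;
 8; 10; 9; 5; 7; 13; 6])) (Split 4 12 (Instance 102 [:: 4; 3; 2; 1; 7; 6; 5; 10; 9; 8; 11; 12]) (Split 9 13 (Split 3
 12 (Instance 61 [:: 11; 8; 5; 1; 6; 9; 4; 7; 10; 3; 2; 12]) (Split 4 13 (Instance 11 [:: 3; 13; 1; 4; 6; 5; 7; 9; 8;
 10; 11; 12]) (Instance 111 [:: 9; 4; 5; 1; 2; 11; 8; 7; 0; 13; 6]))) (Split 1 12 (Instance 102 [:: 1; 2; 3; 4; 5; 6;
 7; 8; 9; 10; 11; 12]) (Split 2 12 (Instance 102 [:: 2; 1; 0; 4; 6; 5; 7; 9; 8; 10; 11; 12]) (Split 3 12 (Instance 10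
 [:: 4; 3; 2; 1; 7; 6; 5; 10; 9; 8; 11; 12]) (Split 5 13 (Instance 118 [:: 0; 1; 2; 3; 4; 5; 6; 7; 8; 9; 12; 13])
 (Instance 103 [:: 7; 10; 11; 4; 8; 5; 2; 9; 6; 1; 0; 13])))))))))));
 (mkst 13 [:: (0, 2); (0, 3); (0, 5); (0, 8); (1, 3); (1, 4); (1, 5); (1, 8); (2, 4); (2, 6); (2, 9); (3, 6); (3, 9);
 (4, 7); (4, 10); (5, 9); (5, 10); (5, 11); (6, 8); (6, 10); (6, 11); (7, 8); (7, 9); (7, 11); (8, 12)] [:: (5, 12);
 (9, 12); (10, 12)], Split 11 12 (Split 4 12 (Prop_Q 3 (units [:: 12; 11; 9; 6; 5; 4; 3; 2; 1]) [:: Instance 116 [::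
 3; 2; 1; 0; 4; 6; 5; 12; 13; 8; 10; 11; 9]; Split 0 13 (Prop_Q 2 (units [:: 12; 11; 5; 4; 2; 0]) [:: Instance 64 [::
 10; 2; 5; 6; 9; 4; 11; 13; 6; 1; 7; 12; 8; 0; 14]; Instance 64 [:: 10; 11; 4; 6; 7; 5; 2; 8; 6; 1; 9; 0; 13; 12;
 14]]) (Instance 57 [:: 2; 8; 4; 1; 6; 5; 0; 10; 13; 9])]) (Instance 63 [:: 9; 8; 3; 7; 5; 6; 4; 2; 1; 11; 10; 12]))
 (Instance 103 [:: 4; 0; 1; 2; 7; 5; 6; 10; 8; 9; 11; 12]))].

Definition core2_certs : seq cert := [::
 Instance 119 [:: 7; 8; 9; 10; 11; 0; 4; 2; 3; 1; 5; 6; 12];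
 Instance 116 [:: 10; 9; 8; 7; 11; 4; 0; 2; 1; 3; 5; 6; 12];
 Instance 120 [:: 10; 9; 8; 7; 11; 4; 0; 2; 1; 3; 5; 6; 12];
 Instance 110 [:: 7; 8; 9; 10; 11; 0; 4; 2; 3; 1; 5; 6; 12];
 Instance 120 [:: 7; 8; 9; 10; 11; 0; 4; 2; 3; 1; 5; 6; 12];
 Instance 116 [:: 7; 8; 9; 10; 11; 0; 4; 2; 3; 1; 5; 6; 12];
 Instance 108 [:: 7; 8; 9; 10; 11; 0; 4; 2; 3; 1; 5; 6; 12];
 Instance 3 [:: 9; 11; 7; 8; 1; 5; 3; 4; 2; 0; 13; 12];
 Instance 3 [:: 8; 11; 10; 9; 0; 2; 4; 3; 5; 1; 13; 12];
 Instance 104 [:: 7; 8; 9; 10; 11; 0; 4; 2; 3; 1; 5; 6; 12; 13]].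

Definition core3_lemmas : seq (state * cert) := [::
 (mkst 12 [:: (0, 2); (0, 3); (0, 6); (1, 3); (1, 6); (1, 11); (2, 4); (2, 7); (2, 11); (3, 7); (3, 8); (3, 10); (4,
 6); (4, 8); (4, 10); (5, 6); (5, 7); (5, 8); (5, 11); (7, 9); (9, 10); (10, 11)] [:: (8, 9)], Join 8 9 (Instance 0
 [:: 2; 11; 0; 1; 4; 5; 3; 7; 10; 6; 8; 9]));
 (mkst 12 [:: (0, 2); (0, 4); (0, 7); (1, 3); (1, 4); (1, 7); (2, 3); (2, 5); (2, 8); (3, 6); (3, 11); (4, 8); (4,
 9); (4, 11); (5, 7); (5, 9); (5, 11); (6, 7); (6, 8); (6, 9); (7, 10); (8, 10); (10, 11)] [::], Split 9 10 (Instance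
 131 [:: 4; 8; 2; 5; 7; 1; 0; 9; 11; 6; 10; 3]) (Instance 132 [:: 0; 1; 2; 4; 5; 6; 7; 8; 9; 10; 11; 3]));
 (mkst 12 [:: (0, 2); (0, 4); (0, 7); (1, 3); (1, 4); (1, 7); (1, 11); (2, 3); (2, 5); (2, 8); (3, 6); (3, 9); (4,
 8); (4, 9); (4, 10); (5, 7); (5, 9); (5, 10); (5, 11); (6, 7); (6, 8); (6, 10)] [:: (0, 11)], Join 0 11 (Prop_Q 3
 (units [:: 12; 11; 10; 5; 4; 3; 2; 1; 0]) [:: Instance 133 [:: 1; 9; 7; 5; 3; 0; 10; 4; 6; 13; 8; 2]; Instance 132
 [:: 8; 10; 2; 4; 3; 7; 6; 0; 1; 12; 13; 5]; Instance 133 [:: 0; 8; 7; 6; 2; 1; 10; 4; 5; 13; 9; 3]]));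
 (mkst 12 [:: (0, 2); (0, 4); (0, 7); (1, 3); (1, 4); (1, 7); (1, 11); (2, 3); (2, 5); (2, 8); (3, 6); (3, 9); (4,
 8); (4, 9); (4, 10); (5, 7); (5, 9); (5, 10); (5, 11); (6, 7); (6, 8); (6, 10)] [:: (6, 11); (8, 11)], Join 6 11
 (Prop_Q 3 (units [:: 12; 11; 10; 6; 5; 4; 3; 2; 1]) [:: Instance 134 [:: 11; 2; 1; 3; 5; 4; 6; 13; 7; 9; 10; 8];
 Instance 134 [:: 1; 13; 7; 5; 4; 6; 2; 3; 0; 10; 8; 12]; Instance 134 [:: 5; 13; 7; 1; 2; 6; 4; 10; 0; 3; 8; 12]]));
 (mkst 12 [:: (0, 1); (0, 3); (0, 6); (0, 11); (1, 2); (1, 4); (1, 7); (2, 5); (2, 8); (3, 7); (3, 8); (4, 6); (4,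
 8); (4, 10); (5, 6); (5, 7); (5, 11); (6, 9); (7, 9); (9, 10); (10, 11)] [:: (8, 11)], Join 8 11 (Instance 50 [::
 10; 5; 9; 11; 4; 7; 0; 3; 6; 1; 2; 8]));
 (mkst 13 [:: (0, 2); (0, 4); (0, 7); (1, 3); (1, 4); (1, 7); (2, 3); (2, 5); (2, 8); (3, 6); (3, 9); (4, 8); (4, 9);
 (4, 10); (5, 7); (5, 9); (5, 10); (5, 12); (6, 7); (6, 8); (6, 10); (6, 12); (8, 11); (9, 11); (11, 12)] [:: (4,
 12)], Prop_Q 4 (units [:: 12; 11; 9; 8; 7; 6; 5; 4; 3; 2; 1; 0]) [:: Instance 133 [:: 0; 1; 2; 3; 4; 5; 6; 13; 8;
 10; 11; 9]; Instance 136 [:: 5; 2; 8; 9; 0; 6; 7; 3; 4; 1; 13; 12]]);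
 (mkst 12 [:: (0, 2); (0, 4); (0, 7); (1, 3); (1, 4); (1, 7); (2, 3); (2, 5); (2, 8); (2, 11); (3, 6); (3, 9); (4,
 8); (4, 9); (4, 10); (5, 7); (5, 9); (5, 10); (6, 7); (6, 8); (6, 10); (6, 11)] [:: (4, 11); (9, 11)], Split 1 11
 (Instance 134 [:: 9; 1; 5; 7; 4; 2; 6; 3; 10; 0; 8; 11]) (Instance 101 [:: 1; 0; 3; 2; 4; 6; 5; 7; 9; 8; 10; 11]));
 (mkst 12 [:: (0, 2); (0, 4); (0, 7); (1, 3); (1, 4); (1, 7); (1, 11); (2, 3); (2, 5); (2, 8); (3, 6); (3, 9); (4,
 8); (4, 9); (4, 10); (5, 7); (5, 9); (5, 10); (6, 7); (6, 8); (6, 10); (6, 11)] [:: (0, 11); (5, 11); (9, 11)], Join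
 9 11 (Split 2 12 (Split 7 12 (Split 10 12 (Instance 138 [:: 9; 1; 12; 7; 4; 2; 6; 3; 10; 0; 8; 11]) (Instance 138
 [:: 1; 9; 7; 5; 4; 6; 2; 3; 0; 10; 8; 12])) (Split 10 12 (Instance 135 [:: 9; 10; 3; 6; 4; 2; 7; 5; 1; 8; 0; 12])
 (Join 7 12 (Prop_Q 4 [:: (12, 1); (11, 1); (9, 1); (8, 1); (7, 1); (6, 1); (5, 1); (4, 2); (2, 1); (1, 1); (0, 1)]
 [:: Instance 135 [:: 1; 14; 3; 2; 4; 6; 5; 7; 9; 8; 10; 11]; Instance 138 [:: 1; 9; 14; 5; 4; 6; 2; 3; 0; 10; 8;
 12]; Instance 135 [:: 9; 14; 3; 6; 4; 2; 7; 5; 1; 8; 0; 12]; Instance 138 [:: 14; 2; 1; 3; 5; 4; 6; 8; 7; 9; 10;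
 11]])))) (Split 8 12 (Prop_Q 4 (units [:: 12; 11; 10; 9; 7; 6; 5; 4; 3; 2; 1; 0]) [:: Instance 138 [:: 9; 1; 13; 7;
 4; 2; 6; 3; 10; 0; 8; 11]; Instance 137 [:: 0; 1; 2; 3; 4; 5; 6; 7; 8; 9; 10; 12; 13]]) (Split 7 12 (Instance 135
 [:: 10; 9; 6; 3; 4; 7; 2; 5; 8; 1; 0; 12]) (Instance 61 [:: 0; 1; 2; 3; 4; 5; 6; 7; 8; 9; 10; 12])))));
 (mkst 12 [:: (0, 2); (0, 4); (0, 7); (1, 3); (1, 4); (1, 7); (2, 3); (2, 5); (2, 8); (2, 11); (3, 6); (3, 9); (4,
 8); (4, 9); (4, 10); (5, 7); (5, 9); (5, 10); (6, 7); (6, 8); (6, 10); (10, 11)] [:: (7, 11)], Split 1 11 (Instance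
 137 [:: 8; 0; 6; 7; 2; 10; 1; 4; 3; 5; 11; 9; 4]) (Instance 135 [:: 9; 10; 3; 6; 4; 2; 7; 5; 1; 8; 0; 11]));
 (mkst 12 [:: (0, 2); (0, 4); (0, 7); (1, 3); (1, 4); (1, 7); (2, 3); (2, 5); (2, 8); (2, 11); (3, 6); (3, 9); (4,
 8); (4, 9); (4, 10); (5, 7); (5, 9); (5, 10); (6, 7); (6, 8); (6, 10); (9, 11)] [:: (6, 11); (7, 11)], Split 10 11
 (Instance 140 [:: 0; 1; 2; 3; 4; 5; 6; 7; 8; 9; 10; 11]) (Split 1 11 (Instance 140 [:: 8; 10; 2; 5; 4; 3; 7; 6; 0;
 9; 1; 11]) (Instance 139 [:: 10; 9; 6; 3; 4; 7; 2; 5; 8; 1; 0; 11])));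
 (mkst 12 [:: (0, 2); (0, 4); (0, 7); (1, 3); (1, 4); (1, 7); (2, 3); (2, 5); (2, 8); (3, 6); (3, 9); (4, 8); (4, 9);
 (4, 10); (5, 7); (5, 9); (5, 10); (6, 7); (6, 8); (6, 10); (6, 11)] [:: (4, 11); (5, 11); (9, 11)], Split 0 11
 (Instance 135 [:: 1; 0; 3; 2; 4; 6; 5; 7; 9; 8; 10; 11]) (Split 2 11 (Instance 138 [:: 0; 1; 2; 3; 4; 5; 6; 7; 8; 9;
 10; 11]) (Split 1 11 (Instance 139 [:: 0; 1; 2; 3; 4; 5; 6; 7; 8; 9; 10; 11]) (Instance 51 [:: 9; 10; 3; 6; 4; 2; 7;
 5; 1; 8; 0; 11]))));
 (mkst 12 [:: (0, 2); (0, 4); (0, 7); (1, 3); (1, 4); (1, 7); (2, 3); (2, 5); (2, 8); (3, 6); (3, 9); (4, 8); (4, 9);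
 (4, 10); (5, 7); (5, 9); (5, 10); (6, 7); (6, 8); (6, 10); (7, 11)] [:: (4, 11); (8, 11); (9, 11)], Split 2 11
 (Instance 142 [:: 8; 10; 2; 5; 4; 3; 7; 6; 0; 9; 1; 11]) (Instance 142 [:: 9; 10; 3; 6; 4; 2; 7; 5; 1; 8; 0; 11]));
 (mkst 12 [:: (0, 2); (0, 4); (0, 7); (1, 3); (1, 4); (1, 7); (2, 3); (2, 5); (2, 8); (3, 6); (3, 9); (4, 8); (4, 9);
 (4, 10); (5, 7); (5, 9); (5, 10); (6, 7); (6, 8); (6, 10); (7, 11)] [:: (4, 11); (9, 11); (10, 11)], Split 8 11
 (Instance 134 [:: 10; 8; 5; 2; 4; 7; 3; 6; 9; 0; 1; 11]) (Instance 143 [:: 1; 0; 3; 2; 4; 6; 5; 7; 9; 8; 10; 11]));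
 (mkst 12 [:: (0, 2); (0, 4); (0, 7); (1, 3); (1, 4); (1, 7); (2, 3); (2, 5); (2, 8); (3, 6); (3, 9); (4, 8); (4, 9);
 (4, 10); (5, 7); (5, 9); (5, 10); (6, 7); (6, 8); (6, 10); (7, 11)] [:: (4, 11); (10, 11)], Split 8 11 (Instance 134
 [:: 10; 8; 5; 2; 4; 7; 3; 6; 9; 0; 1; 11]) (Instance 144 [:: 1; 0; 3; 2; 4; 6; 5; 7; 9; 8; 10; 11]));
 (mkst 12 [:: (0, 2); (0, 4); (0, 7); (1, 3); (1, 4); (1, 7); (2, 3); (2, 5); (2, 8); (3, 6); (3, 9); (4, 8); (4, 9);
 (4, 10); (5, 7); (5, 9); (5, 10); (6, 7); (6, 8); (6, 10); (6, 11)] [:: (1, 11); (2, 11); (4, 11); (5, 11)], Join 2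
 11 (Instance 51 [:: 9; 10; 3; 6; 4; 2; 7; 5; 1; 8; 0; 11]));
 (mkst 12 [:: (0, 2); (0, 4); (0, 7); (1, 3); (1, 4); (1, 7); (2, 3); (2, 5); (2, 8); (3, 6); (3, 9); (4, 8); (4, 9);
 (4, 10); (5, 7); (5, 9); (5, 10); (5, 11); (6, 7); (6, 8); (6, 10)] [:: (3, 11); (4, 11); (6, 11)], Split 0 11
 (Instance 141 [:: 10; 8; 5; 2; 4; 7; 3; 6; 9; 0; 1; 11]) (Instance 146 [:: 1; 0; 3; 2; 4; 6; 5; 7; 9; 8; 10; 11]));
 (mkst 12 [:: (0, 2); (0, 4); (0, 7); (0, 11); (1, 3); (1, 4); (1, 7); (2, 3); (2, 5); (2, 8); (3, 6); (3, 9); (4,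
 8); (4, 9); (4, 10); (5, 7); (5, 9); (5, 10); (6, 7); (6, 8); (6, 10)] [:: (1, 11); (8, 11)], Join 8 11 (Split 7 12
 (Split 3 12 (Split 10 12 (Instance 145 [:: 8; 10; 2; 5; 4; 3; 7; 12; 0; 9; 1; 11]) (Instance 145 [:: 0; 1; 2; 3; 4;
 5; 6; 7; 8; 9; 10; 12])) (Instance 147 [:: 10; 8; 5; 2; 4; 7; 3; 6; 9; 0; 1; 12])) (Split 3 12 (Instance 142 [:: 10;
 8; 5; 2; 4; 7; 3; 6; 9; 0; 1; 12]) (Instance 63 [:: 3; 10; 9; 6; 2; 4; 7; 1; 5; 8; 0; 12]))));
 (mkst 12 [:: (0, 2); (0, 4); (0, 7); (1, 3); (1, 4); (1, 7); (2, 3); (2, 5); (2, 8); (3, 6); (3, 9); (4, 8); (4, 9);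
 (4, 10); (5, 7); (5, 9); (5, 10); (6, 7); (6, 8); (6, 10); (9, 11); (10, 11)] [:: (0, 11); (2, 11); (7, 11)], Join 0
 11 (Instance 52 [:: 7; 9; 1; 5; 0; 3; 10; 6; 4; 2; 8; 11]));
 (mkst 12 [:: (0, 2); (0, 4); (0, 7); (1, 3); (1, 4); (1, 7); (2, 3); (2, 5); (2, 8); (3, 6); (3, 9); (4, 8); (4, 9);
 (4, 10); (5, 7); (5, 9); (5, 10); (6, 7); (6, 8); (6, 10); (8, 11); (9, 11)] [:: (1, 11); (7, 11)], Split 10 11
 (Instance 149 [:: 1; 0; 3; 2; 4; 6; 5; 7; 9; 8; 10; 11]) (Instance 132 [:: 0; 1; 2; 4; 5; 6; 7; 8; 10; 11; 9; 3]));
 (mkst 12 [:: (0, 2); (0, 4); (0, 7); (0, 11); (1, 3); (1, 4); (1, 7); (1, 11); (2, 3); (2, 5); (2, 8); (3, 6); (3,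
 9); (4, 8); (4, 9); (4, 10); (5, 7); (5, 9); (5, 10); (6, 7); (6, 8); (6, 10)] [:: (5, 11); (6, 11); (9, 11)], Split
 10 11 (Instance 150 [:: 1; 9; 7; 5; 4; 6; 2; 3; 0; 10; 8; 11]) (Instance 149 [:: 10; 8; 5; 2; 4; 7; 3; 6; 9; 0; 1;
 11]));
 (mkst 12 [:: (0, 2); (0, 4); (0, 7); (1, 3); (1, 4); (1, 7); (2, 3); (2, 5); (2, 8); (3, 6); (3, 9); (4, 8); (4, 9);
 (4, 10); (5, 7); (5, 9); (5, 10); (6, 7); (6, 8); (6, 10); (8, 11); (10, 11)] [:: (7, 11); (9, 11)], Split 3 11
 (Instance 147 [:: 8; 10; 2; 5; 4; 3; 7; 6; 0; 9; 1; 11]) (Instance 151 [:: 8; 10; 2; 5; 4; 3; 7; 6; 0; 9; 1; 11]));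
 (mkst 12 [:: (0, 2); (0, 4); (0, 7); (1, 3); (1, 4); (1, 7); (2, 3); (2, 5); (2, 8); (3, 6); (3, 9); (4, 8); (4, 9);
 (4, 10); (5, 7); (5, 9); (5, 10); (6, 7); (6, 8); (6, 10); (8, 11)] [:: (5, 11); (7, 11); (9, 11)], Split 10 11
 (Instance 152 [:: 0; 1; 2; 3; 4; 5; 6; 7; 8; 9; 10; 11]) (Split 0 11 (Split 3 11 (Instance 152 [:: 10; 9; 6; 3; 4;
 7; 2; 5; 8; 1; 0; 11]) (Instance 152 [:: 1; 9; 7; 5; 4; 6; 2; 3; 0; 10; 8; 11])) (Instance 148 [:: 8; 10; 2; 5; 4;
 3; 7; 6; 0; 9; 1; 11])));
 (mkst 12 [:: (0, 2); (0, 4); (0, 7); (1, 3); (1, 4); (1, 7); (2, 3); (2, 5); (2, 8); (3, 6); (3, 9); (3, 11); (4,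
 8); (4, 9); (4, 10); (4, 11); (5, 7); (5, 9); (5, 10); (6, 7); (6, 8); (6, 10)] [:: (5, 11); (7, 11)], Join 5 11
 (Split 6 12 (Join 7 11 (Split 2 13 (Split 0 12 (Instance 147 [:: 9; 10; 3; 6; 4; 2; 12; 5; 11; 8; 0; 13]) (Instance
 143 [:: 8; 10; 2; 5; 4; 3; 7; 6; 0; 9; 1; 12])) (Instance 147 [:: 10; 8; 5; 2; 4; 7; 3; 6; 9; 0; 1; 13]))) (Instance
 147 [:: 0; 1; 2; 3; 4; 5; 6; 7; 8; 9; 10; 12])));
 (mkst 12 [:: (0, 2); (0, 4); (0, 7); (1, 3); (1, 4); (1, 7); (2, 3); (2, 5); (2, 8); (3, 6); (3, 9); (4, 8); (4, 9);
 (4, 10); (4, 11); (5, 7); (5, 9); (5, 10); (6, 7); (6, 8); (6, 10)] [:: (2, 11); (5, 11); (6, 11); (7, 11)], Split 3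
 11 (Instance 154 [:: 0; 1; 2; 3; 4; 5; 6; 7; 8; 9; 10; 11]) (Join 7 11 (Split 2 12 (Split 10 12 (Join 3 11 (Split 9
 12 (Instance 154 [:: 1; 9; 7; 12; 4; 6; 2; 3; 0; 10; 8; 11]) (Instance 143 [:: 0; 1; 2; 3; 4; 5; 6; 7; 8; 9; 10;
 12]))) (Instance 143 [:: 0; 8; 7; 6; 4; 5; 3; 2; 1; 10; 9; 12])) (Split 8 12 (Split 10 12 (Split 3 12 (Instance 154
 [:: 0; 8; 7; 12; 4; 5; 3; 2; 1; 10; 9; 11]) (Instance 147 [:: 10; 8; 5; 2; 4; 7; 3; 6; 9; 0; 1; 12])) (Instance 134
 [:: 10; 8; 5; 2; 4; 7; 3; 6; 9; 0; 1; 12])) (Instance 142 [:: 9; 10; 3; 6; 4; 2; 7; 5; 1; 8; 0; 12])))));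
 (mkst 12 [:: (0, 2); (0, 4); (0, 7); (1, 3); (1, 4); (1, 7); (2, 3); (2, 5); (2, 8); (3, 6); (3, 9); (4, 8); (4, 9);
 (4, 10); (4, 11); (5, 7); (5, 9); (5, 10); (6, 7); (6, 8); (6, 10)] [:: (5, 11); (6, 11); (7, 11)], Split 2 11
 (Instance 155 [:: 1; 0; 3; 2; 4; 6; 5; 7; 9; 8; 10; 11]) (Instance 155 [:: 0; 1; 2; 3; 4; 5; 6; 7; 8; 9; 10; 11]));
 (mkst 12 [:: (0, 2); (0, 4); (0, 7); (1, 3); (1, 4); (1, 7); (2, 3); (2, 5); (2, 8); (3, 6); (3, 9); (4, 8); (4, 9);
 (4, 10); (5, 7); (5, 9); (5, 10); (6, 7); (6, 8); (6, 10); (8, 11)] [:: (5, 11); (10, 11)], Split 0 11 (Split 3 11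
 (Instance 152 [:: 10; 9; 6; 3; 4; 7; 2; 5; 8; 1; 0; 11]) (Instance 152 [:: 1; 9; 7; 5; 4; 6; 2; 3; 0; 10; 8; 11]))
 (Instance 148 [:: 8; 10; 2; 5; 4; 3; 7; 6; 0; 9; 1; 11]));
 (mkst 12 [:: (0, 2); (0, 4); (0, 7); (1, 3); (1, 4); (1, 7); (2, 3); (2, 5); (2, 8); (3, 6); (3, 9); (4, 8); (4, 9);
 (4, 10); (5, 7); (5, 9); (5, 10); (6, 7); (6, 8); (6, 10)] [:: (4, 11); (5, 11); (6, 11); (7, 11); (8, 11); (9,
 11)], Split 10 11 (Instance 148 [:: 10; 8; 5; 2; 4; 7; 3; 6; 9; 0; 1; 11]) (Split 3 11 (Instance 145 [:: 1; 9; 7; 5;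
 4; 6; 2; 3; 0; 10; 8; 11]) (Split 0 11 (Instance 153 [:: 8; 10; 2; 5; 4; 3; 7; 6; 0; 9; 1; 11]) (Split 2 11
 (Instance 145 [:: 0; 8; 7; 6; 4; 5; 3; 2; 1; 10; 9; 11]) (Join 6 11 (Split 4 12 (Split 5 12 (Instance 153 [:: 9; 1;
 5; 7; 4; 2; 6; 3; 12; 0; 8; 11]) (Split 2 12 (Instance 153 [:: 0; 1; 2; 3; 4; 5; 6; 7; 12; 9; 10; 11]) (Instance 156
 [:: 0; 8; 7; 6; 4; 5; 3; 2; 1; 10; 9; 12]))) (Split 2 12 (Split 9 12 (Split 1 12 (Instance 145 [:: 1; 9; 7; 5; 4; 6;
 2; 12; 0; 10; 8; 11]) (Instance 157 [:: 10; 8; 5; 2; 4; 7; 3; 6; 9; 0; 1; 12])) (Instance 145 [:: 0; 8; 7; 6; 4; 5;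
 3; 2; 1; 10; 9; 12])) (Split 1 12 (Split 5 12 (Split 0 12 (Instance 145 [:: 0; 1; 2; 3; 4; 5; 6; 12; 8; 9; 10; 11])
 (Instance 157 [:: 9; 10; 3; 6; 4; 2; 7; 5; 1; 8; 0; 12])) (Instance 153 [:: 9; 10; 3; 6; 4; 2; 7; 5; 1; 8; 0; 12]))
 (Instance 145 [:: 8; 10; 2; 5; 4; 3; 7; 6; 0; 9; 1; 12])))))))));
 (mkst 13 [:: (0, 2); (0, 4); (0, 7); (1, 3); (1, 4); (1, 7); (2, 3); (2, 5); (2, 8); (3, 6); (3, 9); (4, 8); (4, 9);
 (4, 10); (4, 12); (5, 7); (5, 9); (5, 10); (6, 7); (6, 8); (6, 10); (6, 12); (7, 11); (9, 11); (11, 12)] [:: (5,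
 12); (8, 11)], Split 2 11 (Instance 134 [:: 12; 9; 6; 3; 4; 7; 2; 11; 8; 1; 0; 5]) (Instance 135 [:: 10; 9; 6; 3; 4;
 7; 2; 5; 8; 1; 0; 11]))].

Definition core3_certs : seq cert := [::
 Instance 158 [:: 7; 8; 9; 10; 0; 4; 2; 3; 1; 5; 6; 11];
 Instance 156 [:: 7; 8; 9; 10; 0; 4; 2; 3; 1; 5; 6; 11];
 Instance 153 [:: 7; 8; 9; 10; 0; 4; 2; 3; 1; 5; 6; 11];
 Instance 142 [:: 7; 8; 9; 10; 0; 4; 2; 3; 1; 5; 6; 11];
 Instance 143 [:: 7; 8; 9; 10; 0; 4; 2; 3; 1; 5; 6; 11];
 Instance 142 [:: 8; 7; 10; 9; 0; 2; 4; 3; 5; 1; 6; 11];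
 Instance 153 [:: 8; 7; 10; 9; 0; 2; 4; 3; 5; 1; 6; 11];
 Instance 3 [:: 9; 10; 7; 8; 1; 5; 3; 4; 2; 0; 12; 11];
 Instance 159 [:: 7; 8; 9; 10; 0; 4; 2; 3; 1; 5; 6; 12; 11];
 Instance 159 [:: 8; 7; 10; 9; 0; 2; 4; 3; 5; 1; 6; 11; 12]].

(** * Libraries of refuted states *)

Definition narrow_sets : seq (seq nat) := [::] :: [seq [:: i] | i <- iota 0 6].
(** In the numbering of the cores these are the neighbour pairs of [a] and [u], of [v] and [b], and
    of [c] and [w] on the hexagon. *)
Definition opposed_sets : seq (seq nat * seq nat) :=
  [:: ([:: 1; 5], [:: 2; 4]); ([:: 0; 2], [:: 3; 5]); ([:: 1; 3], [:: 0; 4])].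
Definition extensions k :=
  [seq narrow k s | s <- narrow_sets] ++ [seq opposed k p.1 p.2 | p <- opposed_sets].
Definition stage lemmas targets certs : seq (state * cert) := lemmas ++ zip targets certs.
Definition hexagon_stage := stage hexagon_lemmas [:: point_matching; point_pentagon] hexagon_certs.
Definition centre_stage := stage centre_lemmas [:: centred_hexagon] centre_certs.
Definition core_stage k := nth [::]
  [:: stage core0_lemmas (extensions 0) core0_certs; stage core1_lemmas (extensions 1) core1_certs;
      stage core2_lemmas (extensions 2) core2_certs; stage core3_lemmas (extensions 3) core3_certs] k.
(** A core closes its stage in the library, because later stages may assume that it does not map
    into the graph. The first three cores have the indices 32, 82 and 131. *)
Fixpoint core_library k : seq state :=
  if k is j.+1 then core_library j ++ map fst (core_stage j) ++ [:: core_state j] else [::].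

Lemma core_stage_ok k : k < 4 -> check_all (core_library k) (core_stage k).
Proof. by case: k => [|[|[|[|]]]] // _; vm_compute. Qed.

(** * From refuted states to a colouring or a frame *)

Section Finite.
Variables (T : finType) (adj : rel T).
Hypothesis sym : symmetric adj.
Hypothesis irr : irreflexive adj.
Hypothesis tf : triangle_free adj.
Hypothesis common : forall x y, ~~ adj x y -> exists z, adj z x && adj z y.
Hypothesis Q4 : property_Q 4 adj.
Local Notation refuted := (refuted adj).
Local Notation valid := (valid adj).


Definition all_refuted (l : seq state) := forall k, k < size l -> refuted (nth (State [::] [::]) l k).
Definition bounded (l : seq state) := all (fun p => size (nonedges p) <= sz p) l.

Lemma all_refuted_cat l1 l2 : all_refuted (l1 ++ l2) <-> all_refuted l1 /\ all_refuted l2.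
Proof.
split=> [h|[h1 h2] k]; last first.
  rewrite size_cat nth_cat => kl; case: ltnP => k1; first exact: h1.
  by apply: h2; rewrite ltn_subLR.
split=> k kl.
  by have := h k; rewrite size_cat nth_cat kl ltn_addr // => /(_ isT).
by have := h (size l1 + k); rewrite size_cat nth_cat ltn_add2l kl ltnNge leq_addr addKn => /(_ isT).
Qed.

Lemma check_all_refuted lib l : all_refuted lib -> bounded lib -> bounded (map fst l) ->
  check_all lib l -> all_refuted (map fst l).
Proof.
move=> rl bl b c k; rewrite size_map => kl.
rewrite (nth_map (State [::] [::], Join 0 0 (Instance 0 [::]))) //.
apply: (check_all_sound sym irr tf common Q4) c k kl => //.
by move: b; rewrite /bounded all_map.
Qed.

Lemma stage_refuted lib lemmas targets certs : all_refuted lib -> bounded lib ->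
  bounded (map fst (stage lemmas targets certs)) -> size targets <= size certs ->
  check_all lib (stage lemmas targets certs) -> all_refuted targets.
Proof.
move=> rl bl b le c; have := check_all_refuted rl bl b c.
by rewrite /stage map_cat => /all_refuted_cat[_ h]; rewrite -(unzip1_zip le).
Qed.

Lemma hexagon_free : refuted induced_hexagon -> refuted point_matching /\ refuted point_pentagon.
Proof.
move=> r; have rl : all_refuted [:: induced_hexagon] by case.
have ok : check_all [:: induced_hexagon] hexagon_stage by vm_compute.
have h : all_refuted [:: point_matching; point_pentagon] by apply: stage_refuted rl _ _ _ ok.
by split; [apply: (h 0) | apply: (h 1)].
Qed.

Lemma centred_hexagon_core : refuted (core_state 3) -> refuted centred_hexagon.
Proof.
move=> r; have rl : all_refuted [:: core_state 3] by case.
have ok : check_all [:: core_state 3] centre_stage by vm_compute.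
have h : all_refuted [:: centred_hexagon] by apply: stage_refuted rl _ _ _ ok.
exact: (h 0).
Qed.

(** The certificates of stage [k] use only the cores before [k]. So the states of all stages up to
    [k] are refuted as soon as no earlier core maps into the graph. *)
Lemma core_library_refuted k : k < 4 -> (forall j, j < k -> refuted (core_state j)) ->
  all_refuted (core_library k ++ map fst (core_stage k)).
Proof.
elim: k => [|k IH] k4 min; apply/all_refuted_cat.
  by split=> //; apply: (@check_all_refuted [::]) => //; exact: core_stage_ok.
have rk : all_refuted (core_library k.+1).
  rewrite /= catA; apply/all_refuted_cat; split; first by apply: IH (ltnW k4) _ => j jk; apply: min (ltnW jk).
  by case=> // _; apply: min.
split=> //; apply: (check_all_refuted rk) (core_stage_ok k4); move: k4; clear;
  by case: k => [|[|[|]]] // _; vm_compute.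
Qed.

Lemma extensions_refuted k : k < 4 -> (forall j, j < k -> refuted (core_state j)) ->
  all_refuted (extensions k).
Proof.
move=> k4 min; have /all_refuted_cat[_] := core_library_refuted k4 min.
have [lemmas [certs [-> le]]] : exists lemmas certs,
    core_stage k = stage lemmas (extensions k) certs /\ size (extensions k) <= size certs.
  by move: k4; clear; case: k => [|[|[|[|//]]]] _; do 2!eexists; split; try reflexivity.
by rewrite /stage map_cat => /all_refuted_cat[_ h]; rewrite -(unzip1_zip le).
Qed.

Lemma core_narrow k s : k < 4 -> (forall j, j < k -> refuted (core_state j)) ->
  s \in narrow_sets -> refuted (narrow k s).
Proof.
move=> k4 min sN; have /all_refuted_cat[h _] := extensions_refuted k4 min.
have := h (index s narrow_sets); rewrite size_map index_mem sN => /(_ isT).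
by rewrite (nth_map [::]) ?index_mem // nth_index.
Qed.

Lemma core_opposed k s s' : k < 4 -> (forall j, j < k -> refuted (core_state j)) ->
  (s, s') \in opposed_sets -> refuted (opposed k s s').
Proof.
move=> k4 min sN; have /all_refuted_cat[_ h] := extensions_refuted k4 min.
have := h (index (s, s') opposed_sets); rewrite size_map index_mem sN => /(_ isT).
by rewrite (nth_map ([::], [::])) ?index_mem // nth_index.
Qed.

Lemma valid_edges (h : nat -> T) s L : valid h s -> all (fun p => bit2 (edges s) p.1 p.2) L ->
  all (fun p => adj (h p.1) (h p.2)) L.
Proof. by move=> [_ E _] /allP a; apply/allP => p /a /E. Qed.

(** Classical, since [refuted] quantifies over all maps from [nat]. *)
Lemma not_refuted s : ~ refuted s -> exists h, valid h s.
Proof. by move=> nr; apply: NNPP => ne; apply: nr => h v; apply: ne; exists h. Qed.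

Lemma first_core : ~ refuted (core_state 3) ->
  exists k, [/\ k < 4, forall j, j < k -> refuted (core_state j) & ~ refuted (core_state k)].
Proof.
move=> n3; case: (classic (refuted (core_state 0))) => [r0|n0]; last by exists 0.
case: (classic (refuted (core_state 1))) => [r1|n1]; last by exists 1; split=> // -[].
case: (classic (refuted (core_state 2))) => [r2|n2]; last by exists 2; split=> // -[|[]].
by exists 3; split=> // -[|[|[]]].
Qed.

(** The centre given by Q sees an alternating triple. If it is the odd one, the hexagon is
    renumbered by one step to match [centred_hexagon]. *)
Lemma hexagon_core h : valid h induced_hexagon -> ~ refuted (core_state 3).
Proof.
move=> v r3; have rc := centred_hexagon_core r3; have [_ E N] := v.
have e : all (fun p => adj (h p.1) (h p.2)) hexagon by apply: valid_edges v _.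
have n03 : ~~ adj (h 0) (h 3) by apply: N.
have n14 : ~~ adj (h 1) (h 4) by apply: N.
have n25 : ~~ adj (h 2) (h 5) by apply: N.
have [z] := hexagon_centre sym Q4 e.
move: e => /= /and5P[e01 e12 e23 e34 /and3P[e45 e05 _]] /orP[] /and3P[z1 z2 z3].
  apply: (rc (fun i => if i == 6 then z else h i)); apply: valid_mkst => //=.
    by rewrite e01 e12 e23 e34 e45 e05 ![adj _ z]sym z1 z2 z3.
  by rewrite n03 n14 n25.
apply: (rc (fun i => if i == 6 then z else if i == 5 then h 0 else h i.+1)); apply: valid_mkst => //=.
  by rewrite e12 e23 e34 e45 [adj (h 5) _]sym e05 [adj (h 1) (h 0)]sym e01 ![adj _ z]sym z1 z2 z3.
by rewrite n14 n25 [adj (h 3) _]sym n03.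
Qed.

(** The order of the arguments reflects the cyclic numbering [a v c u b w] of the hexagon in the
    cores. A failure of [fr_dom] would extend the core to a state [narrow], a failure of [fr_anti]
    to a state [opposed], and both are refuted. *)
Lemma core_frame k h : k < 4 -> (forall j, j < k -> refuted (core_state j)) ->
  valid h (core_state k) -> frame adj (h 0) (h 4) (h 2) (h 3) (h 1) (h 5) (h 6).
Proof.
move=> k4 min v.
have bd : all (fun p => (p.1 < (core k).1) && (p.2 < (core k).1)) (core k).2.
  by move: k4; clear; case: k => [|[|[|[|]]]].
have n6 : 6 < (core k).1 by move: k4; clear; case: k => [|[|[|[|]]]].
have eE : all (fun p => adj (h p.1) (h p.2)) (core k).2.
  by apply: valid_edges v _; move: k4; clear; case: k => [|[|[|[|]]]].
have : all (fun p => adj (h p.1) (h p.2)) (hexagon ++ [:: (0, 6); (2, 6); (4, 6)]).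
  by apply: valid_edges v _; move: k4; clear; case: k => [|[|[|[|]]]].
move=> /= /and5P[e01 e12 e23 e34 /and5P[e45 e05 e06 e26 /andP[e46 _]]].
(* Each opposite pair has a common neighbour among the numbers of the core, which [nonadj] finds by
   computation. *)
have opp i j : (i, j) \in [:: (0, 3); (4, 1); (2, 5)] -> ~~ adj (h i) (h j).
  move=> ij; apply: (nonadjP sym irr tf v); move: k4 ij; clear.
  by rewrite !inE; case: k => [|[|[|[|]]]] // _ /or3P[] /eqP[-> ->].
have lt6 i : i < 6 -> [/\ i < (core k).1, (i == (core k).1) = false & (i == (core k).1.+1) = false].
  by move: n6; clear => n6 i6; split; lia.
have w1 i : i < (core k).1 -> i < (core k).1.+1 by exact: ltnW.
have w2 i : i < (core k).1 -> i < (core k).1.+2 by move/w1/ltnW.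
split.
- by split; split; rewrite // sym.
- by split; rewrite sym.
- by split; apply: opp.
- move=> z; pose s := [seq i <- iota 0 6 | adj z (h i)].
  have -> : count id (trace adj (h 0) (h 4) (h 2) (h 3) (h 1) (h 5) z) = size s.
    rewrite /s /trace size_filter /=.
    by case: (adj z (h 0)); case: (adj z (h 1)); case: (adj z (h 2)); case: (adj z (h 3));
       case: (adj z (h 4)); case: (adj z (h 5)).
  rewrite ltnNge; apply/negP => s1.
  have sub : {subset s <= iota 0 6} by move=> i; rewrite mem_filter => /andP[].
  apply: (@core_narrow k s k4 min _ (fun i => if i == (core k).1 then z else h i)).
    move: s1 sub; rewrite !inE; case: (s) => [//|i [|//]] _ /(_ i); rewrite inE eqxx mem_iota => /(_ isT).
    by case: i => [|[|[|[|[|[|]]]]]].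
  apply: valid_mkst => //.
  + rewrite !all_cat -andbA; apply/and3P; split.
    * by apply: sub_all bd => p /andP[p1 p2]; rewrite !w1.
    * by apply/allP => _ /mapP[i + ->]; move=> /sub; rewrite mem_iota => /lt6[il _ _] /=; rewrite w1 // ltnSn.
    * by apply/allP => _ /mapP[i + ->]; rewrite mem_filter mem_iota => /andP[_ /lt6[il _ _]] /=; rewrite w1 // ltnSn.
  + rewrite all_cat; apply/andP; split.
      apply/allP => p pE; have /andP[p1 p2] := allP bd _ pE.
      by rewrite (ltn_eqF p1) (ltn_eqF p2) (allP eE).
    apply/allP => _ /mapP[i is_ ->] /=; have := sub _ is_; rewrite mem_iota => /lt6[_ -> _].
    by rewrite eqxx sym; move: is_; rewrite mem_filter => /andP[].
  + apply/allP => _ /mapP[i + ->] /=; rewrite mem_filter => /andP[ns ii].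
    move: (ii); rewrite mem_iota => /lt6[_ -> _].
    by rewrite eqxx sym; apply: contra ns => zi; rewrite mem_filter zi.
have anti s s' z z' : (s, s') \in opposed_sets ->
    (forall i, i < 6 -> adj z (h i) = (i \in s)) -> (forall i, i < 6 -> adj z' (h i) = (i \in s')) -> ~~ adj z z'.
  move=> ss zs zs'; apply/negP => zz'.
  have [sub sub'] : all (fun i => i < 6) s /\ all (fun i => i < 6) s'.
    by move: ss; rewrite !inE => /or3P[] /eqP[-> ->].
  apply: (@core_opposed k s s' k4 min ss (fun i => if i == (core k).1 then z else if i == (core k).1.+1 then z' else h i)).
  have n1 : ((core k).1.+1 == (core k).1) = false by rewrite gtn_eqF.
  apply: valid_mkst => //.
  + rewrite !all_cat -!andbA; apply/and5P; split.
    * by apply: sub_all bd => p /andP[p1 p2]; rewrite !w2.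
    * by apply/allP => _ /mapP[i /(allP sub)/lt6[il _ _] ->] /=; rewrite w2 // !ltnS leqnSn.
    * by apply/allP => _ /mapP[i /(allP sub')/lt6[il _ _] ->] /=; rewrite w2 // ltnSn.
    * by rewrite /= !ltnS leqnSn.
    * apply/and4P; split; [by rewrite /= ltnSn | by [] | |]; apply/allP => _ /mapP[i + ->]; rewrite mem_filter mem_iota => /andP[_ /lt6[il _ _]] /=;
        rewrite (w2 _ il) /=; clear; lia.
  + rewrite !all_cat; apply/and4P; split.
    * apply/allP => p pE; have /andP[p1 p2] := allP bd _ pE.
      by rewrite (ltn_eqF p1) (ltn_eqF p2) (ltn_eqF (w1 _ p1)) (ltn_eqF (w1 _ p2)) (allP eE).
    * apply/allP => _ /mapP[i ii ->] /=; have i6 := allP sub _ ii.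
      have [_ -> ->] := lt6 _ i6.
      by rewrite eqxx sym zs.
    * apply/allP => _ /mapP[i ii ->] /=; have i6 := allP sub' _ ii.
      have [_ -> ->] := lt6 _ i6.
      by rewrite n1 eqxx sym zs'.
    * by rewrite /= eqxx n1 eqxx zz'.
  + rewrite all_cat; apply/andP; split; apply/allP => _ /mapP[i + ->] /=; rewrite mem_filter mem_iota => /andP[ns i6];
      have [_ -> ->] := lt6 _ i6; rewrite ?n1 eqxx sym ?zs // zs' //.
move=> z z'; split=> -[e1 e2 e3 e4 e5 e6] [f1 f2 f3 f4 f5 f6].
- by apply: (@anti [:: 1; 5] [:: 2; 4]); rewrite // => -[|[|[|[|[|[|]]]]]].
(* This pair is listed with the trace of [v] before that of [b]. *)
- by rewrite sym; apply: (@anti [:: 0; 2] [:: 3; 5]); rewrite // => -[|[|[|[|[|[|]]]]]].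
- by apply: (@anti [:: 1; 3] [:: 0; 4]); rewrite // => -[|[|[|[|[|[|]]]]]].
Qed.

Lemma twin_free_structure (x0 : T) : (forall x y, adj x =1 adj y -> x = y) ->
  (exists2 k, 0 < k & blowup adj (andrasfai_adj k)) \/
  (exists i mu nu, 2 <= i /\ blowup_on adj (vega_adj i) (vega_vertices i mu nu)).
Proof.
move=> twin_free; case: (classic (refuted induced_hexagon)) => [r|/not_refuted[h v]].
  have [rm rp] := hexagon_free r; left.
  have [||A [B [C col]]] := @two_matching_colourable _ adj sym irr tf x0.
  - move=> a b c d ab cd; apply/negPn/negP; rewrite !negb_or => /and5P[n1 n2 n3 n4 /and4P[n5 n6 n7 n8]].
    apply: (rm (nth x0 [:: a; b; c; d; x0])); apply: valid_mkst => //=; first by rewrite ab cd.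
    by rewrite n1 n2 n3 n4 ![adj _ x0]sym n5 n6 n7 n8.
  - move=> c0 c1 c2 c3 c4 /and5P[e1 e2 e3 e4 e5]; apply/negPn/negP; rewrite !negb_or => /and5P[n1 n2 n3 n4 n5].
    apply: (rp (nth x0 [:: c0; c1; c2; c3; c4; x0])); apply: valid_mkst => //=.
      by rewrite e1 e2 e3 e4 [adj c0 _]sym e5.
    by rewrite ![adj _ x0]sym n1 n2 n3 n4 n5.
  exact: (@colouring_andrasfai _ adj sym irr tf common Q4 twin_free x0 _ _ _ col).
right; have [k [k4 min /not_refuted[g w]]] := first_core (hexagon_core v).
by apply: frame_blowup (core_frame k4 min w).
Qed.
End Finite.

(** * Reduction to twin-free graphs *)

(** A triangle of the enlarged graph uses the new edge, and only once since there are no loops; its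
    third vertex is the common neighbour. *)
Lemma add_edge_common (T : finType) (adj : rel T) x y : symmetric adj -> irreflexive adj ->
  triangle_free adj -> x != y -> ~ triangle_free (add_edge adj x y) -> exists z, adj z x && adj z y.
Proof.
move=> sym irr tf xy mx; apply/existsP; apply: contraT => /existsPn no; case: mx.
have no' z : adj z x -> adj z y -> False by move=> zx zy; have := no z; rewrite zx zy.
have xy' : x <> y by apply/eqP.
move=> p q r [pq [qr pr]]; move: pq qr pr; rewrite /add_edge -!orbA.
case/or3P => [pq|/andP[/eqP pq /eqP qp]|/andP[/eqP pq /eqP qp]];
case/or3P => [qr|/andP[/eqP qr /eqP rq]|/andP[/eqP qr /eqP rq]];
case/or3P => [pr|/andP[/eqP pr /eqP rp]|/andP[/eqP pr /eqP rp]]; subst; try by [].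
all: try by apply: (tf p q r).
all: try by rewrite irr in pq.
all: try by rewrite irr in qr.
all: try by rewrite irr in pr.
all: try by apply: (no' r); rewrite // sym.
all: try by apply: (no' q); rewrite // sym.
all: by apply: (no' p); rewrite // sym.
Qed.

Lemma maximal_common (T : finType) (adj : rel T) : symmetric adj -> irreflexive adj -> 2 <= #|T| ->
  maximal_triangle_free adj -> forall x y, ~~ adj x y -> exists z, adj z x && adj z y.
Proof.
move=> sym irr T2 [tf mx].
have neq x y : x != y -> ~~ adj x y -> exists z, adj z x && adj z y.
  by move=> xy nxy; apply: add_edge_common (mx x y xy nxy).
move=> x y nxy; case: (eqVneq x y) => [<-|xy]; last exact: neq.
(* For [x = y] a neighbour of [x] is wanted: any other vertex is one, or has a common neighbour with
   [x]. *)
have [z zx] : exists z, z != x.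
  apply/existsP; apply: contraLR T2 => /existsPn h; rewrite -leqNgt -(card1 x).
  by apply: subset_leq_card; apply/subsetP => z _; have := h z; rewrite negbK.
case: (boolP (adj z x)) => [zx'|nzx]; first by exists z; rewrite zx'.
by have [w /andP[_ wx]] := neq z x zx nzx; exists w; rewrite wx.
Qed.

Section Twins.
Variables (T : finType) (adj : rel T).
Hypothesis sym : symmetric adj.

(** The value of [pick] depends only on the extension of its predicate, so twins receive the same
    representative. *)
Definition twin_rep x := odflt x [pick y | [forall z, adj y z == adj x z]].

Lemma twin_repP x : adj (twin_rep x) =1 adj x.
Proof. by rewrite /twin_rep; case: pickP => [y /forallP h z|//]; apply/eqP. Qed.

Lemma twin_rep_eq x y : adj x =1 adj y -> twin_rep x = twin_rep y.
Proof.
move=> e; rewrite /twin_rep.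
rewrite (@eq_pick _ _ (fun w => [forall z, adj w z == adj y z])) => [|w]; last first.
  by apply: eq_forallb => z; rewrite e.
by case: pickP => // /(_ y) /forallP[] z.
Qed.

Lemma twin_rep_idem x : twin_rep (twin_rep x) == twin_rep x.
Proof. by apply/eqP/twin_rep_eq/twin_repP. Qed.

Definition twin_class := {x | twin_rep x == x}.
Definition class_of x : twin_class := exist _ (twin_rep x) (twin_rep_idem x).
Definition class_adj : rel twin_class := fun x y => adj (val x) (val y).

Lemma class_adjE x y : class_adj (class_of x) (class_of y) = adj x y.
Proof. by rewrite /class_adj /= twin_repP sym twin_repP sym. Qed.

Lemma class_of_val x : class_of (val x) = x.
Proof. by apply: val_inj; rewrite /= (eqP (valP x)). Qed.

Lemma class_twin_free x y : class_adj x =1 class_adj y -> x = y.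
Proof.
move=> e; rewrite -[x]class_of_val -[y]class_of_val; apply: val_inj; apply: twin_rep_eq => z.
by have := e (class_of z); rewrite /class_adj /= ![adj _ (twin_rep z)]sym !twin_repP ![adj z _]sym.
Qed.

Lemma class_property_Q n : property_Q n adj -> property_Q n class_adj.
Proof.
move=> Q m mn s; have [I [ind big]] := Q m mn (val \o s).
have ims : [set (val \o s) i | i in I] = [set val x | x in [set s i | i in I]] by rewrite -imset_comp.
exists I; split.
  by move=> x y xU yU; apply: ind; rewrite ims; apply: imset_f.
case: big => [|[cI [z zI]]]; [by left | right; split=> //].
exists (class_of z) => x xU; rewrite -[x]class_of_val class_adjE.
by apply: zI; rewrite ims; apply: imset_f.
Qed.

Lemma blowup_on_class (V : finType) (e : rel V) (S : pred V) :
  blowup_on class_adj e S -> blowup_on adj e S.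
Proof.
move=> [f [fS [fsurj fadj]]]; exists (f \o class_of); split; [|split].
- by move=> x; apply: fS.
- by move=> v /fsurj[x <-]; exists (val x); rewrite /= class_of_val.
- by move=> x y; rewrite /= -fadj class_adjE.
Qed.
End Twins.

Theorem theorem5p1 (T : finType) (adj : rel T)
    (adj_sym : symmetric adj) (adj_irr : irreflexive adj)
    (T_ge2 : 2 <= #|T|)
    (mtf : maximal_triangle_free adj) :
  property_Q 4 adj <->
  ((exists k : nat, 1 <= k /\ blowup adj (andrasfai_adj k)) \/
   (exists (i : nat) (mu nu : bool),
      2 <= i /\ blowup_on adj (vega_adj i) (vega_vertices i mu nu))).
Proof.
have tf : triangle_free adj by case: mtf.
have common := maximal_common adj_sym adj_irr T_ge2 mtf.
split=> [Q4|[[k [k1 G]]|[i [mu [nu [i2 G]]]]]]; last 2 first.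
- exact: andrasfai_property_Q G.
- exact: vega_property_Q G.
have /card_gt0P[x0 _] : 0 < #|T| by apply: ltnW.
have [|||||[k k0 G]|[i [mu [nu [i2 G]]]]] :=
  @twin_free_structure _ (class_adj (adj := adj)) _ _ _ _ _ (class_of adj x0) (class_twin_free adj_sym).
- by move=> x y; apply: adj_sym.
- by move=> x; apply: adj_irr.
- by move=> x y z h; apply: (tf (val x) (val y) (val z)).
- move=> x y /common[z /andP[zx zy]]; exists (class_of adj z).
  by rewrite -[x]class_of_val -[y]class_of_val !class_adjE ?zx.
- exact: class_property_Q.
- by left; exists k; split=> //; apply: blowup_on_class G.
- by right; exists i, mu, nu; split=> //; apply: blowup_on_class G.
Qed.
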